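(* Let $(X,x)$ be a non-F-pure simple elliptic singularity over an algebraically closed field $k$ of characteristic $p>0$, presented as $X=\operatorname{Spec}R$ with $R=\bigoplus_{n\ge0}H^0(E,L^n)t^n$, where $E$ is the elliptic exceptional curve on the minimal resolution $\widetilde{X}$, and suppose $E^2=-1$. Let $P_0$ be the point on $E\subset\widetilde{X}$ such that $\mathcal{O}_{\widetilde{X}}(-E)\otimes\mathcal{O}_E\cong\mathcal{O}_E(P_0)$, and let $\mathcal{I}_e\subset\mathcal{O}_{\widetilde{X}}$ be the ideal sheaf defining the fat point supported at $P_0\in\widetilde{X}$ whose local expression at $P_0$ is $$(\mathcal{I}_e)_{P_0}=(t,u^{p^e-1}),$$ where $t$ is the fiber coordinate of $\pi:\widetilde{X}\to E$ (with respect to a local trivialization of $L$ near $P_0$; so $t=0$ is the local equation of $E$) and $u$ is (the pullback by $\pi$ of) a regular parameter of $E$ at $P_0$. Then for any $e\ge1$ the blowup $\mathrm{Bl}_{\mathcal{I}_e}(\widetilde{X})$ of $\widetilde{X}$ at $\mathcal{I}_e$ coincides with the normalization of the $e$-th F-blowup $\mathrm{FB}_e(X)$.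
   Context: Blowup at a module: for a Noetherian integral scheme $X$ and a coherent sheaf $\mathcal{M}$, a modification $f:Y\to X$ is a flattening of $\mathcal{M}$ if the torsion-free pullback $f^{\star}\mathcal{M}=(f^*\mathcal{M})/\mathrm{tors}$ is flat (equivalently locally free); the blowup of $X$ at $\mathcal{M}$ is the universal flattening, through which every other flattening factors. The $e$-th F-blowup $\mathrm{FB}_e(X)$ is the blowup of $X$ at $F^e_*\mathcal{O}_X$ ($F$ the absolute Frobenius). Simple elliptic singularities: a simple elliptic singularity is a normal surface singularity whose minimal resolution has a single smooth elliptic curve $E$ as exceptional curve. It is quasi-homogeneous, so one takes $X=\operatorname{Spec}R$ with $R=R(E,L)=\bigoplus_{n\ge0}H^0(E,L^n)t^n$, $L$ an ample line bundle on the elliptic curve $E$, $\deg t=1$. The minimal resolution is $f:\widetilde{X}=\operatorname{Spec}_E\big(\bigoplus_{n\ge0}L^nt^n\big)\to X$, with $\mathbb{A}^1$-bundle projection $\pi:\widetilde{X}\to E$; the exceptional curve is the zero section of $\pi$, identified with $E$; $E^2=-\deg L$. Non-F-pure means that $\mathcal{O}_X\to F_*\mathcal{O}_X$ is not pure; this is equivalent to $E$ being a supersingular elliptic curve. *)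

(* Defs.v *)
From HB Require Import structures.
From mathcomp Require Import all_boot all_order all_algebra.
From mathcomp Require Import boolp classical_sets functions cardinality fsbigop.

Set Implicit Arguments.
Unset Strict Implicit.
Unset Printing Implicit Defensive.

Import Order.TTheory GRing.Theory Num.Theory.
Local Open Scope classical_set_scope.
Local Open Scope ring_scope.

(* All the schemes involved are integral, separated, and birational to X, so
   they are represented as "models" in the sense of Zariski (Zariski-Samuel II,
   Ch. VI, 17): a scheme Y with function field K is the set of its local rings
   O_{Y,y}, which are subrings of K.  A birational morphism Y' -> Y inducing
   the identity on K is unique when it exists; it exists iff every local ring
   of Y' dominates a local ring of Y.  Two schemes over X coincide (are
   isomorphic over X, compatibly with their function fields) iff they have
   the same set of local rings. *)

Section Models.
Variable K : fieldType.
Implicit Types (A B V R : set K) (M : set (set K)).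

Definition subring A : Prop := subring_closed (mem A).

Definition adjoin A (S : set K) : set K := smallest subring (A `|` S).

Definition prime_ideal A (P : set K) : Prop :=
  [/\ P `<=` A, P 0 /\ ~ P 1,
      forall x y, P x -> P y -> P (x + y),
      forall a x, A a -> P x -> P (a * x)
    & forall a b, A a -> A b -> P (a * b) -> P a \/ P b].

Definition localization A (P : set K) : set K :=
  [set x | exists a b, [/\ A a, A b, ~ P b & x = a / b]].

(* The local rings of Spec A, for a subring A of K. *)
Definition spec_model A : set (set K) :=
  [set B | exists2 P, prime_ideal A P & B = localization A P].

(* The set of nonunits; 0 is singled out because 0^-1 = 0. *)
Definition nonunits A : set K := [set x | A x /\ (x = 0 \/ ~ A x^-1)].

Definition dominates B' B : Prop := B `<=` B' /\ nonunits B `<=` nonunits B'.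

Definition valuation_ring V : Prop :=
  subring V /\ forall x, V x \/ V x^-1.

Definition factors_through M' M : Prop :=
  forall B', M' B' -> exists2 B, M B & dominates B' B.

(* For a Noetherian subring R of K with fraction field K: the proper
   birational integral R-schemes.  The first clause is finite type (a finite
   cover by spectra of finitely generated R-subalgebras of K); the second one
   is the valuative criterion, existence being universal closedness and
   uniqueness being separatedness. *)
Definition modification R M : Prop :=
  (exists s : seq (seq K),
     M = [set B | exists2 l, l \in s & spec_model (adjoin R [set` l]) B])
  /\ forall V, valuation_ring V -> R `<=` V ->
       exists! B, M B /\ dominates V B.

(* F^e_* R tensored with K over R is F^e_* K, that is, K on which c acts as
   multiplication by c ^ q, where q = p ^ e.  Hence (F^e_* R (x)_R B) / tors is
   the image of F^e_* R (x)_R B in F^e_* K. *)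
Definition torsionfree_pullback (q : nat) R B : set K :=
  [set x | exists n (c m : 'I_n -> K),
     [/\ forall i, B (c i), forall i, R (m i) & x = \sum_i c i ^+ q * m i]].

(* Freeness of finite rank of a B-submodule N of F^e_* K. *)
Definition free_pushforward (q : nat) B (N : set K) : Prop :=
  exists n (m : 'I_n -> K), (forall i, N (m i)) /\
    forall x, N x ->
      exists! c : 'I_n -> K, (forall i, B (c i)) /\ x = \sum_i c i ^+ q * m i.

Definition F_flattening (q : nat) R M : Prop :=
  modification R M /\
  forall B, M B -> free_pushforward q B (torsionfree_pullback q R B).

(* For q = p ^ e: the e-th F-blowup of Spec R. *)
Definition is_F_blowup (q : nat) R M : Prop :=
  F_flattening q R M /\
  forall M', F_flattening q R M' -> factors_through M' M.

Definition integral_closure A : set K :=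
  [set x | exists g : {poly K},
     [/\ g \is monic, forall i, A g`_i & root g x]].

(* The normalization of Y, base changed to Spec O_{Y,y}, is the spectrum of the
   integral closure of O_{Y,y}. *)
Definition normalization M : set (set K) :=
  [set B' | exists2 B, M B & spec_model (integral_closure B) B'].

(* An ideal sheaf on a model is the family I of its stalks.  Over Spec B the
   blowup Proj (\bigoplus_n I^n) is covered by the charts Spec B[I / a], for
   nonzero a in I. *)
Definition blowup M (I : set K -> set K) : set (set K) :=
  [set B' | exists B a, [/\ M B, I B a, a != 0
     & spec_model (adjoin B [set x / a | x in I B]) B']].

End Models.

(* A -> F_* A is pure: N -> N (x)_A F_* A is injective for all A-modules N.  By
   the universal property of the tensor product, x (x) 1 = 0 iff all balanced
   biadditive maps on N x F_* A vanish at (x, 1). *)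
Definition frobenius_balanced (p : nat) (A : comNzRingType) (N : lmodType A)
    (W : zmodType) (b : N -> A -> W) : Prop :=
  [/\ forall x y s, b (x + y) s = b x s + b y s,
      forall x s s', b x (s + s') = b x s + b x s'
    & forall a x s, b (a *: x) s = b x (a ^+ p * s)].

Definition F_pure (p : nat) (A : comNzRingType) : Prop :=
  forall (N : lmodType A) (x : N),
    (forall (W : zmodType) (b : N -> A -> W),
       frobenius_balanced p b -> b x 1 = 0) -> x = 0.

(* The smooth projective curve E over k with function field F: its closed
   points are the nontrivial valuation rings of F containing k, and P, as a
   subring of F, is the local ring O_{E,P}. *)
Section Curves.
Variables (k : closedFieldType) (F : fieldType) (iota : {rmorphism k -> F}).
Implicit Types (P : set F) (C : set F -> int).

Definition function_field_1 : Prop :=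
  exists x : F, ~ algebraicOver iota x /\
    exists n (b : 'I_n -> F), forall f : F,
      exists (c : {poly k}) (a : 'I_n -> {poly k}), c != 0 /\
        (map_poly iota c).[x] * f = \sum_i (map_poly iota (a i)).[x] * b i.

Definition place P : Prop :=
  [/\ valuation_ring P, range iota `<=` P & P <> setT].

Definition uniformizer P (u : F) : Prop :=
  nonunits P = [set u * a | a in P].

(* Divisors are functions on closed points; values elsewhere are irrelevant. *)
Definition divisor C : Prop := finite_set [set P | place P /\ C P != 0].

Definition degree C : int := \sum_(P \in [set P | place P]) C P.

Definition point_divisor P : set F -> int := fun Q => (Q == P)%:Z.

(* The stalk at P of O_E(C), as a subsheaf of the constant sheaf F. *)
Definition stalk C P : set F :=
  [set f | exists2 u, uniformizer P u & P (f * u ^ C P)].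

Definition global_sections C : set F :=
  [set f | forall P, place P -> stalk C P f].

Definition has_dim (S : set F) (n : nat) : Prop :=
  exists b : 'I_n -> F, (forall i, S (b i)) /\
    forall f, S f -> exists! c : 'I_n -> k, f = \sum_i iota (c i) * b i.

(* The genus is the maximum of deg C + 1 - dim H^0(E, O_E(C)). *)
Definition has_genus (g : nat) : Prop :=
  (forall C n, divisor C -> has_dim (global_sections C) n ->
     degree C + 1 - n%:Z <= g%:Z) /\
  exists C n, [/\ divisor C, has_dim (global_sections C) n
     & degree C + 1 - n%:Z = g%:Z].

Definition elliptic_curve : Prop := function_field_1 /\ has_genus 1.

(* In what follows L = O_E(D). *)
Variable D : set F -> int.

(* R(E, L), inside F[t], where t = 'X. *)
Definition section_ring : set {poly F} :=
  [set f | forall n, global_sections (fun P => D P *+ n) f`_n].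

(* The stalk at P of \bigoplus_n L^n t^n. *)
Definition cone_algebra P : set {poly F} :=
  [set f | forall n, stalk (fun Q => D Q *+ n) P f`_n].

(* The stalk at P of the ideal of the zero section in \bigoplus_n L^n t^n. *)
Definition zero_section_ideal P : set {poly F} :=
  [set f | cone_algebra P f /\ f`_0 = 0].

(* With I the ideal of the zero section E of Xtilde, f |-> f`_1 identifies
   I / I^2 = O_{Xtilde}(-E) (x) O_E with a subsheaf of the constant sheaf F;
   this is the stalk at P. *)
Definition conormal_stalk P : set F := [set f`_1 | f in zero_section_ideal P].

(* E^2 = deg (O_{Xtilde}(E) (x) O_E). *)
Definition zero_section_square (n : int) : Prop :=
  exists C, [/\ divisor C, forall P, place P -> conormal_stalk P = stalk C P
    & n = - degree C].

(* O_{Xtilde}(-E) (x) O_E is isomorphic to O_E(P0): an isomorphism between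
   invertible subsheaves of F is multiplication by a nonzero h in F. *)
Definition conormal_is_point (P0 : set F) : Prop :=
  exists2 h : F, h != 0 & forall P, place P ->
    conormal_stalk P = [set h * f | f in stalk (point_divisor P0) P].

(* The function field F(t) of Xtilde and X. *)
Local Notation K := {fraction {poly F}}.
Local Notation "f %:K" := (tofrac f : K) (at level 2, format "f %:K").

(* Xtilde = Spec_E (\bigoplus_n L^n t^n), as the set of its local rings. *)
Definition min_resolution : set (set K) :=
  [set B | exists2 P, place P & spec_model [set f%:K | f in cone_algebra P] B].

(* The local ring of Xtilde at the point P of the zero section E. *)
Definition zero_section_point P : set K :=
  localization [set f%:K | f in cone_algebra P]
    [set f%:K | f in [set f | cone_algebra P f /\ nonunits P f`_0]].

(* g trivializes L near P, so that g t is the fiber coordinate. *)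
Definition trivialization P (g : F) : Prop := stalk D P = [set g * a | a in P].

(* The ideal sheaf of the fat point (g t, u ^ (q - 1)) at P0: its stalk is the
   unit ideal away from P0. *)
Definition fat_point_ideal (q : nat) (P0 : set F) (g u : F) (B : set K) :
    set K :=
  [set x | B x /\ (B = zero_section_point P0 ->
     exists a b, [/\ B a, B b
       & x = a * (g *: 'X)%:K + b * ((u ^+ q.-1)%:P)%:K])].

End Curves.

(* Main.v *)
(** Put q = p^e, let w be a uniformizer of E at P0, and rescale t to T so that R becomes the ring of
    the sums of f_n T^n with f_n in H^0(n P0).  Both models are then described by valuation rings V of
    K containing R: the local ring of the center of V is the localization [Y V] of an explicit normal
    chart, O_P[T] off P0, and O_P0[T/w^q] or O_P0[T/w, w^q/T] over P0.  The last two are the charts of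
    the blowup of the ideal (T/w, w^(q-1)).

    Functions on E whose orders at P are distinct mod q form a basis of F over F^q.  Since E is
    supersingular, q P is not linearly equivalent to q P0 for P <> P0, so by Riemann-Roch such functions
    can be chosen in H^0(i P0) and H^0((i + q) P0) to form a basis of the degree i part of F_* O near P;
    the only exception is i = 0, P = P0.  There, if A_m has a pole of order m + 2 (m < q) and
    1 = \sum_m b_m^q A_m, then b_(q-1) and b_(q-2) have orders q + 1 and 1 at P0, so T/w^q and w^q/T are,
    up to units, ratios of the coefficients of this relation: the pullback to a chart containing one of
    them becomes free.

    Hence the blowup is a flattening and dominates FB.  Conversely, for B in FB dominated by [Y V], the
    determinant of a change of bases is a unit in B, so the coordinates of the elements of R in the
    basis over [Y V] lie in B.  They include a nonconstant function on E and, over P0, T/w^q or w^q/T up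
    to a unit; therefore the integral closure of B contains the chart, up to localization at V. *)

(* Non-purity is used by contraposition. A function with divisor q (P - P0) yields, after extracting
   p-th roots, a function h that is not a p-th power but whose divisor is divisible by p; the powers
   of h then split Frobenius compatibly with every H^0(n D). Supersingularity thus enters as the
   absence of p-power torsion. The case i = 0, P = P0 is exceptional because a basis there would
   need the orders -q, ..., -1 at P0 inside H^0(q P0), and genus one has no function with a single
   simple pole. The order N of b_(q-1) at P0 is not visible locally, where one only gets N >= 2. It
   is global: the last coordinate defines a Frobenius-semilinear map from H^0(2q P0), of dimension
   2q, onto H^0(N P0), of dimension N, and its kernel has dimension q - 1. FB is known only through
   its universal property, so none of its charts is explicit. This is why models are compared one
   valuation ring at a time, and why the passage down to FB uses only determinants and
   integrality. *)
Require Import Defs.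
From HB Require Import structures.
From mathcomp Require Import all_boot all_order all_algebra.
From mathcomp Require Import boolp classical_sets functions cardinality fsbigop.
From mathcomp Require Import ring zify.

Set Implicit Arguments.
Unset Strict Implicit.
Unset Printing Implicit Defensive.

Import Order.TTheory GRing.Theory Num.Theory.
Local Open Scope classical_set_scope.
Local Open Scope ring_scope.

(** * Subrings, valuation rings and models *)

Section Subrings.
Variable K : fieldType.
Implicit Types (A B C V : set K) (f g : {poly K}).

Lemma subringP A : subring A <->
  [/\ A 1, forall x y, A x -> A y -> A (x - y)
    & forall x y, A x -> A y -> A (x * y)].
Proof.
split=> [[h1 hB hM]|[h1 hB hM]]; split.
- by rewrite inE in h1.
- by move=> x y Ax Ay; have := hB x y; rewrite !inE; apply.
- by move=> x y Ax Ay; have := hM x y; rewrite !inE; apply.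
- by rewrite inE.
- by move=> x y; rewrite !inE; apply: hB.
- by move=> x y; rewrite !inE; apply: hM.
Qed.

Section Closure.
Variables (A : set K) (ringA : subring A).

Lemma sub1 : A 1. Proof. by case/subringP: ringA. Qed.
Lemma subB x y : A x -> A y -> A (x - y).
Proof. by case/subringP: ringA => _ + _; apply. Qed.
Lemma subM x y : A x -> A y -> A (x * y).
Proof. by case/subringP: ringA => _ _; apply. Qed.
Lemma sub0 : A 0. Proof. by rewrite -(subrr 1); apply: subB; apply: sub1. Qed.
Lemma subN x : A x -> A (- x).
Proof. by move=> Ax; rewrite -sub0r; apply: subB => //; apply: sub0. Qed.
Lemma subD x y : A x -> A y -> A (x + y).
Proof. by move=> Ax Ay; rewrite -[y]opprK; apply: subB => //; apply: subN. Qed.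
Lemma subX x n : A x -> A (x ^+ n).
Proof.
by move=> Ax; elim: n => [|n IH]; rewrite ?expr0 ?exprS; [apply: sub1|apply: subM].
Qed.
Lemma sub_sum I (r : seq I) (Q : pred I) (v : I -> K) :
  (forall i, Q i -> A (v i)) -> A (\sum_(i <- r | Q i) v i).
Proof. by move=> h; apply: big_ind => //; [apply: sub0|apply: subD]. Qed.
Lemma sub_prod I (r : seq I) (Q : pred I) (v : I -> K) :
  (forall i, Q i -> A (v i)) -> A (\prod_(i <- r | Q i) v i).
Proof. by move=> h; apply: big_ind => //; [apply: sub1|apply: subM]. Qed.

End Closure.

Definition polyover A f := forall i, A f`_i.

Definition polyring A (x : K) : set K := [set f.[x] | f in polyover A].

Lemma polyover_subring A : subring A ->
  [/\ polyover A 1, forall f g, polyover A f -> polyover A g -> polyover A (f - g)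
    & forall f g, polyover A f -> polyover A g -> polyover A (f * g)].
Proof.
move=> rA; split.
- by move=> i; rewrite coef1; case: eqP => _; [apply: sub1|apply: sub0].
- by move=> f g hf hg i; rewrite coefB; apply: subB.
- by move=> f g hf hg i; rewrite coefM; apply: sub_sum => // j _; apply: subM.
Qed.

Lemma overC A c : subring A -> A c -> polyover A c%:P.
Proof. by move=> rA Ac i; rewrite coefC; case: eqP => _ //; apply: sub0. Qed.

Lemma overX A : subring A -> polyover A 'X.
Proof. by move=> rA i; rewrite coefX; case: eqP => _; [apply: sub1|apply: sub0]. Qed.

Lemma polyring_subring A x : subring A -> subring (polyring A x).
Proof.
move=> rA; have [h1 hB hM] := polyover_subring rA.
apply/subringP; split.
- by exists 1; rewrite ?hornerC.
- by move=> _ _ [f hf <-] [g hg <-]; exists (f - g); rewrite ?hornerD ?hornerN //; apply: hB.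
- by move=> _ _ [f hf <-] [g hg <-]; exists (f * g); rewrite ?hornerM //; apply: hM.
Qed.

Lemma sub_polyring A x : subring A -> A `<=` polyring A x.
Proof. by move=> rA a Aa; exists a%:P; rewrite ?hornerC //; apply: overC. Qed.

Lemma polyring_gen A x : subring A -> polyring A x x.
Proof. by move=> rA; exists 'X; rewrite ?hornerX //; apply: overX. Qed.

Lemma polyring_min A B x : subring B -> A `<=` B -> B x -> polyring A x `<=` B.
Proof.
move=> rB AB Bx _ [f hf <-]; rewrite horner_coef; apply: sub_sum => // i _.
by apply: subM => //; [apply: AB|apply: subX].
Qed.

Lemma adjoin_subring A (S : set K) : subring (adjoin A S).
Proof.
apply/subringP; split.
- by move=> B [rB _]; apply: sub1.
- by move=> x y hx hy B hB; have [rB _] := hB; apply: subB; [|apply: hx|apply: hy].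
- by move=> x y hx hy B hB; have [rB _] := hB; apply: subM; [|apply: hx|apply: hy].
Qed.

Lemma sub_adjoin A S : A `<=` adjoin A S.
Proof. by move=> a Aa B [_]; apply; left. Qed.

Lemma adjoin_gen A S : S `<=` adjoin A S.
Proof. by move=> a Sa B [_]; apply; right. Qed.

Lemma adjoin_min A B S : subring B -> A `<=` B -> S `<=` B -> adjoin A S `<=` B.
Proof. by move=> rB AB SB x; apply; split=> // y []; [apply: AB|apply: SB]. Qed.

Lemma exprV_cancel (a c : K) m l : a != 0 -> (l <= m)%N ->
  a ^+ m * (c * a^-1 ^+ l) = a ^+ (m - l) * c.
Proof.
by move=> a0 le; rewrite -{1}(subnK le) exprD exprVn; field; rewrite expf_neq0.
Qed.

(* Pairs of a subring and a proper ideal, for Zorn's lemma. *)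
Let ring_ideal (BI : set K * set K) : Prop :=
  [/\ subring BI.1, BI.2 `<=` BI.1, ~ BI.2 1,
      forall x y, BI.2 x -> BI.2 y -> BI.2 (x + y)
    & (BI.2 0 /\ forall a x, BI.1 a -> BI.2 x -> BI.2 (a * x))].

Let ideal_sum B I n (v : 'I_n -> K) : ring_ideal (B, I) ->
  (forall i, I (v i)) -> I (\sum_i v i).
Proof. by case=> _ _ _ hD [h0 _] h; apply: big_ind. Qed.

Let extend B I x : ring_ideal (B, I) ->
  ~ polyring I x 1 -> ring_ideal (polyring B x, polyring I x).
Proof.
move=> rI; have [/= rB IB I1 ID [I0 IM]] := rI; move=> n1; split=> //=.
- exact: polyring_subring.
- by move=> _ [f hf <-]; exists f => // i; apply: IB.
- by move=> _ _ [f hf <-] [g hg <-]; exists (f + g); rewrite ?hornerD // => i;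
    rewrite coefD; apply: ID.
- split; first by exists 0; rewrite ?horner0 // => i; rewrite coef0.
  move=> _ _ [f hf <-] [g hg <-]; exists (f * g); rewrite ?hornerM // => i.
  by rewrite coefM; apply: (ideal_sum rI) => j; apply: IM.
Qed.

(** Chevalley's extension theorem. In a maximal pair (B, I), adjoining x to both shows that x lies
    in B or 1 lies in I[x]; if neither x nor x^-1 were in B, both I[x] and I[x^-1] would contain 1,
    which a descent on degrees excludes. *)
Lemma chevalley A (J : set K) : subring A -> J `<=` A -> ~ J 1 -> J 0 ->
  (forall x y, J x -> J y -> J (x + y)) ->
  (forall a x, A a -> J x -> J (a * x)) ->
  exists V, [/\ valuation_ring V, A `<=` V & J `<=` nonunits V].
Proof.
move=> rA JA J1 J0 JD JM.
pose T := {BI : set K * set K | `[< [/\ ring_ideal BI, A `<=` BI.1 & J `<=` BI.2] >]}.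
have T0 : T by exists (A, J); apply/asboolP; split.
pose R (s t : T) := `[< (sval s).1 `<=` (sval t).1 /\ (sval s).2 `<=` (sval t).2 >].
have [|||/= C totC|[[B I] /= hBI] /= maxI] := @Zorn T R.
- by move=> s; apply/asboolP; split.
- move=> r s t /asboolP[h1 h2] /asboolP[h3 h4]; apply/asboolP.
  by split; [apply: subset_trans h3|apply: subset_trans h4].
- move=> [[B1 I1] h1] [[B2 I2] h2] /asboolP[/= a b] /asboolP[/= c d].
  apply: eq_exist => /=; congr pair; by rewrite eqEsubset.
- have [[c0 Cc0]|nC] := pselect (exists c, C c); last first.
    by exists T0 => s Cs; case: nC; exists s.
  pose U : set K * set K := (\bigcup_(s in C) (sval s).1, \bigcup_(s in C) (sval s).2).
  have tot s t : C s -> C t -> exists r, [/\ C r, (sval s).1 `<=` (sval r).1,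
     (sval s).2 `<=` (sval r).2 & (sval t).1 `<=` (sval r).1 /\ (sval t).2 `<=` (sval r).2].
    by move=> Cs Ct; case: (totC s t Cs Ct) => /asboolP[h1 h2];
      [exists t|exists s]; do !split=> //.
  have hU : `[< [/\ ring_ideal U, A `<=` U.1 & J `<=` U.2] >].
    apply/asboolP; split; last 2 first.
    - move=> a Aa; exists c0 => //; case: (c0) => BI /= /asboolP[_ h _]; exact: h.
    - move=> a Aa; exists c0 => //; case: (c0) => BI /= /asboolP[_ _ h]; exact: h.
    split=> /=.
    - apply/subringP; split.
      + exists c0 => //; case: (c0) => BI /= /asboolP[[h _ _ _ _] _ _]; exact: sub1.
      + move=> x y [s Cs sx] [t Ct ty]; have [r [Cr h1 h2 [h3 h4]]] := tot s t Cs Ct.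
        exists r => //; move: h1 h3; case: (r) => BI /= /asboolP[[h _ _ _ _] _ _] h1 h3.
        by apply: subB => //; [apply: h1|apply: h3].
      + move=> x y [s Cs sx] [t Ct ty]; have [r [Cr h1 h2 [h3 h4]]] := tot s t Cs Ct.
        exists r => //; move: h1 h3; case: (r) => BI /= /asboolP[[h _ _ _ _] _ _] h1 h3.
        by apply: subM => //; [apply: h1|apply: h3].
    - move=> x [s Cs sx]; exists s => //; move: sx.
      by case: (s) => BI /= /asboolP[[_ h _ _ _] _ _]; apply: h.
    - by move=> [s Cs]; case: (s) => BI /= /asboolP[[_ _ h _ _] _ _].
    - move=> x y [s Cs sx] [t Ct ty]; have [r [Cr h1 h2 [h3 h4]]] := tot s t Cs Ct.
      exists r => //; move: h2 h4; case: (r) => BI /= /asboolP[[_ _ _ h _] _ _] h2 h4.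
      by apply: h => //; [apply: h2|apply: h4].
    - split.
        exists c0 => //; case: (c0) => BI /= /asboolP[[_ _ _ _ [h _]] _ _]; exact: h.
      move=> x y [s Cs sx] [t Ct ty]; have [r [Cr h1 h2 [h3 h4]]] := tot s t Cs Ct.
      exists r => //; move: h1 h4; case: (r) => BI /= /asboolP[[_ _ _ _ [_ h]] _ _] h1 h4.
      by apply: h; [apply: h1|apply: h4].
  exists (exist _ U hU) => s Cs; apply/asboolP; split=> x sx; exists s => //.
have /asboolP[/= rI AB JI] := hBI.
have maxBI B' I' : ring_ideal (B', I') -> B `<=` B' -> I `<=` I' -> B' `<=` B /\ I' `<=` I.
  move=> r' BB II.
  have h' : `[< [/\ ring_ideal (B', I'), A `<=` B' & J `<=` I'] >].
    by apply/asboolP; split => //; [apply: subset_trans BB|apply: subset_trans II].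
  have /(congr1 sval) /= : exist _ (B', I') h' = exist _ (B, I) hBI :> T.
    by apply: maxI; apply/asboolP.
  by move=> [-> ->]; split.
have [/= rB IB I1 ID [I0 IM]] := rI.
have IX n x : I x -> I (x ^+ n.+1).
  by move=> Ix; rewrite exprS mulrC; apply: IM => //; apply: subX => //; apply: IB.
have dich x : B x \/ polyring I x 1.
  case: (pselect (polyring I x 1)) => [?|n1]; [by right|left].
  have [||h _] := maxBI _ _ (extend rI n1).
  - exact: sub_polyring.
  - move=> a Ia; exists a%:P; rewrite ?hornerC // => i.
    by rewrite coefC; case: eqP => _ //.
  - by apply: h; apply: polyring_gen.
have I1u i : I i -> 1 + i != 0.
  move=> Ii; apply/eqP => e; apply: I1; rewrite -[1](addrK i) e sub0r -mulN1r.
  by apply: IM => //; apply: subN => //; apply: sub1.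
(* Otherwise 1 lies in I[(1 + i)^-1]; clearing denominators puts a power of 1 + i in I, but such a
   power is 1 + j with j in I. *)
have unit1 i : I i -> B (1 + i)^-1.
  move=> Ii; case: (dich (1 + i)^-1) => // -[f hf f1]; exfalso.
  have Bi : B (1 + i) by apply: subD => //; [apply: sub1|apply: IB].
  have In : I ((1 + i) ^+ size f * f.[(1 + i)^-1]).
    rewrite horner_coef mulr_sumr; apply: (ideal_sum rI) => j.
    by rewrite exprV_cancel ?I1u ?(ltnW (ltn_ord j)) //; apply: IM => //; apply: subX.
  rewrite f1 mulr1 in In.
  have [j Ij ej] : exists2 j, I j & (1 + i) ^+ size f = 1 + j.
    elim: (size f) => [|n [j Ij ej]]; first by exists 0; rewrite ?addr0.
    exists (j + i * (1 + j)).
      apply: ID => //; rewrite mulrC; apply: IM => //; apply: subD; rewrite ?rB //.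
        exact: sub1.
      exact: IB.
    by rewrite exprS ej; ring.
  apply: I1; rewrite ej in In.
  have -> : 1 = (1 + j) + (-1) * j by ring.
  by apply: ID => //; apply: IM => //; apply: subN => //; apply: sub1.
(* B is local with maximal ideal I. *)
have step f g x : x != 0 -> polyover I f -> polyover I g -> f.[x] = 1 -> g.[x^-1] = 1 ->
    (size g <= size f)%N -> exists2 f', polyover I f' & f'.[x] = 1 /\ (size f' < size f)%N.
  move=> x0 hf hg f1 g1 le.
  have sg : (0 < size g)%N.
    by rewrite lt0n size_poly_eq0; apply/eqP => g0; move: g1; rewrite g0 horner0 => /esym/eqP; rewrite oner_eq0.
  have [n sf] : exists n, size f = n.+1 by exists (size f).-1; rewrite prednK //; apply: leq_trans le.
  have [m sgm] : exists n, size g = n.+1 by exists (size g).-1; rewrite prednK.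
  have [g0I u0] : I (- g`_0) /\ B (1 - g`_0)^-1.
    have : I (- g`_0) by rewrite -mulN1r; apply: IM => //; apply: subN => //; apply: sub1.
    by move=> h; split => //; apply: unit1.
  pose w := (1 - g`_0)^-1.
  have w0 : 1 - g`_0 != 0 by apply: I1u.
  (* The equation g(x^-1) = 1 is solved for 1 after its constant term is absorbed by the unit 1 -
     g_0. Multiplying the top term f_n x^n by this expression replaces it by lower terms with
     coefficients in I. *)
  have e1 : 1 = \sum_(i < m) w * g`_i.+1 * x^-1 ^+ i.+1.
    apply: (mulfI w0); rewrite mulr_sumr mulr1 -{1}g1 horner_coef sgm big_ord_recl /=.
    rewrite expr0 mulr1 addrC addKr; apply: eq_bigr => i _.
    by rewrite /w /bump /= add1n; field.
  have le' : (m <= n)%N by rewrite -ltnS -sf -sgm.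
  pose f' := \poly_(i < n) f`_i + \sum_(i < m) (f`_n * w * g`_i.+1) *: 'X^(n - i.+1).
  exists f'.
    move=> i; rewrite coefD; apply: ID.
      by rewrite coef_poly; case: ltnP => _ //; apply: hf.
    rewrite coef_sum; apply: (ideal_sum rI) => l; rewrite coefZ coefXn.
    case: eqP => _; rewrite ?mulr1 ?mulr0 //; apply: IM; last exact: hg.
    by apply: subM => //; apply: IB; apply: hf.
  split.
    rewrite hornerD horner_poly horner_sum -[RHS]f1 (horner_coef f) sf big_ord_recr /=; congr +%R.
    rewrite -[RHS]mulr1 e1 mulr_sumr; apply: eq_bigr => i _.
    rewrite hornerZ hornerXn.
    have -> : x ^+ n = x ^+ (n - i.+1) * x ^+ i.+1 by rewrite -exprD subnK // (leq_trans (ltn_ord i)).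
    rewrite exprVn; field. by rewrite expf_neq0.
  rewrite sf ltnS (leq_trans (size_polyD _ _)) // geq_max size_poly.
  apply: (leq_trans (size_sum _ _ _)); apply/bigmax_leqP => i _.
  apply: leq_trans (size_scale_leq _ _) _; rewrite size_polyXn.
  by have := ltn_ord i; lia.
(* The roles of x and x^-1 are symmetric, so the longer of f and g is always the one that is
   shortened. *)
have no N : forall f g x, x != 0 -> polyover I f -> polyover I g -> f.[x] = 1 -> g.[x^-1] = 1 ->
    (size f + size g <= N)%N -> False.
  elim: N => [|N IH] f g x x0 hf hg f1 g1 le.
    move: le; rewrite leqn0 addn_eq0 size_poly_eq0 => /andP[/eqP f0 _].
    by move: f1; rewrite f0 horner0 => /esym/eqP; rewrite oner_eq0.
  case/orP: (leq_total (size g) (size f)) => l.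
    have [f' hf' [f1' lt]] := step f g x x0 hf hg f1 g1 l.
    by apply: (IH f' g x) => //; lia.
  have [|//|g' hg' [g1' lt]] := step g f x^-1 _ hg hf g1 _ l; rewrite ?invr_eq0 ?invrK //.
  by apply: (IH f g' x) => //; lia.
exists B; split => //.
- split=> // x; case: (eqVneq x 0) => [->|x0]; first by left; apply: sub0.
  case: (dich x) => [?|[f hf f1]]; first by left.
  case: (dich x^-1) => [?|[g hg g1]]; first by right.
  by case: (no _ f g x x0 hf hg f1 g1 (leqnn _)).
- move=> x /JI Ix; split; first exact: IB.
  case: (eqVneq x 0) => [|x0]; [by left|right => Bx].
  by apply: I1; rewrite -(mulVf x0); apply: IM.
Qed.

End Subrings.

Lemma ord_pred_sub n (i : 'I_n) : n = (i + (n.-1 - i)).+1.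
Proof. by have := ltn_ord i; lia. Qed.

(** * Local rings as centers of valuation rings, integral closure *)

Section Localizations.
Variable K : fieldType.
Implicit Types (A B C V W R : set K) (f g : {poly K}).

Lemma val_sub V : valuation_ring V -> subring V. Proof. by case. Qed.

Lemma sub_integral A : subring A -> A `<=` integral_closure A.
Proof.
move=> rA a Aa; exists ('X - a%:P); split; rewrite ?monicXsubC ?root_XsubC // => i.
by have [_ hB _] := polyover_subring rA; apply: hB; [apply: overX|apply: overC].
Qed.

Lemma integral_mono A B : A `<=` B -> integral_closure A `<=` integral_closure B.
Proof. by move=> AB x [g [gm hg gx]]; exists g; split=> // i; apply: AB. Qed.

Lemma integral_val A V : valuation_ring V -> A `<=` V -> integral_closure A `<=` V.
Proof.
move=> [rV dV] AV x [g [gm hg /rootP gx]].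
case: (dV x) => // Vx; case: (eqVneq x 0) => [->|x0]; first exact: sub0.
have : (0 < size g)%N by rewrite lt0n size_poly_eq0 monic_neq0.
case sg: (size g) => [//|n] _.
have gn : g`_n = 1 by move/monicP: gm; rewrite /lead_coef sg.
case: n => [|n] in sg gn *.
  by move: gx; rewrite horner_coef sg big_ord1 gn expr0 mulr1 => /eqP; rewrite oner_eq0.
move: gx; rewrite horner_coef sg big_ord_recr /= gn mul1r => /eqP.
rewrite addr_eq0 => /eqP e.
have -> : x = - \sum_(i < n.+1) g`_i * x^-1 ^+ (n - i).
  have e2 : x = x ^+ n.+1 * x^-1 ^+ n by rewrite exprS exprVn mulfK // expf_neq0.
  rewrite [LHS]e2 -[x ^+ n.+1]opprK -e mulNr mulr_suml; congr (- _).
  apply: eq_bigr => i _; rewrite -mulrA; congr (_ * _).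
  have -> : x^-1 ^+ n = x^-1 ^+ (n - i) * x^-1 ^+ i by rewrite -exprD subnK // -ltnS.
  by rewrite mulrCA -exprMn mulfV // expr1n mulr1.
apply: subN => //; apply: sub_sum => // i _; apply: subM => //; first exact: AV.
exact: subX.
Qed.

(** If x^-1 is a unit of A[x^-1], then 1 = x^-1 f(x^-1), multiplied by a power of x, is a monic
    equation for x; its coefficients are those of f reversed. If not, Chevalley's theorem gives a
    valuation ring in which x^-1 is a nonunit, so x is missing. That integral elements form a ring
    is deduced from this. *)
Lemma integral_of_val A x : subring A ->
  (forall V, valuation_ring V -> A `<=` V -> V x) -> integral_closure A x.
Proof.
move=> rA h; case: (eqVneq x 0) => [->|x0].
  by apply: sub_integral => //; apply: sub0.
pose B := polyring A x^-1; have rB : subring B by apply: polyring_subring.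
pose J : set K := [set x^-1 * b | b in B].
case: (pselect (J 1)) => [[_ [f hf <-] f1]|n1].
  pose g : {poly K} := 'X^(size f) - \poly_(i < size f) f`_((size f).-1 - i).
  exists g; rewrite {}/g.
  have s1 : (size (\poly_(i < size f) f`_((size f).-1 - i))%R <= size f)%N by apply: size_poly.
  split.
  - apply/monicP; by rewrite lead_coefDl ?lead_coefXn // size_polyXn size_polyN ltnS.
  - move=> i; rewrite coefB coefXn coef_poly; apply: subB => //.
      by case: eqP => _; [apply: sub1|apply: sub0].
    by case: ifP => _ //; apply: sub0.
  - apply/rootP; rewrite hornerD hornerN hornerXn horner_poly.
    rewrite -[X in X - _]mulr1 -f1 horner_coef mulr_sumr mulr_sumr.
    rewrite (reindex_inj rev_ord_inj) /= -sumrB big1 // => i _.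
    have -> : (size f - i.+1 = (size f).-1 - i)%N by lia.
    set m := ((size f).-1 - i)%N.
    have -> : x ^+ size f = x ^+ (i + m) * x.
      by rewrite -exprSr; congr (_ ^+ _); apply: ord_pred_sub.
    by rewrite exprD exprVn; field; rewrite expf_neq0 // x0.
have [V [vV BV JV]] : exists V, [/\ valuation_ring V, B `<=` V & J `<=` nonunits V].
  apply: chevalley => //.
  - move=> _ [b Bb <-]; apply: subM => //; exact: polyring_gen.
  - by exists 0; rewrite ?mulr0 //; apply: sub0.
  - by move=> _ _ [b Bb <-] [c Bc <-]; exists (b + c); rewrite ?mulrDr //; apply: subD.
  - by move=> a _ Ba [b Bb <-]; exists (a * b); rewrite ?mulrA 1?[a * _]mulrC //; first exact: subM.
have [_] : nonunits V x^-1 by apply: JV; exists 1; rewrite ?mulr1 //; apply: sub1.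
rewrite invrK; case=> [/eqP|nV]; first by rewrite invr_eq0 (negPf x0).
by exfalso; apply: nV; apply: h => //; apply: subset_trans BV; apply: sub_polyring.
Qed.

Lemma integral_subring A : subring A -> subring (integral_closure A).
Proof.
move=> rA; apply/subringP; split; first by apply: sub_integral => //; apply: sub1.
- move=> x y hx hy; apply: integral_of_val => // V vV AV.
  by apply: subB; [apply: val_sub|apply: (integral_val vV AV)..].
- move=> x y hx hy; apply: integral_of_val => // V vV AV.
  by apply: subM; [apply: val_sub|apply: (integral_val vV AV)..].
Qed.

Definition unit_in V (b : K) : Prop := [/\ V b, b != 0 & V b^-1].

Lemma unit_inM V a b : subring V -> unit_in V a -> unit_in V b -> unit_in V (a * b).
Proof.
move=> rV [Va a0 Va'] [Vb b0 Vb']; split; rewrite ?mulf_neq0 ?invfM //; exact: subM.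
Qed.

Lemma unit_in1 V : subring V -> unit_in V 1.
Proof. by move=> rV; split; rewrite ?invr1 ?oner_eq0 //; apply: sub1. Qed.

Lemma unit_nonunits V b : V b -> ~ nonunits V b <-> unit_in V b.
Proof.
move=> Vb; split=> [h|[_ b0 Vb'] [_ [/eqP|//]]]; last by rewrite (negPf b0).
split=> //; first by apply/eqP => b0; apply: h; split=> //; left.
by apply: contrapT => h'; apply: h; split=> //; right.
Qed.

(* The local ring of Spec C at the center of V. *)
Definition loc V C : set K :=
  [set x | exists a b, [/\ C a, C b, unit_in V b & x = a / b]].

Lemma sub_loc V C : subring V -> subring C -> C `<=` loc V C.
Proof.
by move=> rV rC a Ca; exists a, 1; split; rewrite ?divr1 //; [apply: sub1|apply: unit_in1].
Qed.

Lemma loc_sub V C : subring V -> C `<=` V -> loc V C `<=` V.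
Proof. by move=> rV CV _ [a [b [Ca Cb [Vb b0 Vb'] ->]]]; apply: subM => //; apply: CV. Qed.

Lemma loc_subring V C : subring V -> subring C -> subring (loc V C).
Proof.
move=> rV rC; apply/subringP; split; first by apply: sub_loc => //; apply: sub1.
- move=> _ _ [a [b [Ca Cb ub ->]]] [c [d [Cc Cd ud ->]]].
  exists (a * d - c * b), (b * d); split; [|exact: subM|exact: unit_inM|].
    by apply: subB => //; apply: subM.
  by case: ub ud => _ b0 _ [_ d0 _]; field; rewrite b0 d0.
- move=> _ _ [a [b [Ca Cb ub ->]]] [c [d [Cc Cd ud ->]]].
  exists (a * c), (b * d); split; [exact: subM|exact: subM|exact: unit_inM|].
  by case: ub ud => _ b0 _ [_ d0 _]; field; rewrite b0 d0.
Qed.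

Lemma loc_mono V C C' : C `<=` C' -> loc V C `<=` loc V C'.
Proof. by move=> h _ [a [b [Ca Cb ub ->]]]; exists a, b; split=> //; apply: h. Qed.

Lemma loc_loc V C C' : subring V -> subring C -> C `<=` C' -> C' `<=` loc V C ->
  loc V C' = loc V C.
Proof.
move=> rV rC CC h; rewrite eqEsubset; split; last exact: loc_mono.
move=> _ [a [b [/h[a1 [s [Ca Cs us ->]]] /h[b1 [t [Cb Ct ut eb]]] ub ->]]].
have [[_ s0 _] [_ t0 _] [_ b0 _]] := And3 us ut ub.
have eb1 : b1 = b * t by rewrite eb; field.
exists (a1 * t), (s * b1); split; [exact: subM|exact: subM| |].
- by rewrite eb1; apply: unit_inM => //; apply: unit_inM.
- by rewrite eb1; field; rewrite s0 t0 b0.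
Qed.

Lemma loc_idem V C : subring V -> subring C -> loc V (loc V C) = loc V C.
Proof. by move=> rV rC; apply: loc_loc => //; apply: sub_loc. Qed.

Lemma loc_eq V W C : (forall b, C b -> unit_in V b <-> unit_in W b) -> loc V C = loc W C.
Proof.
by move=> h; rewrite eqEsubset; split=> _ [a [b [Ca Cb /h ub ->]]]; exists a, b; split=> //; apply: ub.
Qed.

Lemma loc_unit V C b : subring V -> subring C -> loc V C b -> unit_in V b -> loc V C b^-1.
Proof.
move=> rV rC [a [s [Ca Cs us e]]] ub; exists s, a; split=> //; last by rewrite e invf_div.
have [_ s0 _] := us; have -> : a = b * s by rewrite e; field.
exact: unit_inM.
Qed.

Lemma dominates_loc V C : subring V -> subring C -> C `<=` V -> dominates V (loc V C).
Proof.
move=> rV rC CV; split; first exact: loc_sub.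
move=> x [Cx hx]; split; first exact: loc_sub Cx.
case: hx => [->|hx]; [by left|].
case: (eqVneq x 0) => [->|x0]; [by left|right => Vx; apply: hx].
by apply: loc_unit => //; split=> //; apply: loc_sub Cx.
Qed.

Lemma nonunitsM V a x : subring V -> V a -> nonunits V x -> nonunits V (a * x).
Proof.
move=> rV Va [Vx hx]; split; first exact: subM.
case: hx => [->|hx]; first by left; rewrite mulr0.
case: (eqVneq (a * x) 0) => [|ax0]; [by left|right => Vax; apply: hx].
have [a0 x0] : a != 0 /\ x != 0 by apply/andP; rewrite -negb_or -mulf_eq0.
have -> : x^-1 = a * (a * x)^-1 by field; rewrite a0 x0.
exact: subM.
Qed.

Lemma nonunits0 V : subring V -> nonunits V 0.
Proof. by move=> rV; split; [apply: sub0|left]. Qed.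

Lemma nonunitsN V x : subring V -> nonunits V x -> nonunits V (- x).
Proof.
by move=> rV nx; rewrite -mulN1r; apply: nonunitsM => //; apply: subN => //; apply: sub1.
Qed.

Lemma nonunitsD V x y : valuation_ring V -> nonunits V x -> nonunits V y ->
  nonunits V (x + y).
Proof.
move=> vV nx ny; have rV := val_sub vV.
case: (eqVneq x 0) => [->|x0]; first by rewrite add0r.
case: (eqVneq y 0) => [->|y0]; first by rewrite addr0.
case: (vV.2 (x / y)) => h.
  have -> : x + y = (x / y + 1) * y by field.
  by apply: nonunitsM => //; apply: subD => //; apply: sub1.
have -> : x + y = (1 + (x / y)^-1) * x by rewrite invf_div; field.
by apply: nonunitsM => //; apply: subD => //; apply: sub1.
Qed.

Lemma nonunits1 V : subring V -> ~ nonunits V 1.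
Proof. by move=> rV; apply/unit_nonunits; [exact: sub1|exact: unit_in1]. Qed.

Lemma not_val_nonunits V x : valuation_ring V -> ~ V x -> nonunits V x^-1.
Proof.
by move=> [rV dV] nx; case: (dV x) => // Vx'; split=> //; right; rewrite invrK.
Qed.

Lemma spec_loc V C : valuation_ring V -> subring C -> C `<=` V -> spec_model C (loc V C).
Proof.
move=> vV rC CV; have rV := val_sub vV.
have locE : loc V C = localization C [set x | C x /\ nonunits V x].
  rewrite eqEsubset; split=> _ [a [b [Ca Cb ub ->]]]; exists a, b; split=> //.
    by move=> [_]; apply/unit_nonunits => //; apply: CV.
  by apply/unit_nonunits; [apply: CV|move=> n; apply: ub].
exists [set x | C x /\ nonunits V x] => //.
split.
- by move=> x [].
- split; first by split; [apply: sub0|split; [apply: sub0|left]].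
  move=> [_]; apply/unit_nonunits; [exact: sub1|exact: unit_in1].
- by move=> x y [Cx nx] [Cy ny]; split; [apply: subD|apply: nonunitsD].
- by move=> a x Ca [Cx nx]; split; [apply: subM|apply: nonunitsM => //; apply: CV].
- move=> a b Ca Cb [_ nab]; apply: contrapT => /not_orP[ha hb].
  have ua : unit_in V a by apply/unit_nonunits; [apply: CV|move=> n; apply: ha].
  have ub : unit_in V b by apply/unit_nonunits; [apply: CV|move=> n; apply: hb].
  have uab := unit_inM rV ua ub; move: nab.
  by apply/unit_nonunits => //; case: uab.
Qed.

(** Chevalley's theorem, applied to the localization and its maximal ideal, replaces a prime by a
    valuation ring centered at it. From here on points of models are handled through valuation rings
    only. *)
Lemma loc_spec C B : subring C -> spec_model C B ->
  exists V, [/\ valuation_ring V, C `<=` V & B = loc V C].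
Proof.
move=> rC [P [PC [P0 P1] PD PM Ppr] ->].
have n0 b : ~ P b -> b != 0 by move=> h; apply/eqP => e; apply: h; rewrite e.
have nM a b : C a -> C b -> ~ P a -> ~ P b -> ~ P (a * b).
  by move=> Ca Cb na nb /Ppr[].
pose J : set K := [set x | exists a b, [/\ P a, C b, ~ P b & x = a / b]].
have CL : C `<=` localization C P.
  by move=> x Cx; exists x, 1; split; rewrite ?divr1 //; apply: sub1.
have rL : subring (localization C P).
  apply/subringP; split; first by apply: CL; apply: sub1.
  - move=> _ _ [a [b [Ca Cb /[dup] nb /n0 b0 ->]]] [c [d [Cc Cd /[dup] nd /n0 d0 ->]]].
    exists (a * d - c * b), (b * d); split; [|exact: subM|exact: nM|].
      by apply: subB => //; apply: subM.
    by field; rewrite b0 d0.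
  - move=> _ _ [a [b [Ca Cb /[dup] nb /n0 b0 ->]]] [c [d [Cc Cd /[dup] nd /n0 d0 ->]]].
    exists (a * c), (b * d); split; [exact: subM|exact: subM|exact: nM|].
    by field; rewrite b0 d0.
have [V [vV LV JV]] : exists V, [/\ valuation_ring V, localization C P `<=` V & J `<=` nonunits V].
  apply: chevalley => //.
  - by move=> _ [a [b [/PC Ca Cb nb ->]]]; exists a, b.
  - by move=> [a [b [Pa Cb /[dup] nb /n0 b0 e]]]; apply: nb; rewrite -[b]mul1r e divfK.
  - by exists 0, 1; split; rewrite ?mul0r //; apply: sub1.
  - move=> _ _ [a [b [Pa Cb /[dup] nb /n0 b0 ->]]] [c [d [Pc Cd /[dup] nd /n0 d0 ->]]].
    exists (d * a + b * c), (b * d); split; [|exact: subM|exact: nM|].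
      by apply: PD; apply: PM.
    by field; rewrite b0 d0.
  - move=> _ _ [a [b [Ca Cb /[dup] nb /n0 b0 ->]]] [c [d [Pc Cd /[dup] nd /n0 d0 ->]]].
    exists (a * c), (b * d); split; [exact: PM|exact: subM|exact: nM|].
    by field; rewrite b0 d0.
exists V; split=> //; first exact: subset_trans LV.
rewrite eqEsubset; split=> _ [a [b [Ca Cb ub ->]]]; exists a, b; split=> //.
  split; [by apply: LV; apply: CL|exact: n0|apply: LV; exists 1, b; split=> //].
    exact: sub1.
  by rewrite mul1r.
move=> Pb; have [] : ~ nonunits V b by apply/unit_nonunits => //; case: ub.
by apply: JV; exists b, 1; split; rewrite ?divr1 //; apply: sub1.
Qed.

Lemma spec_subring C B : subring C -> spec_model C B -> subring B.
Proof. by move=> rC /loc_spec[] // V [vV CV ->]; apply: loc_subring => //; apply: val_sub. Qed.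

Lemma spec_sub C B : subring C -> spec_model C B -> C `<=` B.
Proof. by move=> rC /loc_spec[] // V [vV CV ->]; apply: sub_loc => //; apply: val_sub. Qed.

(** Domination means that an element of C is invertible in B exactly when it is a unit of V, so V
    alone determines which denominators are allowed. *)
Lemma dominates_eq C B V : valuation_ring V -> subring C -> spec_model C B ->
  dominates V B -> B = loc V C.
Proof.
move=> vV rC /[dup] sB /loc_spec[] // W [vW CW eB] [BV nBV].
have CB : C `<=` B by apply: spec_sub.
have [rV rW] := (val_sub vV, val_sub vW).
rewrite eB; apply: loc_eq => b Cb; split=> ub; have [_ b0 _] := ub.
  split=> //; first by apply: BV; apply: CB.
  by apply: BV; rewrite eB; apply: loc_unit => //; apply: sub_loc.
apply/unit_nonunits; first exact: CW.
move=> [_ [/eqP|nW]]; first by rewrite (negPf b0).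
have [] : ~ nonunits V b by apply/unit_nonunits => //; case: ub.
apply: nBV; split; first exact: CB.
by right => Bb; apply: nW; apply: (loc_sub rW CW); rewrite -eB.
Qed.

(** With s a common denominator of the coefficients g_i of a monic equation of degree n for x, the
    product s x satisfies the monic equation with coefficients g_i s^(n-i), which lie in C. *)
Lemma integral_loc V C x : subring V -> subring C -> integral_closure (loc V C) x ->
  exists s, [/\ C s, unit_in V s & integral_closure C (s * x)].
Proof.
move=> rV rC [g [gm hg /rootP gx]].
have [s [Cs us hs]] : exists s, [/\ C s, unit_in V s & forall i, (i < size g)%N -> C (s * g`_i)].
  elim: (size g) => [|n [s [Cs us hs]]].
    by exists 1; split=> //; [apply: sub1|apply: unit_in1].
  have [a [b [Ca Cb ub e]]] := hg n; have [_ b0 _] := ub.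
  exists (s * b); split; [exact: subM|exact: unit_inM|move=> i].
  rewrite ltnS leq_eqVlt => /orP[/eqP ->|/hs h].
    by rewrite e (_ : _ * _ = s * a); [apply: subM|field].
  by rewrite mulrAC; apply: subM.
have [n sg] : exists n, size g = n.+1.
  by exists (size g).-1; rewrite prednK // lt0n size_poly_eq0 monic_neq0.
have gn : g`_n = 1 by move/monicP: gm; rewrite /lead_coef sg.
have [_ s0 _] := us.
exists s; split=> //; exists (\poly_(i < n.+1) (g`_i * s ^+ (n - i))); split.
- apply/monicP; rewrite lead_coef_poly //= ?subnn ?gn ?mulr1 //; exact: oner_neq0.
- move=> i; rewrite coef_poly; case: ltnP => [|_]; last exact: sub0.
  rewrite ltnS leq_eqVlt => /orP[/eqP ->|lt]; first by rewrite subnn gn mulr1; apply: sub1.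
  rewrite -(subnSK lt) exprS mulrA [_ * s]mulrC.
  by apply: subM; rewrite ?sg; [|apply: hs; rewrite sg ltnW|apply: subX].
- apply/rootP; transitivity (s ^+ n * g.[x]); last by rewrite gx mulr0.
  rewrite horner_poly horner_coef sg mulr_sumr.
  apply: eq_bigr => i _; have le : (i <= n)%N by rewrite -ltnS.
  by rewrite exprMn -[X in s ^+ X * (_ * x ^+ _)](subnK le) exprD; ring.
Qed.

Lemma int_closed_loc V C : subring V -> subring C -> integral_closure C `<=` C ->
  integral_closure (loc V C) `<=` loc V C.
Proof.
move=> rV rC iC x /integral_loc[] // s [Cs us /iC h]; exists (s * x), s; split=> //.
by have [_ s0 _] := us; field.
Qed.

(* Y is the local ring of the center of a valuation, computed on any chart. *)
Lemma modification_of_charts R (s : seq (seq K)) (Y : set K -> set K) :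
  (forall V, valuation_ring V -> R `<=` V -> exists2 l, l \in s & [set` l] `<=` V) ->
  (forall V l, valuation_ring V -> R `<=` V -> l \in s -> [set` l] `<=` V ->
     loc V (adjoin R [set` l]) = Y V) ->
  modification R [set Y V | V in [set V | valuation_ring V /\ R `<=` V]].
Proof.
move=> cov glu; split; [exists s|].
  rewrite eqEsubset; split=> [_ [V [vV RV] <-]|B [l ls sB]].
    have [l ls lV] := cov V vV RV; exists l => //; rewrite -(glu V l) //.
    apply: spec_loc => //; first exact: adjoin_subring.
    by apply: adjoin_min => //; apply: val_sub.
  have [V [vV AV ->]] := loc_spec (adjoin_subring _ _) sB.
  have RV : R `<=` V by apply: subset_trans AV; apply: sub_adjoin.
  exists V => //; rewrite -(glu V l) //.
  by apply: subset_trans AV; apply: adjoin_gen.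
move=> V vV RV; have [l ls lV] := cov V vV RV; have rV := val_sub vV.
have AV : adjoin R [set` l] `<=` V by apply: adjoin_min.
exists (Y V); split.
  split; first by exists V.
  by rewrite -(glu V l) //; apply: dominates_loc => //; apply: adjoin_subring.
move=> B' [[W [vW RW] <-] dW].
have [l' ls' lW] := cov W vW RW.
have sW : spec_model (adjoin R [set` l']) (Y W).
  rewrite -(glu W l') //; apply: spec_loc => //; first exact: adjoin_subring.
  by apply: adjoin_min => //; apply: val_sub.
rewrite (dominates_eq vV (adjoin_subring _ _) sW dW) (glu V l') //.
apply: subset_trans dW.1; apply: subset_trans (spec_sub (adjoin_subring _ _) sW).
exact: adjoin_gen.
Qed.

Lemma modification_sub R M B : modification R M -> M B -> subring B /\ R `<=` B.
Proof.
move=> [[s ->] _] [l _ sB]; split; first exact: spec_subring (adjoin_subring _ _) sB.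
by apply: subset_trans (spec_sub (adjoin_subring _ _) sB); apply: sub_adjoin.
Qed.

(** Reduces the computation of a normalization to one valuation ring at a time: only the local ring
    at the center of V has to be identified. *)
Lemma normalizationE R M (Y : set K -> set K) : modification R M ->
  (forall V B, valuation_ring V -> R `<=` V -> M B -> dominates V B ->
     Y V = loc V (integral_closure B)) ->
  normalization M = [set Y V | V in [set V | valuation_ring V /\ R `<=` V]].
Proof.
move=> mM hY; rewrite eqEsubset; split=> B'; last first.
  move=> [V [vV RV] <-]; have [B [[MB dB] _]] := mM.2 V vV RV.
  have [rB _] := modification_sub mM MB.
  exists B => //; rewrite (hY V B) //; apply: spec_loc => //; first exact: integral_subring.
  by apply: integral_val => //; case: dB.
move=> [B MB]; have [rB RB] := modification_sub mM MB.
move=> /loc_spec[]; first exact: integral_subring.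
move=> V [vV BV ->]; have rV := val_sub vV.
have BV' : B `<=` V by apply: subset_trans BV; apply: sub_integral.
have RV : R `<=` V by apply: subset_trans BV'.
(* V need not dominate B, since the prime of the integral closure may lie over a smaller prime of B.
   The center B1 of V on the model is then a further localization of the same chart, and both
   integral closures have the same localization at V. *)
exists V => //; have [B1 [[MB1 dB1] uB1]] := mM.2 V vV RV.
have [[s Ms] _] := mM; have := MB; rewrite Ms => -[l ls sB].
have rC := adjoin_subring R [set` l].
have CB := spec_sub rC sB.
have CV : adjoin R [set` l] `<=` V by apply: subset_trans BV'.
have e1 : B1 = loc V (adjoin R [set` l]).
  apply: uB1; split; last exact: dominates_loc.
  by rewrite Ms; exists l => //; apply: spec_loc.
rewrite (hY V B1) // e1; apply: loc_loc => //; first exact: integral_subring.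
  have [W [vW CW eB]] := loc_spec rC sB; have rW := val_sub vW.
  apply: integral_mono => x; rewrite {1}eB => -[a [b [Ca Cb ub ->]]].
  exists a, b; split=> //; have [_ b0 _] := ub; split=> //; first exact: CV.
  by apply: BV'; rewrite eB; apply: loc_unit => //; apply: sub_loc.
move=> x /integral_loc[] // t [Ct ut ix]; exists (t * x), t; split=> //.
- exact: integral_mono ix.
- by apply: sub_integral => //; apply: CB.
- by have [_ t0 _] := ut; field.
Qed.

End Localizations.

(** * Linear algebra over a subfield *)

Section Linear.
Variables (k L : fieldType) (iota : {rmorphism k -> L}).
Implicit Types (S : set L) (x y : L).

Definition comb n (c : 'I_n -> k) (v : 'I_n -> L) : L := \sum_i iota (c i) * v i.
Definition kfree n (v : 'I_n -> L) : Prop :=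
  forall c, comb c v = 0 -> forall i, c i = 0.
Definition kspan n (v : 'I_n -> L) : set L := [set x | exists c, x = comb c v].
Definition subspace S : Prop :=
  [/\ S 0, forall x y, S x -> S y -> S (x + y) & forall a x, S x -> S (iota a * x)].

Lemma combD n (c d : 'I_n -> k) v : comb (fun i => c i + d i) v = comb c v + comb d v.
Proof. by rewrite /comb -big_split; apply: eq_bigr => i _ /=; rewrite rmorphD mulrDl. Qed.

Lemma combN n (c : 'I_n -> k) v : comb (fun i => - c i) v = - comb c v.
Proof. by rewrite /comb -sumrN; apply: eq_bigr => i _ /=; rewrite rmorphN mulNr. Qed.

Lemma combB n (c d : 'I_n -> k) v : comb (fun i => c i - d i) v = comb c v - comb d v.
Proof. by rewrite combD combN. Qed.

Lemma combZ n a (c : 'I_n -> k) v : comb (fun i => a * c i) v = iota a * comb c v.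
Proof. by rewrite /comb mulr_sumr; apply: eq_bigr => i _ /=; rewrite rmorphM mulrA. Qed.

Lemma comb0 n (v : 'I_n -> L) : comb (fun=> 0) v = 0.
Proof. by rewrite /comb big1 // => i _; rewrite rmorph0 mul0r. Qed.

Lemma comb_delta n (v : 'I_n -> L) i : comb (fun j => (j == i)%:R) v = v i.
Proof.
rewrite /comb (bigD1 i) //= eqxx rmorph1 mul1r big1 ?addr0 // => j /negPf ->.
by rewrite rmorph0 mul0r.
Qed.

Lemma subspace_span n (v : 'I_n -> L) : subspace (kspan v).
Proof.
split; first by exists (fun=> 0); rewrite comb0.
- by move=> _ _ [c ->] [d ->]; exists (fun i => c i + d i); rewrite combD.
- by move=> a _ [c ->]; exists (fun i => a * c i); rewrite combZ.
Qed.

Lemma kspan_gen n (v : 'I_n -> L) i : kspan v (v i).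
Proof. by exists (fun j => (j == i)%:R); rewrite comb_delta. Qed.

Lemma subspace_comb S n (c : 'I_n -> k) v : subspace S -> (forall i, S (v i)) -> S (comb c v).
Proof. by case=> h0 hD hZ hv; apply: big_ind => // i _; apply: hZ. Qed.

Lemma subspaceB S x y : subspace S -> S x -> S y -> S (x - y).
Proof.
case=> _ hD hZ Sx Sy; apply: hD => //.
by have := hZ (-1) y Sy; rewrite rmorphN1 mulN1r.
Qed.

Lemma kspan_min S n (v : 'I_n -> L) : subspace S -> (forall i, S (v i)) -> kspan v `<=` S.
Proof. by move=> sS hv _ [c ->]; apply: subspace_comb. Qed.

Lemma free_le m n (w : 'I_m -> L) (v : 'I_n -> L) :
  kfree w -> (forall i, kspan v (w i)) -> (m <= n)%N.
Proof.
move=> fw /choice[A hA]; rewrite leqNgt; apply/negP => lt.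
pose M : 'M[k]_(m, n) := \matrix_(i, j) A i j.
have : kermx M != 0.
  rewrite -mxrank_eq0 mxrank_ker subn_eq0 -ltnNge.
  by apply: leq_ltn_trans (rank_leq_col _) lt.
move=> /rowV0Pn[r /sub_kermxP rM /negP]; apply; apply/eqP/rowP => i; rewrite mxE.
apply: (fw (fun i => r 0 i)); rewrite /comb.
transitivity (comb (fun j => (r *m M) 0 j) v); last by rewrite rM /comb big1 // => j _; rewrite mxE rmorph0 mul0r.
under eq_bigr do rewrite hA /comb mulr_sumr.
rewrite exchange_big; apply: eq_bigr => j _ /=; rewrite mxE rmorph_sum mulr_suml.
by apply: eq_bigr => l _; rewrite mxE rmorphM mulrA.
Qed.

Lemma span_free n (w v : 'I_n -> L) : kfree w -> (forall i, kspan v (w i)) -> kfree v.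
Proof.
case: n w v => [|n] w v fw sw c hc i; first by case: i.
apply/eqP/negPn/negP => ci.
have sv j : kspan (fun l => v (lift i l)) (v j).
  case: (unliftP i j) => [l ->|->]; first exact: (kspan_gen (fun l => v (lift i l))).
  exists (fun l => - (c i)^-1 * c (lift i l)); rewrite combZ rmorphN fmorphV.
  have i0 : iota (c i) != 0 by rewrite fmorph_eq0.
  apply: (mulfI i0); move: hc; rewrite /comb (bigD1_ord i) //= => /eqP.
  by rewrite addr_eq0 => /eqP ->; field.
have := free_le fw (v := fun l => v (lift i l)); rewrite ltnn => h; apply: notF; apply: h => j.
exact: kspan_min (subspace_span _) sv _ (sw j).
Qed.

Definition kdim S n : Prop :=
  exists b : 'I_n -> L, [/\ forall i, S (b i), kfree b & S `<=` kspan b].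

Lemma kdim_free_le S n m (w : 'I_m -> L) : kdim S n ->
  (forall i, S (w i)) -> kfree w -> (m <= n)%N.
Proof. by move=> [b [_ _ sb]] Sw fw; apply: free_le fw _ => i; apply/sb. Qed.

Lemma kdim_le S S' n m : kdim S n -> kdim S' m -> S `<=` S' -> (n <= m)%N.
Proof. by move=> [b [Sb fb _]] h SS; apply: kdim_free_le h _ fb => i; apply: SS. Qed.

Lemma kdim_uniq S n m : kdim S n -> kdim S m -> n = m.
Proof. by move=> h h'; apply/eqP; rewrite eqn_leq !(kdim_le (S := S) (S' := S)). Qed.

Definition ext x n (v : 'I_n -> L) : 'I_n.+1 -> L := fun i => oapp v x (unlift ord0 i).

Lemma comb_ext x n (v : 'I_n -> L) (c : 'I_n.+1 -> k) :
  comb c (ext x v) = iota (c ord0) * x + comb (fun i => c (lift ord0 i)) v.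
Proof.
rewrite /comb big_ord_recl /ext unlift_none /=; congr +%R.
by apply: eq_bigr => i _; rewrite liftK.
Qed.

Lemma free_ext x n (v : 'I_n -> L) : kfree v -> ~ kspan v x -> kfree (ext x v).
Proof.
move=> fv nx c; rewrite comb_ext => e.
have c0 : c ord0 = 0.
  apply: contrapT => /eqP c0; apply: nx.
  exists (fun i => - (c ord0)^-1 * c (lift ord0 i)); rewrite combZ rmorphN fmorphV.
  have i0 : iota (c ord0) != 0 by rewrite fmorph_eq0.
  by apply: (mulfI i0); move/eqP: e; rewrite addr_eq0 => /eqP ->; field.
move: e; rewrite c0 rmorph0 mul0r add0r => /fv h i.
by case: (unliftP ord0 i) => [j ->|->].
Qed.

Lemma dim_exists S N : subspace S ->
  (forall m (w : 'I_m -> L), (forall i, S (w i)) -> kfree w -> (m <= N)%N) ->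
  exists2 n, (n <= N)%N & kdim S n.
Proof.
move=> sS bnd.
pose P m := `[< exists w : 'I_m -> L, (forall i, S (w i)) /\ kfree w >].
have ex : exists m, P m by exists 0%N; apply/asboolP; exists (fun=> 0); split=> [[] //|c _ []].
have ub m : P m -> (m <= N)%N by move=> /asboolP[w [Sw fw]]; apply: (bnd m w).
case: (ex_maxnP ex ub) => n /asboolP[w [Sw fw]] mx.
exists n; first by apply: (bnd n w).
exists w; split=> // x Sx; apply: contrapT => nx.
have : P n.+1.
  apply/asboolP; exists (ext x w); split; last exact: free_ext.
  by move=> i; rewrite /ext; case: (unlift ord0 i).
by move/mx; rewrite ltnn.
Qed.

Lemma free_spans S n (w : 'I_n -> L) : kdim S n -> (forall i, S (w i)) -> kfree w ->
  S `<=` kspan w.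
Proof.
move=> hS Sw fw x Sx; apply: contrapT => nx.
have := kdim_free_le hS _ (free_ext fw nx); rewrite ltnn => h.
suff : false by []. apply: h => i; by rewrite /ext; case: (unlift ord0 i).
Qed.

Lemma dim_eq S S' n : kdim S n -> kdim S' n -> S `<=` S' -> subspace S -> S' `<=` S.
Proof.
move=> [b [Sb fb _]] h SS sS x S'x.
have [|c ->] := free_spans h _ fb S'x; last exact: subspace_comb.
by move=> i; apply: SS.
Qed.

(** The last hypothesis says that S'/S is at most one-dimensional, in the form in which leading
    coefficients with values in k provide it. *)
Lemma dim_step S S' n : subspace S -> subspace S' -> S `<=` S' -> kdim S n ->
  (forall f g, S' f -> S' g -> ~ S g -> exists a, S (f - iota a * g)) ->
  kdim S' n /\ S' `<=` S \/ kdim S' n.+1 /\ exists2 g, S' g & ~ S g.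
Proof.
move=> sS sS' SS hS hc.
have [[g S'g nSg]|no] := pselect (exists2 g, S' g & ~ S g); last first.
  left; have SS' : S' `<=` S by move=> g S'g; apply: contrapT => nS; apply: no; exists g.
  by split=> //; have -> : S' = S by rewrite eqEsubset.
right; split; last by exists g.
have [b [Sb fb sb]] := hS.
exists (ext g b); split.
- by move=> i; rewrite /ext; case: (unlift ord0 i) => //= j; apply: SS.
- apply: free_ext => // hg; apply: nSg; exact: kspan_min hg.
- move=> f S'f; have [a /sb[c e]] := hc f g S'f S'g nSg.
  exists (fun i => oapp c a (unlift ord0 i)); rewrite comb_ext unlift_none /=.
  rewrite -[f](subrK (iota a * g)) e addrC; congr +%R.
  by apply: eq_bigr => i _; rewrite liftK.
Qed.

End Linear.

Lemma has_dimP (k : closedFieldType) (L : fieldType) (iota : {rmorphism k -> L}) (S : set L) n :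
  has_dim iota S n <-> kdim iota S n.
Proof.
split=> [[b [Sb h]]|[b [Sb fb sb]]]; exists b; split=> //.
- move=> c hc; have [n0|n0] := leqP n 0; first by move=> [i hi]; exfalso; move: hi; rewrite ltnNge (leq_trans n0).
  have [S0|nS0] := pselect (S 0).
    have [d [_ ud]] := h 0 S0.
    move=> i; rewrite -(congr1 (fun f => f i) (ud c (esym hc))).
    by rewrite (congr1 (fun f => f i) (ud (fun=> 0) (esym (comb0 iota b)))).
  (* S is not assumed to contain 0; in that case the uniqueness of coordinates is tested on a basis
     vector instead. *)
  have [d [ed ud]] := h _ (Sb (Ordinal n0)).
  have e : d = (fun i => d i + c i).
    by apply: ud; rewrite -[RHS]/(comb iota _ b) combD hc addr0.
  by move=> i; have := congr1 (fun f => f i) e; rewrite -[LHS]addr0 => /addrI.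
- by move=> f /h[c [-> _]]; exists c.
- move=> f /sb[c ->]; exists c; split=> // d e; apply/funext => i.
  by apply/eqP; rewrite -subr_eq0; apply/eqP; apply: (fb (fun i => c i - d i)); rewrite combB e subrr.
Qed.

Section FreeFin.
Variables (k L : fieldType) (iota : {rmorphism k -> L}).

Lemma comb_enum (I : finType) (w : I -> L) (c : 'I_#|I| -> k) :
  comb iota c (fun i : 'I_#|I| => w (enum_val i)) = \sum_i iota (c (enum_rank i)) * w i.
Proof.
rewrite /comb [RHS](reindex_onto enum_val (@enum_rank I)); last by move=> x _; rewrite enum_rankK.
by apply: eq_big => x; rewrite /= ?enum_valK ?eqxx.
Qed.

Definition kfree_fin (I : finType) (w : I -> L) : Prop :=
  forall c : I -> k, \sum_i iota (c i) * w i = 0 -> forall i, c i = 0.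

Lemma kfree_enum (I : finType) (w : I -> L) : kfree_fin w -> kfree iota (fun i : 'I_#|I| => w (enum_val i)).
Proof.
move=> fw c; rewrite comb_enum => hc i; have := fw (fun x => c (enum_rank x)) hc (enum_val i).
by rewrite enum_valK.
Qed.

Lemma free_le_fin (I J : finType) (w : I -> L) (v : J -> L) : kfree_fin w ->
  (forall i, exists c : J -> k, w i = \sum_j iota (c j) * v j) -> (#|I| <= #|J|)%N.
Proof.
move=> fw sw; apply: (@free_le _ _ iota _ _ (fun i : 'I_#|I| => w (enum_val i)) (fun i : 'I_#|J| => v (enum_val i))).
  exact: kfree_enum.
move=> i; have [c e] := sw (enum_val i); exists (fun i => c (enum_val i)); rewrite comb_enum [LHS]e.
by apply: eq_bigr => j _; rewrite /= enum_rankK.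
Qed.

Lemma free_spans_fin (S : set L) (I : finType) (w : I -> L) : kdim iota S #|I| ->
  (forall i, S (w i)) -> kfree_fin w ->
  forall x, S x -> exists c : I -> k, x = \sum_i iota (c i) * w i.
Proof.
move=> hS Sw /kfree_enum fw x /(free_spans hS (fun i => Sw (enum_val i)) fw)[c ->].
by exists (fun x => c (enum_rank x)); rewrite comb_enum.
Qed.

End FreeFin.

(** * Finiteness of the function field over k[y] *)

Section PolyFree.
Variables (k : closedFieldType) (F : fieldType) (iota : {rmorphism k -> F}).
Local Notation ev p y := (map_poly iota p).[y].

Definition polyfree (y : F) m (z : 'I_m -> F) : Prop :=
  forall p : 'I_m -> {poly k}, \sum_i ev (p i) y * z i = 0 -> forall i, p i = 0.

Lemma nonconst_root y (p : {poly k}) : ~ range iota y -> p != 0 -> ev p y != 0.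
Proof.
move=> ny p0; have [r e] := closed_field_poly_normal p.
rewrite e map_polyZ rmorph_prod /= hornerZ horner_prod mulf_neq0 //.
  by rewrite fmorph_eq0 lead_coef_eq0.
rewrite prodf_seq_neq0; apply/allP => x _ /=.
rewrite rmorphB /= map_polyX map_polyC hornerXsubC subr_eq0.
by apply/eqP => ey; apply: ny; exists x.
Qed.

(** If all constant terms of a relation vanish, the relation can be divided by y, so its size
    descends to 0. *)
Lemma polyfree_red y m (z : 'I_m -> F) : y != 0 ->
  (forall p : 'I_m -> {poly k}, \sum_i ev (p i) y * z i = 0 -> forall i, (p i)`_0 = 0) ->
  polyfree y z.
Proof.
move=> y0 h.
suff H n : forall p : 'I_m -> {poly k}, (forall i, size (p i) <= n)%N ->
    \sum_i ev (p i) y * z i = 0 -> forall i, p i = 0.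
  move=> p; apply: (H (\max_i size (p i))); exact: leq_bigmax.
elim: n => [|n IH] p sp hp i; first by apply/eqP; rewrite -size_poly_eq0 -leqn0.
have p0 := h _ hp.
have e j : p j = drop_poly 1 (p j) * 'X.
  rewrite -[LHS](poly_take_drop 1) expr1 [X in X + _](_ : _ = 0) ?add0r //.
  apply/polyP => l; rewrite coef_take_poly coef0; case: ltnP => //.
  by rewrite ltnS leqn0 => /eqP ->.
rewrite e [drop_poly _ _](IH (fun j => drop_poly 1 (p j))) ?mul0r // => [j|]; first by rewrite size_drop_poly leq_subLR add1n.
apply: (mulfI y0); rewrite mulr0 -[RHS]hp mulr_sumr; apply: eq_bigr => j _.
by rewrite [in RHS]e rmorphM /= map_polyX hornerM hornerX; ring.
Qed.

Section Bound.
Variables (x : F) (n : nat) (b : 'I_n -> F).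
Hypothesis hb : forall f : F, exists (c : {poly k}) (a : 'I_n -> {poly k}), c != 0 /\
  ev c x * f = \sum_i ev (a i) x * b i.
Hypothesis hx : ~ range iota x.

Let V D : set F := [set f | exists2 a : 'I_n -> {poly k},
  (forall i, size (a i) <= D)%N & f = \sum_i ev (a i) x * b i].

Let V_add D f g : V D f -> V D g -> V D (f + g).
Proof.
move=> [a ha ->] [c hc ->]; exists (fun i => a i + c i).
  by move=> i; rewrite (leq_trans (size_polyD _ _)) // geq_max ha hc.
by rewrite -big_split; apply: eq_bigr => i _ /=; rewrite rmorphD hornerD mulrDl.
Qed.

Let V_mul D (c : {poly k}) d f : (size c <= d)%N -> V D f -> V (D + d) (ev c x * f).
Proof.
move=> sc [a ha ->]; exists (fun i => c * a i).
  move=> i; rewrite (leq_trans (size_polyMleq _ _)) //; have := ha i; lia.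
by rewrite mulr_sumr; apply: eq_bigr => i _ /=; rewrite rmorphM hornerM mulrA.
Qed.

Let V_mono D D' : (D <= D')%N -> V D `<=` V D'.
Proof. by move=> le f [a ha ->]; exists a => // i; apply: leq_trans le. Qed.

Let common m (f : 'I_m -> F) : exists (c : {poly k}) D, c != 0 /\ forall i, V D (ev c x * f i).
Proof.
elim: m f => [|m IH] f; first by exists 1, 0%N; split=> [|[]//]; rewrite oner_neq0.
have [c [D [c0 hc]]] := IH (fun i => f (lift ord0 i)).
have [d [a [d0 hd]]] := hb (f ord0).
exists (c * d), (D + size d + (\max_i size (a i) + size c))%N.
split=> [|i]; first by rewrite mulf_neq0.
rewrite rmorphM hornerM; case: (unliftP ord0 i) => [j ->|->].
  rewrite [X in X * _]mulrC -mulrA; apply: (@V_mono (D + size d)); first exact: leq_addr.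
  exact: V_mul.
rewrite -mulrA hd; apply: (@V_mono (\max_i size (a i) + size c)); first exact: leq_addl.
by apply: V_mul => //; exists a => // j; apply: leq_bigmax.
Qed.

(** A dimension count. Up to a denominator c(x), multiplication by y maps [V E] into [V (E + d)],
    and [V D] has dimension at most n D. Given N elements free over k[y], their products with the
    powers y^l, l <= m, are N (m + 1) independent elements which c(x)^m c'(x) moves into
    [V (E + m * d)]. *)
Lemma polyfree_bound y : exists N, forall m (z : 'I_m -> F), polyfree y z -> (m <= N)%N.
Proof.
have [c [D [c0 hc]]] := common (fun i => y * b i).
pose d := (D + size c)%N.
have Vy E f : V E f -> V (E + d) (ev c x * (y * f)).
  move=> [a ha ->]; rewrite mulr_sumr mulr_sumr.
  have hV i : V (E + d) (ev c x * (y * (ev (a i) x * b i))).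
    have -> : ev c x * (y * (ev (a i) x * b i)) = ev (a i) x * (ev c x * (y * b i)) by ring.
    by apply: (@V_mono (D + E)); [rewrite /d; lia|apply: V_mul].
  apply: big_ind => //; last by move=> f1 f2; apply: V_add.
  by exists (fun=> 0) => [i|]; rewrite ?size_poly0 // big1 // => i _; rewrite rmorph0 horner0 mul0r.
have Vc E f : V E f -> V (E + d) (ev c x * f).
  by move=> h; apply: V_mul => //; apply: leq_addl.
have Vl E f m : V E f -> forall l : nat, (l <= m)%N -> V (E + m * d) (ev c x ^+ m * (y ^+ l * f)).
  move=> Vf; elim: m => [|m IH] l le.
    by move: le; rewrite leqn0 => /eqP ->; rewrite !expr0 !mul1r mul0n addn0.
  have -> : (E + m.+1 * d = E + m * d + d)%N by lia.
  case: l le => [|l] le.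
    have -> : ev c x ^+ m.+1 * (y ^+ 0 * f) = ev c x * (ev c x ^+ m * (y ^+ 0 * f)) by rewrite exprS; ring.
    by apply: Vc; apply: IH.
  have -> : ev c x ^+ m.+1 * (y ^+ l.+1 * f) = ev c x * (y * (ev c x ^+ m * (y ^+ l * f))).
    by rewrite !exprS; ring.
  by apply: Vy; apply: IH.
exists (n * d)%N => N z fz.
have [c' [E [c'0 hE]]] := common z.
(* With m = n E the inequality N (m + 1) <= n (E + m d) reads N (m + 1) <= m + n d m, which forces N
   <= n d, a bound free of E. *)
pose m := (n * E)%N.
have cx0 : ev c x ^+ m * ev c' x != 0 by rewrite mulf_neq0 ?expf_neq0 //; apply: nonconst_root.
have : (N * m.+1 <= n * (E + m * d))%N.
  pose w (jl : 'I_N * 'I_m.+1) := ev c x ^+ m * ev c' x * (y ^+ jl.2 * z jl.1).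
  pose v (il : 'I_n * 'I_(E + m * d)) := b il.1 * x ^+ il.2.
  have := @free_le_fin _ _ iota _ _ w v; rewrite !card_prod !card_ord; apply.
  - move=> u hu [j l] /=.
    have : \sum_i ev (\poly_(l < m.+1) u (i, inord l)) y * z i = 0.
      apply: (mulfI cx0); rewrite mulr0 -[RHS]hu.
      transitivity (\sum_i \sum_l iota (u (i, l)) * w (i, l)); last first.
        by rewrite pair_bigA; apply: eq_bigr => -[].
      rewrite mulr_sumr; apply: eq_bigr => i _.
      rewrite [X in _ * (X * _)](horner_coef_wide (n := m.+1)); last by rewrite size_map_poly; apply: size_poly.
      rewrite mulr_suml mulr_sumr; apply: eq_bigr => q _.
      by rewrite coef_map coef_poly ltn_ord inord_val /w /=; ring.
    move/fz => /(_ j)/polyP/(_ l); rewrite coef0 coef_poly ltn_ord.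
    by rewrite inord_val.
  - move=> [j l] /=.
    have [a ha e] : V (E + m * d) (ev c x ^+ m * (y ^+ l * (ev c' x * z j))).
      by apply: Vl; rewrite // -ltnS.
    exists (fun il : 'I_n * 'I_(E + m * d) => (a il.1)`_il.2).
    have -> : w (j, l) = ev c x ^+ m * (y ^+ l * (ev c' x * z j)) by rewrite /w /=; ring.
    transitivity (\sum_i \sum_(l < E + m * d) iota (a i)`_l * v (i, l)); last first.
      by rewrite pair_bigA; apply: eq_bigr => -[].
    rewrite e; apply: eq_bigr => i _.
    rewrite (horner_coef_wide (n := E + m * d)); last by rewrite size_map_poly.
    by rewrite mulr_suml; apply: eq_bigr => q _; rewrite coef_map /v /=; ring.
rewrite /m; nia.
Qed.

End Bound.
End PolyFree.

(** * Places and divisors *)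

Section FunctionField.
Variables (k : closedFieldType) (F : fieldType) (iota : {rmorphism k -> F}).
Local Notation ev p y := (map_poly iota p).[y].

Lemma function_field_bound : function_field_1 iota -> forall y, ~ range iota y ->
  exists N, forall m (z : 'I_m -> F), polyfree iota y z -> (m <= N)%N.
Proof.
move=> [x [tx [n [b hb]]]] y _.
have nx : ~ range iota x.
  move=> [a _ e]; apply: tx; exists ('X - a%:P); first by rewrite polyXsubC_eq0.
  by rewrite rmorphB /= map_polyX map_polyC /= root_XsubC e.
exact: (polyfree_bound hb nx).
Qed.

(** The set is empty for f = 0, so [ord P 0] is the default value 0. *)
Definition ord (P : set F) (f : F) : int :=
  xget 0 [set n | exists2 u, uniformizer P u & unit_in P (f * u ^ (- n))].

(* Order at least n, with the junk value of [ord] at 0 corrected. *)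
Definition vge (P : set F) (n : int) (f : F) : Prop := f = 0 \/ n <= ord P f.

Hypothesis hF : function_field_1 iota.
Variables (P : set F) (hP : place iota P).

Lemma place_val : valuation_ring P. Proof. by case: hP. Qed.
Lemma place_sub : subring P. Proof. exact: val_sub place_val. Qed.
Let rP := place_sub.
Lemma place_const a : P (iota a). Proof. by case: hP => _ h _; apply: h; exists a. Qed.
Lemma const_unit a : a != 0 -> unit_in P (iota a).
Proof.
by move=> a0; split; rewrite ?fmorph_eq0 // -?fmorphV; apply: place_const.
Qed.

Lemma unit_not_nonunit x : unit_in P x -> ~ nonunits P x.
Proof. by move=> ux; apply/unit_nonunits => //; case: ux. Qed.

Lemma nonunit_nonconst y : y != 0 -> nonunits P y -> ~ range iota y.
Proof.
move=> y0 ny [a _ e]; apply: (@unit_not_nonunit y) => //; rewrite -e; apply: const_unit.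
by rewrite -(fmorph_eq0 iota) e.
Qed.

Lemma ev_in p y : P y -> P (ev p y).
Proof.
move=> Py; rewrite horner_coef; apply: sub_sum => // i _.
by apply: subM => //; [rewrite coef_map; apply: place_const|apply: subX].
Qed.

Lemma ev_split p y : P y -> exists2 w, P w & ev p y = iota p`_0 + y * w.
Proof.
move=> Py; exists (ev (drop_poly 1 p) y); first exact: ev_in.
rewrite -{1}(poly_take_drop 1 p) expr1 rmorphD rmorphM /= map_polyX hornerD hornerM hornerX.
rewrite [_ * y]mulrC; congr (_ + _).
have -> : take_poly 1 p = (p`_0)%:P.
  apply/polyP => i; rewrite coef_take_poly coefC.
  by case: i => [|i] /=; rewrite ?eqxx.
by rewrite map_polyC hornerC.
Qed.

Let nu_sum I (r : seq I) (Q : pred I) (v : I -> F) :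
  (forall i, Q i -> nonunits P (v i)) -> nonunits P (\sum_(i <- r | Q i) v i).
Proof.
by move=> h; apply: big_ind => // [|x y]; [apply: nonunits0|apply: nonunitsD place_val].
Qed.

Let nuMr x a : nonunits P x -> P a -> nonunits P (x * a).
Proof. by move=> nx Pa; rewrite mulrC; apply: nonunitsM. Qed.

(** The orders of the z_i increase strictly and stay below that of y. In a relation over k[y], the
    first z_l whose coefficient has a nonzero constant term then has strictly smaller order than all
    other terms. With the bound on free families, this excludes long chains and makes the valuation
    discrete. *)
Lemma chain_polyfree y m (z : 'I_m -> F) : y != 0 -> P y ->
  (forall i, z i != 0 /\ P (z i)) ->
  (forall i j : 'I_m, (i < j)%N -> nonunits P (z j / z i)) ->
  (forall i, nonunits P (y / z i)) -> polyfree iota y z.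
Proof.
move=> y0 Py hz hzz hyz; apply: polyfree_red => // p hp i0; apply/eqP/negPn/negP => n0.
case: (arg_minnP (P := fun i => (p i)`_0 != 0) (fun i : 'I_m => i : nat) n0) => l nl minl.
have [zl0 Pzl] := hz l.
have [w Pw ew] := ev_split (p l) Py.
have : nonunits P (iota (p l)`_0); last by apply: unit_not_nonunit; apply: const_unit.
have -> : iota (p l)`_0 = - (y * w + \sum_(i | i != l) ev (p i) y * z i / z l).
  have := congr1 (fun t => t / z l) hp; rewrite mul0r mulr_suml (bigD1 l) //= ew mulfK //.
  by move=> /eqP; rewrite -addrA addr_eq0 => /eqP.
apply: nonunitsN => //; apply: nonunitsD place_val _ _.
  apply: nuMr => //; have -> : y = y / z l * z l by rewrite divfK.
  by apply: nuMr.
apply: nu_sum => i il; case: (ltngtP i l) => [lt|lt|/val_inj e]; last by rewrite e eqxx in il.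
  have [w' Pw' ->] := ev_split (p i) Py.
  have -> : (p i)`_0 = 0 by apply/eqP/negPn/negP => /minl; rewrite leqNgt lt.
  rewrite rmorph0 add0r (_ : _ / _ = y / z l * (w' * z i)); last by field.
  by apply: nuMr => //; apply: subM => //; have [] := hz i.
by rewrite -mulrA; apply: nonunitsM => //; [apply: ev_in|apply: hzz].
Qed.

Lemma nonunit_ex : exists2 y, y != 0 & nonunits P y.
Proof.
have [x nx] : exists x, ~ P x.
  by apply: contrapT => no; case: hP => _ _; apply; rewrite eqEsubset; split=> // x _;
    apply: contrapT => nx; apply: no; exists x.
exists x^-1; last exact: not_val_nonunits place_val nx.
by rewrite invr_eq0; apply/eqP => e; apply: nx; rewrite e; apply: sub0.
Qed.

(** If every z - a were a unit, so would be g(z) for every nonzero g, as k is algebraically closed;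
    then arbitrarily many powers of z would be free over k[y] for a nonunit y. *)
Lemma residue z : P z -> exists a, nonunits P (z - iota a).
Proof.
move=> Pz; apply: contrapT => no.
have uz a : unit_in P (z - iota a).
  apply/unit_nonunits; first by apply: subB => //; apply: place_const.
  by move=> n; apply: no; exists a.
have [y y0 ny] := nonunit_ex; have Py : P y by case: ny.
have [N hN] := function_field_bound hF (nonunit_nonconst y0 ny).
suff /hN : polyfree iota y (fun i : 'I_N.+1 => z ^+ i) by rewrite ltnn.
apply: polyfree_red => // p hp i.
pose g : {poly k} := \poly_(j < N.+1) (p (inord j))`_0.
have gz : nonunits P (ev g z).
  have -> : ev g z = \sum_(j < N.+1) (iota (p j)`_0 - ev (p j) y) * z ^+ j.
    under eq_bigr do rewrite mulrBl.
    rewrite sumrB hp subr0 (horner_coef_wide (n := N.+1)); last first.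
      by rewrite size_map_poly; apply: size_poly.
    by apply: eq_bigr => j _; rewrite coef_map coef_poly ltn_ord inord_val.
  apply: nu_sum => j _; apply: nuMr; last exact: subX.
  have [w Pw ->] := ev_split (p j) Py.
  by rewrite opprD addrA subrr add0r; apply: nonunitsN => //; apply: nuMr.
have g0 : g = 0.
  apply: contrapT => /eqP g0; apply: unit_not_nonunit gz.
  have [r e] := closed_field_poly_normal g.
  rewrite e map_polyZ rmorph_prod /= hornerZ horner_prod; apply: unit_inM => //.
    by apply: const_unit; rewrite lead_coef_eq0.
  apply: big_ind; [exact: unit_in1|by move=> *; apply: unit_inM|move=> a _].
  by rewrite rmorphB /= map_polyX map_polyC hornerXsubC; apply: uz.
have := congr1 (fun h : {poly k} => h`_i) g0.
by rewrite coef0 coef_poly ltn_ord inord_val.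
Qed.

Lemma uniformizerP u : uniformizer P u <->
  [/\ u != 0, nonunits P u & forall f, nonunits P f -> P (f / u)].
Proof.
split=> [e|[u0 nu hu]].
  have u0 : u != 0.
    have [y y0 ny] := nonunit_ex; rewrite e in ny; case: ny => a _ ea.
    by apply/eqP => u0; move: y0; rewrite -ea u0 mul0r eqxx.
  split=> //; first by rewrite e; exists 1; rewrite ?mulr1 //; apply: sub1.
  by move=> f; rewrite e => -[a Pa <-]; rewrite mulrC mulKf.
rewrite /uniformizer eqEsubset; split=> [f /hu h|_ [a Pa <-]]; last exact: nuMr.
by exists (f / u) => //; rewrite mulrC divfK.
Qed.

(** Without a uniformizer every nonunit u has a nonunit f with u/f again a nonunit; iterating gives
    an infinite chain of strictly decreasing orders. *)
Lemma uniformizer_ex : exists u, uniformizer P u.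
Proof.
apply: contrapT => no.
have /choice[s hs] : forall u, exists f, u != 0 -> nonunits P u ->
    [/\ f != 0, nonunits P f & nonunits P (u / f)].
  move=> u; case: (eqVneq u 0) => [_|u0]; first by exists 0.
  have [nu|nnu] := pselect (nonunits P u); last by exists 0.
  apply: contrapT => no2; apply: no; exists u; apply/uniformizerP; split=> // f nf.
  case: (eqVneq f 0) => [->|f0]; first by rewrite mul0r; apply: sub0.
  apply: contrapT => nPf; apply: no2; exists f; split=> //.
  by rewrite -invf_div; apply: not_val_nonunits place_val nPf.
have [y y0 ny] := nonunit_ex.
pose f i := iter i s y.
have hf i : f i != 0 /\ nonunits P (f i).
  by elim: i => [//|i [h1 h2]]; have [] := hs _ h1 h2.
have hff i n : nonunits P (f i / f (i + n.+1)%N).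
  elim: n => [|n IH]; first by rewrite addn1; have [h1 h2] := hf i; have [] := hs _ h1 h2.
  have [h1 h2] := hf (i + n.+1)%N; have [_ _ h3] := hs _ h1 h2.
  rewrite addnS; have -> : f i / f (i + n.+1).+1 = f i / f (i + n.+1)%N * (f (i + n.+1)%N / f (i + n.+1).+1).
    by have [h4 _] := hf (i + n.+1).+1; field; rewrite h1 h4.
  by apply: nuMr => //; case: h3.
have [N hN] := function_field_bound hF (nonunit_nonconst y0 ny).
(* The chain is reversed so that orders increase, and index 0 is avoided because y / f_0 = 1 is not
   a nonunit. *)
suff /hN : polyfree iota y (fun i : 'I_N.+1 => f (N.+1 - i)%N) by rewrite ltnn.
apply: chain_polyfree => //; first by case: ny.
- by move=> i; have [h [? _]] := hf (N.+1 - i)%N.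
- move=> i j lt; have := hff (N.+1 - j)%N (j - i).-1.
  by congr (nonunits P (_ / f _)); have := ltn_ord j; lia.
- by move=> i; have := hff 0%N (N - i)%N; rewrite add0n subSn // -ltnS.
Qed.

(** If every u^n divided f, then 1, u, ..., u^N would form a chain of orders below that of f for
    every N. *)
Lemma archimedean u f : uniformizer P u -> f != 0 -> P f -> exists n : nat, unit_in P (f / u ^+ n).
Proof.
move=> /uniformizerP[u0 nu hu] f0 Pf.
have [n nPn] : exists n, ~ P (f / u ^+ n).
  apply: contrapT => no.
  have Pn n : P (f / u ^+ n) by apply: contrapT => h; apply: no; exists n.
  have nn n : nonunits P (f / u ^+ n).
    have -> : f / u ^+ n = u * (f / u ^+ n.+1) by rewrite exprS; field; rewrite expf_neq0.
    exact: nuMr.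
  have ny : nonunits P f by have := nn 0%N; rewrite expr0 divr1.
  have [N hN] := function_field_bound hF (nonunit_nonconst f0 ny).
  suff /hN : polyfree iota f (fun i : 'I_N.+1 => u ^+ i) by rewrite ltnn.
  apply: chain_polyfree => // [i|i j lt].
    by rewrite expf_neq0 //; split=> //; apply: subX => //; case: nu.
  have -> : u ^+ j / u ^+ i = u * u ^+ (j - i).-1.
    by rewrite -exprS prednK ?subn_gt0 // -{1}(subnK (ltnW lt)) exprD mulfK ?expf_neq0.
  by apply: nuMr => //; apply: subX => //; case: nu.
elim: n nPn => [|n IH] nPn; first by case: nPn; rewrite expr0 divr1.
have [Pn|/IH//] := pselect (P (f / u ^+ n)).
exists n; apply/unit_nonunits => // /hu h; apply: nPn; move: h.
by rewrite exprSr invfM mulrA.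
Qed.

Lemma unit_inV x : unit_in P x -> unit_in P x^-1.
Proof. by case=> a b c; split; rewrite ?invr_eq0 ?invrK. Qed.

Lemma unit_inXz x (n : int) : unit_in P x -> unit_in P (x ^ n).
Proof.
have H m : unit_in P x -> unit_in P (x ^+ m).
  by move=> ux; elim: m => [|m IH]; rewrite ?expr0 ?exprS; [apply: unit_in1|apply: unit_inM].
by move=> ux; case: n => m; [apply: H|rewrite NegzE -invr_expz; apply/unit_inV/H].
Qed.

Lemma ord_ex u f : uniformizer P u -> f != 0 -> exists n : int, unit_in P (f * u ^ (- n)).
Proof.
move=> hu f0; have [u0 _ _] := (uniformizerP u).1 hu.
case: (place_val.2 f) => Pf.
  by have [n h] := archimedean hu f0 Pf; exists n; rewrite -invr_expz.
have [|n h] := archimedean hu _ Pf; first by rewrite invr_eq0.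
exists (- (n : int)); rewrite opprK.
by have := unit_inV h; rewrite invfM !invrK.
Qed.

Lemma ord_uniq u u' f n n' : uniformizer P u -> uniformizer P u' ->
  unit_in P (f * u ^ (- n)) -> unit_in P (f * u' ^ (- n')) -> n = n'.
Proof.
move=> /uniformizerP[u0 nu hu] /uniformizerP[u0' nu' hu'] h h'.
have f0 : f != 0 by have [_ + _] := h; rewrite mulf_eq0 negb_or => /andP[].
have uu : unit_in P (u' / u).
  split; [exact: hu|by rewrite mulf_neq0 ?invr_eq0|by rewrite invf_div; apply: hu'].
have H : unit_in P (u ^ (n - n')).
  have -> : u ^ (n - n') = (f * u ^ (- n))^-1 * (f * u' ^ (- n')) * (u' / u) ^ n'.
    rewrite expfzMl exprz_inv expfzDr // -!invr_expz.
    have h1 := expfz_neq0 n u0; have h2 := expfz_neq0 n' u0; have h3 := expfz_neq0 n' u0'.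
    by field; rewrite f0 h1 h2 h3.
  by apply: unit_inM (unit_inM rP (unit_inV h) h') (unit_inXz _ uu).
have nun (m : nat) : ~ unit_in P (u ^+ m.+1).
  move=> um; apply: (unit_not_nonunit um); rewrite exprS; apply: nuMr => //.
  by apply: subX => //; case: nu.
apply/eqP; rewrite -subr_eq0; case: (n - n') H => [[|m]|m] H //.
  by case: (nun m).
case: (nun m); move: H; rewrite NegzE -invr_expz => /unit_inV; rewrite invrK.
by [].
Qed.

Lemma ordE u f n : uniformizer P u -> unit_in P (f * u ^ (- n)) -> ord P f = n.
Proof.
move=> hu h; rewrite /ord; case: xgetP => [m -> [u' hu' h']|/(_ n) []]; last by exists u.
exact: ord_uniq hu' hu h' h.
Qed.

Opaque ord.

Lemma ord_spec u f : uniformizer P u -> f != 0 -> unit_in P (f * u ^ (- ord P f)).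
Proof. by move=> hu f0; have [n h] := ord_ex hu f0; rewrite (ordE hu h). Qed.

Lemma ordM f g : f != 0 -> g != 0 -> ord P (f * g) = ord P f + ord P g.
Proof.
move=> f0 g0; have [u hu] := uniformizer_ex; have [u0 _ _] := (uniformizerP u).1 hu.
apply: (ordE hu); rewrite opprD expfzDr // mulrACA.
by apply: unit_inM => //; apply: ord_spec.
Qed.

Lemma ord_unit f : unit_in P f -> ord P f = 0.
Proof. by move=> h; have [u hu] := uniformizer_ex; apply: (ordE hu); rewrite oppr0 expr0z mulr1. Qed.

Lemma ord_one : ord P 1 = 0. Proof. by apply: ord_unit; apply: unit_in1. Qed.

Lemma ord_const a : a != 0 -> ord P (iota a) = 0.
Proof. by move=> a0; apply: ord_unit; apply: const_unit. Qed.

Lemma ordV f : f != 0 -> ord P f^-1 = - ord P f.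
Proof.
move=> f0; apply/eqP; rewrite -addr_eq0; apply/eqP.
by have := @ordM f^-1 f; rewrite invr_eq0 mulVf // ord_one => ->.
Qed.

Lemma ord_div f g : f != 0 -> g != 0 -> ord P (f / g) = ord P f - ord P g.
Proof. by move=> f0 g0; rewrite ordM ?invr_eq0 // ordV. Qed.

Lemma ordX f n : f != 0 -> ord P (f ^+ n) = ord P f *+ n.
Proof.
by move=> f0; elim: n => [|n IH]; rewrite ?expr0 ?ord_one // exprS ordM ?expf_neq0 // IH mulrS.
Qed.

Lemma ordN f : ord P (- f) = ord P f.
Proof.
case: (eqVneq f 0) => [->|f0]; first by rewrite oppr0.
by rewrite -mulN1r ordM ?oppr_eq0 ?oner_neq0 // -[-1](rmorphN1 iota) ord_const ?add0r // oppr_eq0 oner_neq0.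
Qed.

Lemma ord_uniformizer u : uniformizer P u -> ord P u = 1.
Proof.
move=> hu; have [u0 _ _] := (uniformizerP u).1 hu; apply: (ordE hu).
by rewrite exprN1 mulfV //; apply: unit_in1.
Qed.

Lemma place_ord f : P f <-> vge P 0 f.
Proof.
have [u hu] := uniformizer_ex; have [u0 nu hu'] := (uniformizerP u).1 hu; have Pu : P u by case: nu.
split=> [Pf|[->|]]; last 2 first.
- exact: sub0.
- case: (eqVneq f 0) => [->|f0]; first by move=> _; apply: sub0.
  have [h _ _] := ord_spec hu f0; case: (ord P f) h => // n h _.
  have -> : f = f * u ^ (- n%:Z) * u ^+ n by rewrite -invr_expz divfK // expf_neq0.
  by apply: subM => //; apply: subX.
case: (eqVneq f 0) => [->|f0]; [by left|right].
by have [n h] := archimedean hu f0 Pf; rewrite (ordE hu (n := n)) // -invr_expz.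
Qed.

Lemma vge_shift n f g : g != 0 -> vge P n f <-> vge P (n + ord P g) (f * g).
Proof.
move=> g0; case: (eqVneq f 0) => [->|f0]; first by rewrite mul0r; split; left.
split=> -[/eqP|h].
- by rewrite (negPf f0).
- by right; rewrite ordM // lerD2r.
- by rewrite mulf_eq0 (negPf f0) (negPf g0).
- by right; move: h; rewrite ordM // lerD2r.
Qed.

Lemma elem_ord (n : int) : exists2 g, g != 0 & ord P g = n.
Proof.
have [u hu] := uniformizer_ex; have [u0 _ _] := (uniformizerP u).1 hu.
exists (u ^ n); first exact: expfz_neq0.
by apply: (ordE hu); rewrite -expfzDr // subrr expr0z; apply: unit_in1.
Qed.

Lemma vgeD n f g : vge P n f -> vge P n g -> vge P n (f + g).
Proof.
have [h h0 eh] := elem_ord (- n).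
rewrite !(vge_shift n _ h0) eh subrr -!place_ord mulrDl; exact: subD.
Qed.

Lemma vgeM n m f g : vge P n f -> vge P m g -> vge P (n + m) (f * g).
Proof.
case: (eqVneq f 0) => [->|f0]; first by rewrite mul0r; left.
case: (eqVneq g 0) => [->|g0]; first by rewrite mulr0; left.
by move=> [/eqP|h1]; rewrite ?(negPf f0) // => -[/eqP|h2]; rewrite ?(negPf g0) //;
  right; rewrite ordM // lerD.
Qed.

Lemma vgeN n f : vge P n f -> vge P n (- f).
Proof. by move=> [->|h]; [left; rewrite oppr0|right; rewrite ordN]. Qed.

Lemma vgeB n f g : vge P n f -> vge P n g -> vge P n (f - g).
Proof. by move=> h1 h2; apply: vgeD => //; apply: vgeN. Qed.

Lemma vge_le n m f : m <= n -> vge P n f -> vge P m f.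
Proof. by move=> le [->|h]; [left|right; apply: le_trans h]. Qed.

Lemma vge_const a : vge P 0 (iota a).
Proof. by apply/place_ord; apply: place_const. Qed.

Lemma vgeZ n a f : vge P n f -> vge P n (iota a * f).
Proof. by move=> h; rewrite -[n]add0r; apply: vgeM => //; apply: vge_const. Qed.

Lemma vge_sum n I (r : seq I) (Q : pred I) (v : I -> F) :
  (forall i, Q i -> vge P n (v i)) -> vge P n (\sum_(i <- r | Q i) v i).
Proof. by move=> h; apply: big_ind => // [|x y]; [left|apply: vgeD]. Qed.

Lemma vgeX n m f : vge P n f -> vge P (n *+ m) (f ^+ m).
Proof.
move=> h; elim: m => [|m IH]; last by rewrite exprS mulrS; apply: vgeM.
by rewrite expr0 mulr0n; right; rewrite ord_one.
Qed.

Lemma nonunits_ord f : nonunits P f <-> vge P 1 f.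
Proof.
have [u hu] := uniformizer_ex; have [u0 nu hu'] := (uniformizerP u).1 hu.
have e : vge P 1 f <-> P (f / u).
  rewrite (vge_shift 1 f (g := u^-1)) ?invr_eq0 // ordV // (ord_uniformizer hu) subrr.
  by rewrite -place_ord.
rewrite e; split=> [/hu' //|h]; have -> : f = u * (f / u) by field.
exact: nuMr.
Qed.

Lemma vge_neq0 n f : f != 0 -> vge P n f <-> n <= ord P f.
Proof. by move=> f0; split=> [[/eqP|//]|]; [rewrite (negPf f0)|right]. Qed.

Lemma vge_residue n f g : vge P n f -> g != 0 -> ord P g = n ->
  exists a, vge P (n + 1) (f - iota a * g).
Proof.
move=> hf g0 eg.
have [a h] : exists a, nonunits P (f / g - iota a).
  by apply: residue; apply/place_ord; rewrite (vge_shift _ _ g0) add0r divfK // eg.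
exists a; move/nonunits_ord: h; rewrite (vge_shift _ _ g0) eg addrC.
by rewrite mulrBl divfK.
Qed.

Lemma ord_add f g : f != 0 -> g != 0 -> ord P f < ord P g ->
  f + g != 0 /\ ord P (f + g) = ord P f.
Proof.
move=> f0 g0 lt.
have nfg : ~ vge P (ord P f + 1) (f + g).
  move=> h; have : vge P (ord P f + 1) (f + g - g).
    by apply: vgeB => //; right; rewrite lezD1.
  by rewrite addrK vge_neq0 // lezD1 ltxx.
have fg0 : f + g != 0 by apply/eqP => e; apply: nfg; left.
split=> //; apply/eqP; rewrite eq_le; apply/andP; split.
  by rewrite leNgt -lezD1; apply/negP => h; apply: nfg; right.
by rewrite -(vge_neq0 _ fg0); apply: vgeD; right => //; apply: ltW.
Qed.

Lemma stalkE C f : stalk C P f <-> vge P (- C P) f.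
Proof.
have H u : uniformizer P u -> P (f * u ^ C P) <-> vge P (- C P) f.
  move=> hu; have [u0 _ _] := (uniformizerP u).1 hu.
  have e : ord P (u ^ C P) = C P.
    by apply: (ordE hu); rewrite -expfzDr // subrr expr0z; apply: unit_in1.
  by rewrite (vge_shift _ _ (expfz_neq0 (C P) u0)) e addNr place_ord.
split=> [[u hu]|]; first by rewrite (H u).
by have [u hu] := uniformizer_ex; rewrite -(H u hu); exists u.
Qed.

End FunctionField.

(** * Approximation, divisors and spaces of sections *)

Section Divisors.
Variables (k : closedFieldType) (F : fieldType) (iota : {rmorphism k -> F}).
Hypothesis hF : function_field_1 iota.
Implicit Types (P Q : set F) (C : set F -> int).
Local Notation ev p y := (map_poly iota p).[y].
Local Notation H0 := (global_sections iota).

(** A discrete valuation ring is a maximal proper subring: if f has a pole at P and lies in Q, any g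
    is an element of P times a power of f. *)
Lemma place_incomp P Q : place iota P -> place iota Q -> P `<=` Q -> P = Q.
Proof.
move=> hP hQ PQ; rewrite eqEsubset; split=> // f Qf; apply: contrapT => nPf.
have rQ := place_sub hQ.
case: hQ => _ _; apply; rewrite eqEsubset; split=> // g _.
have f0 : f != 0 by apply/eqP => e; apply: nPf; rewrite e; apply: sub0 (place_sub hP).
have of_ : ord P f <= -1.
  by rewrite leNgt; apply/negP => h; apply: nPf; apply/(place_ord hF hP); right; lia.
case: (eqVneq g 0) => [->|g0]; first exact: sub0.
have -> : g = g * (f^-1) ^+ `|ord P g|%N * f ^+ `|ord P g|%N.
  by rewrite exprVn divfK // expf_neq0.
apply: subM => //; last exact: subX.
apply/PQ/(place_ord hF hP); right.
rewrite (ordM hF hP) ?expf_neq0 ?invr_eq0 // (ordX hF hP) ?invr_eq0 // (ordV hF hP) //.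
rewrite -mulr_natr; nia.
Qed.

Lemma place_sep P Q : place iota P -> place iota Q -> P <> Q ->
  exists2 w, w != 0 & ord P w < 0 /\ 0 < ord Q w.
Proof.
move=> hP hQ nPQ.
have H P' Q' : place iota P' -> place iota Q' -> P' <> Q' ->
    exists2 a, a != 0 & 0 <= ord P' a /\ ord Q' a < 0.
  move=> hP' hQ' n; apply: contrapT => no; apply: n; apply: place_incomp => // f Pf.
  case: (eqVneq f 0) => [->|f0]; first exact: sub0 (place_sub hQ').
  apply/(place_ord hF hQ'); right; rewrite leNgt; apply/negP => h; apply: no; exists f => //.
  by split=> //; have /(place_ord hF hP')/(vge_neq0 _ _ f0) := Pf.
have [a a0 [h1 h2]] := H P Q hP hQ nPQ.
have [b b0 [h3 h4]] := H Q P hQ hP (fun e => nPQ (esym e)).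
exists (b / a); first by rewrite mulf_neq0 ?invr_eq0.
by rewrite (ord_div hF hP) // (ord_div hF hQ) //; split; lia.
Qed.

Lemma ord_1D P w : place iota P -> w != 0 -> 0 < ord P w -> 1 + w != 0 /\ ord P (1 + w) = 0.
Proof.
move=> hP w0 h; rewrite -(ord_one hF hP); apply: (ord_add hF hP) => //; first exact: oner_neq0.
by rewrite (ord_one hF hP).
Qed.

Lemma ord_1D_neg P w : place iota P -> w != 0 -> ord P w < 0 -> 1 + w != 0 /\ ord P (1 + w) = ord P w.
Proof.
move=> hP w0 h; rewrite addrC; apply: (ord_add hF hP) => //; first exact: oner_neq0.
by rewrite (ord_one hF hP).
Qed.

(** Weak approximation by induction: w handles the places already treated, v separates P from the
    new place Q, and the correction depends on the sign of the order of w at Q. *)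
Lemma place_seps P (s : seq (set F)) : place iota P -> (forall Q, Q \in s -> place iota Q /\ P <> Q) ->
  exists2 w, w != 0 & ord P w < 0 /\ forall Q, Q \in s -> 0 < ord Q w.
Proof.
move=> hP; elim: s => [|Q s IH] hs.
  by have [w w0 e] := elem_ord hF hP (-1); exists w; rewrite ?e.
have [|w w0 [wP ws]] := IH; first by move=> Q' h; apply: hs; rewrite inE h orbT.
have [hQ nPQ] : place iota Q /\ P <> Q by apply: hs; rewrite inE eqxx.
have hs' Q' : Q' \in s -> place iota Q' by move=> h; have [] := hs Q'; rewrite ?inE ?h ?orbT.
have [v v0 [vP vQ]] := place_sep hP hQ nPQ.
have [r r0 hr] : exists2 r, (0 < r)%N & forall Q', Q' \in s -> 0 < r%:Z + ord Q' v.
  elim: (s) => [|Q1 t [r r0 hr]]; first by exists 1%N.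
  exists (r + `|ord Q1 v|)%N; first lia.
  by move=> Q'; rewrite inE => /orP[/eqP ->|/hr h]; lia.
have wr0 : w ^+ r != 0 by rewrite expf_neq0.
have owr Q' : place iota Q' -> ord Q' (w ^+ r) = ord Q' w *+ r by move=> h; rewrite (ordX hF h).
have hv Q' : Q' \in s -> 0 < ord Q' w *+ r + ord Q' v.
  by move=> h; have := hr _ h; have := ws _ h; rewrite -mulr_natr; nia.
have big Q' : 0 < ord Q' w -> 0 < ord Q' w *+ r by move=> h; rewrite -mulr_natr; nia.
have small Q' : ord Q' w < 0 -> ord Q' w *+ r < 0 by move=> h; rewrite -mulr_natr; nia.
(* If w has a pole at Q, the factor w^r / (1 + w^r) has order 0 at P and at Q and the order of w^r
   at the old places, so v decides at P and Q. If w vanishes at Q, it already works. If w has order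
   0 at Q, w^r v works. *)
have [h|h|h] := ltgtP (ord Q w) 0.
- have [n1 e1] : 1 + w ^+ r != 0 /\ ord P (1 + w ^+ r) = ord P (w ^+ r).
    by apply: ord_1D_neg => //; rewrite owr //; apply: small.
  have [_ e2] : 1 + w ^+ r != 0 /\ ord Q (1 + w ^+ r) = ord Q (w ^+ r).
    by apply: ord_1D_neg => //; rewrite owr //; apply: small.
  exists (w ^+ r / (1 + w ^+ r) * v); first by rewrite !mulf_neq0 ?invr_eq0.
  have oo Q' : place iota Q' -> ord Q' (w ^+ r / (1 + w ^+ r) * v) =
      ord Q' (w ^+ r) - ord Q' (1 + w ^+ r) + ord Q' v.
    by move=> h'; rewrite (ordM hF h') ?(ord_div hF h') // mulf_neq0 ?invr_eq0.
  split; first by rewrite oo // e1; lia.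
  move=> Q'; rewrite inE => /orP[/eqP ->|h']; first by rewrite oo // e2; lia.
  have hQ' := hs' _ h'; have [_ e3] : 1 + w ^+ r != 0 /\ ord Q' (1 + w ^+ r) = 0.
    by apply: ord_1D => //; rewrite owr //; apply: big; apply: ws.
  by rewrite oo // e3 subr0 owr //; apply: hv.
- by exists w => //; split=> // Q'; rewrite inE => /orP[/eqP ->|/ws].
- exists (w ^+ r * v); first by rewrite mulf_neq0.
  have oo Q' : place iota Q' -> ord Q' (w ^+ r * v) = ord Q' w *+ r + ord Q' v.
    by move=> h'; rewrite (ordM hF h') // owr.
  split; first by rewrite oo //; have := small _ wP; lia.
  move=> Q'; rewrite inE => /orP[/eqP ->|h']; first by rewrite oo // h mul0rn add0r.
  by rewrite oo; [apply: hv|apply: hs'].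
Qed.

Lemma not_finite_seq (T : eqType) (A : set T) n : ~ finite_set A ->
  exists s : seq T, [/\ uniq s, size s = n & [set` s] `<=` A].
Proof.
move=> nf; elim: n => [|n [s [us ss sA]]]; first by exists [::].
have [x [Ax nx]] : exists x, A x /\ x \notin s.
  apply: contrapT => no; apply: nf; apply: (sub_finite_set (B := [set` s])); last exact: finite_seq.
  by move=> x Ax /=; apply/negPn/negP => h; apply: no; exists x.
exists (x :: s); split; rewrite /= ?nx ?ss //.
by move=> y /=; rewrite inE => /orP[/eqP ->|/sA].
Qed.

(** At N + 1 zeros p_i of f, approximation gives z_i of order 0 at p_i and positive order at the
    other p_j. Reducing a relation over k[f] at p_i kills every term except the constant coefficient
    of z_i, so the z_i are free over k[f]. *)
Lemma zeros_finite f : ~ range iota f -> finite_set [set P | place iota P /\ nonunits P f].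
Proof.
move=> nf; apply: contrapT => /not_finite_seq inf.
have [N hN] := function_field_bound hF nf.
have [s [us ss sA]] := inf N.+1.
pose p (i : 'I_N.+1) := nth setT s i.
have ps i : p i \in s by rewrite mem_nth // ss.
have hp i : place iota (p i) /\ nonunits (p i) f by apply: sA; apply: ps.
have pinj i j : p i = p j -> i = j.
  by move=> /eqP; rewrite nth_uniq ?ss // => /eqP/val_inj.
have /choice[z hz] : forall i, exists z, [/\ z != 0, ord (p i) z = 0 &
    forall j, j != i -> 0 < ord (p j) z].
  move=> i; have [hi _] := hp i.
  have [|w w0 [wi wj]] := @place_seps (p i) [seq p j | j <- enum 'I_N.+1 & j != i] hi.
    move=> Q /mapP[j]; rewrite mem_filter => /andP[ji _] ->; split; first by have [] := hp j.
    by move/pinj => e; rewrite e eqxx in ji.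
  have [n1 e1] := ord_1D_neg hi w0 wi.
  exists (w / (1 + w)); split; first by rewrite mulf_neq0 ?invr_eq0.
    by rewrite (ord_div hF hi) // e1 subrr.
  move=> j ji; have [hj _] := hp j.
  have oj : 0 < ord (p j) w by apply: wj; apply: map_f; rewrite mem_filter ji mem_enum.
  by rewrite (ord_div hF hj) //; have [_ ->] := ord_1D hj w0 oj; rewrite subr0.
have f0 : f != 0 by apply/eqP => e; apply: nf; rewrite e; exists 0; rewrite ?rmorph0.
suff /hN : polyfree iota f z by rewrite ltnn.
apply: polyfree_red => // q hq i; apply/eqP/negPn/negP => qi.
have [hi ni] := hp i; have [zi0 zi _] := hz i.
have zP l : vge (p i) 0 (z l).
  right; case: (eqVneq l i) => [->|li]; first by rewrite zi.
  by have [_ _ h] := hz l; apply: ltW; apply: h; rewrite eq_sym.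
have : vge (p i) 1 (iota (q i)`_0 * z i).
  have -> : iota (q i)`_0 * z i = - ((ev (q i) f - iota (q i)`_0) * z i
     + \sum_(l | l != i) ev (q l) f * z l).
    by move: hq; rewrite (bigD1 i) //= => /eqP; rewrite addrC addr_eq0 => /eqP ->; ring.
  apply: (vgeN hF hi); apply: (vgeD hF hi).
    have [w Pw ->] := ev_split hi (q i) (let: conj h _ := ni in h).
    rewrite addrAC subrr add0r -[1]addr0; apply: (vgeM hF hi) => //.
    apply/(nonunits_ord hF hi); rewrite mulrC; apply: nonunitsM => //; exact: place_sub hi.
  apply: (vge_sum hF hi) => l li; rewrite -[1]add0r; apply: (vgeM hF hi).
    by apply/(place_ord hF hi)/(ev_in hi); case: ni.
  right; have [_ _ h] := hz l.
  have : 0 < ord (p i) (z l) by apply: h; rewrite eq_sym.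
  by lia.
rewrite vge_neq0 ?mulf_neq0 ?fmorph_eq0 // (ordM hF hi) ?fmorph_eq0 // zi (ord_const hF hi) //.
Qed.

Lemma val_place V f : valuation_ring V -> range iota `<=` V -> ~ V f -> place iota V.
Proof. by move=> vV kV nf; split=> // e; apply: nf; rewrite e. Qed.

(** A function without poles lies in every valuation ring containing k, hence is integral over the
    algebraically closed field k, hence constant. *)
Lemma pole_ex f : ~ range iota f -> exists2 P, place iota P & ~ P f.
Proof.
move=> nf; apply: contrapT => no.
pose A := range iota; have rA : subring A.
  apply/subringP; split; first by exists 1; rewrite ?rmorph1.
  - by move=> _ _ [a _ <-] [b _ <-]; exists (a - b); rewrite ?rmorphB.
  - by move=> _ _ [a _ <-] [b _ <-]; exists (a * b); rewrite ?rmorphM.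
have [g [gm hg gf]] : integral_closure A f.
  apply: integral_of_val => // V vV AV; apply: contrapT => nVf; apply: no.
  by exists V => //; apply: val_place nVf.
have /choice[a ha] : forall i, exists a, iota a = g`_i by move=> i; have [a _ e] := hg i; exists a.
pose q : {poly k} := \poly_(i < size g) a i.
have e : map_poly iota q = g.
  apply/polyP => i; rewrite coef_map coef_poly; case: ltnP => h; first exact: ha.
  by rewrite [LHS]rmorph0 nth_default.
have q0 : q != 0 by rewrite -(map_poly_eq0 iota) e monic_neq0.
by have /negP := nonconst_root nf q0; rewrite e.
Qed.

Lemma ord_finite f : f != 0 -> finite_set [set P | place iota P /\ ord P f != 0].
Proof.
move=> f0; have [[a _ e]|nf] := pselect (range iota f).
  apply: (sub_finite_set (B := set0)) => // P [hP]; rewrite -e (ord_const hF hP) ?eqxx //.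
  by rewrite -(fmorph_eq0 iota) e.
have nf' : ~ range iota f^-1.
  by move=> [a _ e]; apply: nf; exists a^-1; rewrite // fmorphV e invrK.
apply: sub_finite_set (_ : finite_set ([set P | place iota P /\ nonunits P f] `|`
  [set P | place iota P /\ nonunits P f^-1])); last first.
  by rewrite finite_setU; split; apply: zeros_finite.
move=> P [hP o0]; have [h|h|h] := ltgtP (ord P f) 0.
- right; split=> //; apply/(nonunits_ord hF hP); right; rewrite (ordV hF hP) //; lia.
- left; split=> //; apply/(nonunits_ord hF hP); right; lia.
- by rewrite h in o0.
Qed.

Lemma H0P C f : H0 C f <-> forall P, place iota P -> vge P (- C P) f.
Proof. by split=> h P hP; apply/(stalkE hF hP); apply: h. Qed.

Lemma H0_subspace C : subspace iota (H0 C).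
Proof.
split; first by apply/H0P => P hP; left.
- move=> x y /H0P hx /H0P hy; apply/H0P => P hP.
  by apply: (vgeD hF hP); [apply: hx|apply: hy].
- by move=> a x /H0P hx; apply/H0P => P hP; apply: (vgeZ hF hP); apply: hx.
Qed.

Lemma H0_mono C C' : (forall P, place iota P -> C P <= C' P) -> H0 C `<=` H0 C'.
Proof.
move=> h f /H0P hf; apply/H0P => P hP; apply: vge_le (hf P hP).
by rewrite lerN2; apply: h.
Qed.

Lemma H0_ext C C' : (forall P, place iota P -> C P = C' P) -> H0 C = H0 C'.
Proof. by move=> h; rewrite eqEsubset; split; apply: H0_mono => P hP; rewrite h. Qed.

Lemma H0_mul C f g : f != 0 -> H0 C (g * f) <-> H0 (fun P => C P + ord P f) g.
Proof.
move=> f0; rewrite !H0P; split=> h P hP; have := h P hP.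
  by move=> hv; apply/(vge_shift hF hP _ _ f0); rewrite opprD subrK.
by move/(vge_shift hF hP _ _ f0); rewrite opprD subrK.
Qed.

Lemma const_H0 f : H0 (fun=> 0) f <-> range iota f.
Proof.
split=> [/H0P h|[a _ <-]]; last by apply/H0P => P hP; rewrite oppr0; apply: vge_const.
apply: contrapT => nf; have [P hP nP] := pole_ex nf; apply: nP; apply/(place_ord hF hP).
by have := h P hP; rewrite oppr0.
Qed.

Lemma kdim_const : kdim iota (range iota) 1.
Proof.
exists (fun=> 1); split.
- by move=> _; exists 1; rewrite ?rmorph1.
- by move=> c; rewrite /comb big_ord1 mulr1 => /eqP; rewrite fmorph_eq0 => /eqP e i; rewrite ord1.
- by move=> _ [a _ <-]; exists (fun=> a); rewrite /comb big_ord1 mulr1.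
Qed.

Definition addpt C P : set F -> int := fun Q => C Q + point_divisor P Q.

Lemma addptE C P : addpt C P P = C P + 1. Proof. by rewrite /addpt /point_divisor eqxx. Qed.
Lemma addpt_neq C P Q : Q <> P -> addpt C P Q = C Q.
Proof. by move=> /eqP/negPf h; rewrite /addpt /point_divisor h addr0. Qed.

Lemma H0_addpt C P f : place iota P -> H0 C f <-> H0 (addpt C P) f /\ vge P (- C P) f.
Proof.
move=> hP; split=> [hf|[/H0P h hPf]].
  split; last by move/H0P: hf; apply.
  apply: H0_mono hf => Q hQ; rewrite /addpt /point_divisor; case: (Q == P) => /=; lia.
apply/H0P => Q hQ; have [->//|n] := pselect (Q = P).
by have := h Q hQ; rewrite addpt_neq.
Qed.

Lemma H0_step C P n : place iota P -> kdim iota (H0 C) n ->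
  kdim iota (H0 (addpt C P)) n /\ H0 (addpt C P) `<=` H0 C \/
  kdim iota (H0 (addpt C P)) n.+1 /\
    exists2 g, H0 (addpt C P) g & g != 0 /\ ord P g = - (addpt C P P).
Proof.
move=> hP hn.
have ordg g : H0 (addpt C P) g -> ~ H0 C g -> g != 0 /\ ord P g = - (addpt C P P).
  move=> hg ng; have g0 : g != 0.
    by apply/eqP => e; apply: ng; rewrite e; have [] := H0_subspace C.
  split=> //; have /H0P/(_ P hP)/(vge_neq0 _ _ g0) := hg.
  have : ~ vge P (- C P) g by move=> h; apply: ng; apply/(H0_addpt _ _ hP).
  rewrite addptE vge_neq0 // => h1 h2; lia.
have [| | h |[h [g hg ng]]] := dim_step (H0_subspace C) (H0_subspace (addpt C P)) _ hn.
- by move=> f /(H0_addpt _ _ hP)[].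
- move=> f g hf hg ng; have [g0 og] := ordg g hg ng.
  have /H0P/(_ P hP) vf := hf; rewrite -og in vf.
  have [a ha] := vge_residue hF hP vf g0 erefl; exists a; apply/(H0_addpt _ _ hP); split.
    apply: (subspaceB (H0_subspace (addpt C P))) => //.
    by have [_ _ hZ] := H0_subspace (addpt C P); apply: hZ.
  by move: ha; rewrite og addptE opprD addrNK.
- by left.
- by right; split=> //; exists g => //; apply: ordg.
Qed.

Definition supported C (s : seq (set F)) : Prop :=
  [/\ uniq s, forall P, P \in s -> place iota P & forall P, place iota P -> P \notin s -> C P = 0].

Lemma divisorP C : divisor iota C <-> exists s, supported C s.
Proof.
split=> [/finite_seqP[s e]|[s [us sp s0]]].
  exists (undup s); split; first exact: undup_uniq.
    by move=> P; rewrite mem_undup => h; have : [set` s] P by []; rewrite -e => -[].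
  move=> P hP; rewrite mem_undup => h; apply/eqP/negPn/negP => n0.
  by have /negP[] := h; have : [set` s] P by rewrite -e.
apply: sub_finite_set (finite_seq s) => P [hP n0] /=.
by apply/negPn/negP => h; rewrite s0 ?eqxx in n0.
Qed.

Lemma degreeE C s : supported C s -> degree iota C = \sum_(P <- s) C P.
Proof.
move=> [us sp s0]; rewrite fsbig_seq //; apply/esym; apply: fsbig_widen => // P [hP h] /=.
by apply: s0 => //; apply/negP.
Qed.

Lemma supported_cat C s t : supported C s -> (forall P, P \in t -> place iota P) ->
  supported C (undup (s ++ t)).
Proof.
move=> [us sp s0] tp; split; first exact: undup_uniq.
  by move=> P; rewrite mem_undup mem_cat => /orP[/sp|/tp].
by move=> P hP; rewrite mem_undup mem_cat negb_or => /andP[/s0 -> //].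
Qed.

Lemma supported_both C C' : divisor iota C -> divisor iota C' ->
  exists s, supported C s /\ supported C' s.
Proof.
move=> /divisorP[s hs] /divisorP[t ht]; exists (undup (s ++ t)).
have [us ps s0] := hs; have [ut pt t0] := ht; split; first exact: supported_cat.
split; first exact: undup_uniq.
  by move=> P; rewrite mem_undup mem_cat => /orP[/ps|/pt].
by move=> P hP; rewrite mem_undup mem_cat negb_or => /andP[_ /t0 ->].
Qed.

Lemma divisorD C C' : divisor iota C -> divisor iota C' -> divisor iota (fun P => C P + C' P).
Proof.
move=> hC hC'; have [s [[us sp s0] [_ _ s0']]] := supported_both hC hC'.
by apply/divisorP; exists s; split=> // P hP n; rewrite s0 ?s0'.
Qed.

Lemma degreeD C C' : divisor iota C -> divisor iota C' ->
  degree iota (fun P => C P + C' P) = degree iota C + degree iota C'.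
Proof.
move=> hC hC'; have [s [h h']] := supported_both hC hC'.
have [us sp s0] := h; have [_ _ s0'] := h'.
rewrite (degreeE h) (degreeE h') (@degreeE _ s) ?big_split //.
by split=> // P hP n; rewrite s0 ?s0'.
Qed.

Lemma divisorMn C n : divisor iota C -> divisor iota (fun P => C P *+ n).
Proof.
move=> /divisorP[s [us sp s0]]; apply/divisorP; exists s; split=> // P hP h.
by rewrite s0 ?mul0rn.
Qed.

Lemma degreeMn C n : divisor iota C -> degree iota (fun P => C P *+ n) = degree iota C *+ n.
Proof.
move=> /divisorP[s h]; have [us sp s0] := h.
rewrite (degreeE h) (@degreeE _ s) ?sumrMnl //; split=> // P hP h'.
by rewrite s0 ?mul0rn.
Qed.

Lemma divisorN C : divisor iota C -> divisor iota (fun P => - C P).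
Proof.
move=> /divisorP[s [us sp s0]]; apply/divisorP; exists s; split=> // P hP h.
by rewrite s0 ?oppr0.
Qed.

Lemma degreeN C : divisor iota C -> degree iota (fun P => - C P) = - degree iota C.
Proof.
move=> /divisorP[s h]; have [us sp s0] := h.
rewrite (degreeE h) (@degreeE _ s) ?sumrN //; split=> // P hP h'.
by rewrite s0 ?oppr0.
Qed.

Lemma supported_point P : place iota P -> supported (point_divisor P) [:: P].
Proof.
move=> hP; split=> // Q; rewrite inE; first by move/eqP ->.
by move=> _; rewrite /point_divisor => /negPf ->.
Qed.

Lemma divisor_point P : place iota P -> divisor iota (point_divisor P).
Proof. by move=> hP; apply/divisorP; exists [:: P]; apply: supported_point. Qed.

Lemma degree_point P : place iota P -> degree iota (point_divisor P) = 1.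
Proof. by move=> hP; rewrite (degreeE (supported_point hP)) big_seq1 /point_divisor eqxx. Qed.

Lemma divisor0 : divisor iota (fun=> 0).
Proof. by apply/divisorP; exists [::]. Qed.

Lemma degree_ext C C' : (forall P, place iota P -> C P = C' P) -> degree iota C = degree iota C'.
Proof. by move=> h; apply: eq_fsbigr => P /set_mem; apply: h. Qed.

Lemma degree0 : degree iota (fun=> 0) = 0.
Proof. by rewrite (@degreeE _ [::]) ?big_nil. Qed.

Lemma degree_ge0 C : divisor iota C -> (forall P, place iota P -> 0 <= C P) -> 0 <= degree iota C.
Proof.
move=> /divisorP[s h] C0; rewrite (degreeE h) big_seq; apply: sumr_ge0 => P Ps.
by apply: C0; case: h => _ + _; apply.
Qed.

Lemma degree0_ge0 C : divisor iota C -> (forall P, place iota P -> 0 <= C P) ->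
  degree iota C = 0 -> forall P, place iota P -> C P = 0.
Proof.
move=> /divisorP[s h] C0; rewrite (degreeE h) => e P hP.
have [us sp s0] := h; case: (boolP (P \in s)) => [Ps|]; last exact: s0.
have : C P <= 0.
  rewrite -e (bigD1_seq P) //= lerDl big_seq_cond; apply: sumr_ge0 => Q /andP[Qs _].
    by apply: C0; apply: sp.
by move=> h1; apply/eqP; rewrite eq_le h1 C0.
Qed.

Lemma divisor_ord f : f != 0 -> divisor iota (fun P => ord P f).
Proof. exact: ord_finite. Qed.

Lemma degree_addpt C P : place iota P -> divisor iota C ->
  degree iota (addpt C P) = degree iota C + 1.
Proof. by move=> hP hC; rewrite degreeD ?degree_point //; apply: divisor_point. Qed.

Definition subpt C P : set F -> int := fun Q => C Q - point_divisor P Q.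

Lemma subptK C P : addpt (subpt C P) P = C.
Proof. by apply/funext => Q; rewrite /addpt /subpt subrK. Qed.

Lemma divisor_subpt C P : place iota P -> divisor iota C -> divisor iota (subpt C P).
Proof. by move=> hP hC; apply: divisorD => //; apply/divisorN/divisor_point. Qed.

Lemma degree_subpt C P : place iota P -> divisor iota C ->
  degree iota (subpt C P) = degree iota C - 1.
Proof.
by move=> hP hC; apply/eqP; rewrite eq_sym subr_eq -(degree_addpt hP (divisor_subpt hP hC)) subptK.
Qed.

(** Induction on the sum of the absolute values of C: positive values are lowered and negative ones
    raised, which is why Phi must also pass from [addpt C P] back to C. *)
Lemma divisor_ind (Phi : (set F -> int) -> Prop) :
  (forall C, (forall P, place iota P -> C P = 0) -> Phi C) ->
  (forall C P, place iota P -> Phi C -> Phi (addpt C P)) ->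
  (forall C P, place iota P -> Phi (addpt C P) -> Phi C) ->
  forall C, divisor iota C -> Phi C.
Proof.
move=> h0 hA hS C /divisorP[s hs].
move: {2}(\sum_(P <- s) `|C P|%N)%N (leqnn (\sum_(P <- s) `|C P|%N)) => N.
elim: N C hs => [|N IH] C hs le; have [us sp s0] := hs.
  apply: h0 => P hP; case: (boolP (P \in s)) => [Ps|]; last exact: s0.
  move: le; rewrite leqn0 sum_nat_seq_eq0 => /allP/(_ P Ps) /=; lia.
have [h|[P [Ps nP]]] : (forall P, P \in s -> C P = 0) \/ exists P, P \in s /\ C P != 0.
  have [[P [Ps nP]]|no] := pselect (exists P, P \in s /\ C P != 0); [by right; exists P|left].
  by move=> P Ps; apply/eqP/negPn/negP => n; apply: no; exists P.
  apply: h0 => P hP; case: (boolP (P \in s)) => [/h //|]; exact: s0.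
have hP := sp P Ps.
have supp C' : (forall Q, Q <> P -> C' Q = C Q) -> supported C' s.
  move=> e; split=> // Q hQ n; rewrite e ?s0 // => eQ; by rewrite eQ Ps in n.
have bnd C' : (forall Q, Q <> P -> C' Q = C Q) -> (`|C' P| < `|C P|)%N ->
    (\sum_(Q <- s) `|C' Q| <= N)%N.
  move=> e lt; rewrite -ltnS; apply: leq_trans le.
  rewrite (bigD1_seq P) //= [ltnRHS](bigD1_seq P) //= -addSn leq_add //.
  rewrite leq_eqVlt; apply/orP; left; apply/eqP; apply: eq_bigr => Q /eqP QP; by rewrite e.
have eA Q : Q <> P -> addpt C P Q = C Q by apply: addpt_neq.
have eS Q : Q <> P -> subpt C P Q = C Q.
  by move=> /eqP/negPf n; rewrite /subpt /point_divisor n subr0.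
case: (ltrP 0 (C P)) => h.
  rewrite -(subptK C P); apply: hA => //; apply: IH; first exact: supp.
  by apply: bnd => //; rewrite /subpt /point_divisor eqxx; lia.
by apply: (hS _ P) => //; apply: IH; [apply: supp|apply: bnd; rewrite // addptE; lia].
Qed.

Lemma H0_dim C : divisor iota C -> exists n, kdim iota (H0 C) n.
Proof.
move: C; apply: divisor_ind => [C h|C P hP [n hn]|C P hP [n hn]].
- exists 1%N; rewrite (H0_ext (C' := fun=> 0)) //.
  by have -> : H0 (fun=> 0) = range iota; [apply/funext => f; apply/propext; apply: const_H0|apply: kdim_const].
- by case: (H0_step hP hn) => -[h _]; [exists n|exists n.+1].
- have [m _ h] : exists2 m, (m <= n)%N & kdim iota (H0 C) m; last by exists m.
  apply: dim_exists; first exact: H0_subspace.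
  by move=> m w hw fw; apply: kdim_free_le hn _ fw => i; have /(H0_addpt _ _ hP)[] := hw i.
Qed.

Definition h0 C : nat := xget 0%N [set n | kdim iota (H0 C) n].

Lemma h0_spec C : divisor iota C -> kdim iota (H0 C) (h0 C).
Proof. by move=> /H0_dim[n hn]; rewrite /h0; case: xgetP => [m -> //|/(_ n)]. Qed.

Lemma h0E C n : kdim iota (H0 C) n -> h0 C = n.
Proof.
move=> hn; rewrite /h0; case: xgetP => [m _ /= hm|/(_ n) //]; exact: kdim_uniq hm hn.
Qed.

Lemma h0_ext C C' : (forall P, place iota P -> C P = C' P) -> h0 C = h0 C'.
Proof. by move=> h; rewrite /h0 (H0_ext h). Qed.

Lemma h0_zero : h0 (fun=> 0) = 1%N.
Proof.
apply: h0E; have -> : H0 (fun=> 0) = range iota; last exact: kdim_const.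
by apply/funext => f; apply/propext; apply: const_H0.
Qed.

Lemma h0_addpt_le C P : place iota P -> divisor iota C -> (h0 C <= h0 (addpt C P) <= (h0 C).+1)%N.
Proof.
move=> hP hC; have := H0_step hP (h0_spec hC).
by move=> [] [/h0E -> _]; rewrite ?leqnn ?leqnSn.
Qed.

Lemma h0_addpt_lt C P : place iota P -> divisor iota C -> (h0 C < h0 (addpt C P))%N ->
  exists2 g, H0 (addpt C P) g & g != 0 /\ ord P g = - (addpt C P P).
Proof.
move=> hP hC; have [[/h0E -> _]|[_ h] //] := H0_step hP (h0_spec hC).
by rewrite ltnn.
Qed.

Lemma h0_mul C f : divisor iota C -> f != 0 -> h0 (fun P => C P + ord P f) = h0 C.
Proof.
move=> hC f0; apply: h0E; have [b [Cb fb sb]] := h0_spec hC.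
exists (fun i => b i / f); split.
- by move=> i; apply/(H0_mul _ _ f0); rewrite divfK.
- move=> c hc; apply: fb; have := congr1 (fun t => t * f) hc; rewrite mul0r /comb mulr_suml => h.
  by rewrite -[RHS]h; apply: eq_bigr => i _; rewrite -mulrA divfK.
- move=> g /(H0_mul _ _ f0)/sb[c e]; exists c; apply: (mulIf f0).
  by rewrite e /comb mulr_suml; apply: eq_bigr => i _; rewrite -mulrA divfK.
Qed.

Lemma h0_pos C : divisor iota C -> (0 < h0 C)%N -> exists2 f, f != 0 & H0 C f.
Proof.
move=> hC; have [b [Cb fb _]] := h0_spec hC; move=> lt.
exists (b (Ordinal lt)) => //; apply/eqP => e.
have h := fb (fun j => (j == Ordinal lt)%:R); rewrite comb_delta e in h.
by have /eqP := h erefl (Ordinal lt); rewrite eqxx oner_eq0.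
Qed.

End Divisors.

(** * Riemann-Roch in genus one *)

Section Elliptic.
Variables (k : closedFieldType) (F : fieldType) (iota : {rmorphism k -> F}).
Hypothesis hE : elliptic_curve iota.
Implicit Types (P Q : set F) (C E : set F -> int).
Local Notation H0 := (global_sections iota).
Local Notation h0 := (h0 iota).
Let hF : function_field_1 iota := proj1 hE.

Lemma genus_le C : divisor iota C -> degree iota C <= (h0 C)%:Z.
Proof.
move=> hC; have [_ [h _]] := hE.
by have := h C (h0 C) hC ((has_dimP _ _ _).2 (h0_spec hF hC)); lia.
Qed.

Lemma genus_eq : exists2 C, divisor iota C & degree iota C = (h0 C)%:Z.
Proof.
have [_ [_ [C [n [hC /has_dimP hn e]]]]] := hE.
by exists C => //; rewrite (h0E hn); lia.
Qed.

(** The divisor of g^2 has the sections of the zero divisor up to a factor, so the genus inequality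
    gives 2 deg(g) <= 1. Without the square only deg(g) <= 1 would follow. The opposite inequality
    comes from 1/g. *)
Lemma deg_ord f : f != 0 -> degree iota (fun P => ord P f) = 0.
Proof.
have H g : g != 0 -> degree iota (fun P => ord P g) <= 0.
  move=> g0; have g20 : g ^+ 2 != 0 by rewrite expf_neq0.
  have := genus_le (divisor_ord hF g20).
  rewrite -(h0_ext hF (C := fun P => 0 + ord P (g ^+ 2))) => [|P _]; last by rewrite add0r.
  rewrite (h0_mul hF (divisor0 iota) g20) (h0_zero hF).
  rewrite (@degree_ext _ _ _ _ (fun P => ord P g *+ 2)) => [|P hP]; last by apply: (ordX hF hP).
  rewrite degreeMn; last exact: divisor_ord.
  by rewrite mulr2n; lia.
move=> f0; apply/eqP; rewrite eq_le H //=; have := H f^-1; rewrite invr_eq0 => /(_ f0).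
rewrite (@degree_ext _ _ _ _ (fun P => - ord P f)) => [|P hP]; last by apply: (ordV hF hP).
by rewrite degreeN ?oppr_le0 //; apply: divisor_ord.
Qed.

Lemma effective_of C f : divisor iota C -> f != 0 -> H0 C f ->
  [/\ divisor iota (fun P => C P + ord P f),
      degree iota (fun P => C P + ord P f) = degree iota C
    & forall P, place iota P -> 0 <= C P + ord P f].
Proof.
move=> hC f0 /(H0P hF) hf; have hf0 := divisor_ord hF f0; split; first exact: divisorD.
  by rewrite degreeD // deg_ord // addr0.
by move=> P hP; have /(vge_neq0 _ _ f0) := hf P hP; lia.
Qed.

Lemma section_deg0 C f : divisor iota C -> degree iota C = 0 -> f != 0 -> H0 C f ->
  forall P, place iota P -> ord P f = - C P.
Proof.
move=> hC dC f0 hf; have [hd e ge] := effective_of hC f0 hf.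
rewrite dC in e => P hP; have := degree0_ge0 hd ge e hP; lia.
Qed.

Lemma eff_pos E : divisor iota E -> (forall P, place iota P -> 0 <= E P) ->
  0 < degree iota E -> exists2 P, place iota P & 0 < E P.
Proof.
move=> hE' E0 dE; apply: contrapT => no.
have : degree iota E = 0; last by move: dE => /[swap] ->; rewrite ltxx.
rewrite (@degree_ext _ _ _ _ (fun=> 0)) ?degree0 // => P hP.
apply/eqP; rewrite eq_le E0 // andbT leNgt; apply/negP => h; apply: no; by exists P.
Qed.

Lemma subpt_eff E P : (forall Q, place iota Q -> 0 <= E Q) -> 0 < E P ->
  forall Q, place iota Q -> 0 <= subpt E P Q.
Proof.
move=> E0 EP Q hQ; rewrite /subpt /point_divisor; case: eqP => [->|_] /=.
  by move: EP; lia.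
by rewrite subr0 E0.
Qed.

Lemma h0_eff C E : divisor iota C -> divisor iota E -> (forall P, place iota P -> 0 <= E P) ->
  (h0 (fun P => C P + E P)) %:Z <= (h0 C)%:Z + degree iota E.
Proof.
move=> hC; move: {2}(`|degree iota E|%N) (leqnn `|degree iota E|%N) => n.
elim: n E => [|n IH] E le hE' E0; have d0 := degree_ge0 hE' E0.
  have dE : degree iota E = 0 by lia.
  have EE := degree0_ge0 hE' E0 dE.
  by rewrite dE addr0 (h0_ext hF (C' := C)) // => P hP; rewrite EE ?addr0.
have [e|n0] := eqVneq (degree iota E) 0.
  have EE := degree0_ge0 hE' E0 e.
  by rewrite e addr0 (h0_ext hF (C' := C)) // => P hP; rewrite EE ?addr0.
have [|P hP EP] := eff_pos hE' E0; first by lia.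
have hS := divisor_subpt hP hE'.
have dS := degree_subpt hP hE'.
have := IH _ _ hS (subpt_eff E0 EP); rewrite dS => /(_ ltac:(lia)) h1.
have := h0_addpt_le hF hP (divisorD hC hS).
have -> : addpt (fun Q => C Q + subpt E P Q) P = (fun Q => C Q + E Q).
  by apply/funext => Q; rewrite /addpt /subpt; ring.
lia.
Qed.

Lemma place_ex : exists P, place iota P.
Proof.
have [x [tx _]] := hF.
suff nx : ~ range iota x by have [P hP _] := pole_ex nx; exists P.
move=> [a _ e]; apply: tx; exists ('X - a%:P); first by rewrite polyXsubC_eq0.
by rewrite rmorphB /= map_polyX map_polyC /= root_XsubC e.
Qed.

Lemma divisor_mulpt P n : place iota P -> divisor iota (fun Q => point_divisor P Q *+ n).
Proof. by move=> hP; apply/divisorMn/divisor_point. Qed.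

Lemma degree_mulpt P n : place iota P -> degree iota (fun Q => point_divisor P Q *+ n) = n%:Z.
Proof. by move=> hP; rewrite degreeMn ?degree_point ?natz //; apply: divisor_point. Qed.

Lemma mulptS P n : addpt (fun Q => point_divisor P Q *+ n) P = fun Q => point_divisor P Q *+ n.+1.
Proof. by apply/funext => Q; rewrite /addpt mulrSr. Qed.

(* A function with a single simple pole would make the genus 0. *)
Lemma h0_point P : place iota P -> h0 (point_divisor P) = 1%N.
Proof.
move=> hP.
have eP : addpt (fun=> 0) P = point_divisor P by apply/funext => Q; rewrite /addpt add0r.
have := h0_addpt_le hF hP (divisor0 iota); rewrite eP (h0_zero hF) => /andP[le1 le2].
apply/eqP; rewrite eqn_leq le1 andbT leqNgt; apply/negP => lt.
have [|g gH [g0 og]] := h0_addpt_lt hF hP (divisor0 iota); first by rewrite eP (h0_zero hF).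
rewrite addptE add0r in og; rewrite eP in gH.
pose nP n : set F -> int := fun Q => point_divisor P Q *+ n.
(* The powers 1, g, ..., g^n have distinct pole orders at P. *)
have hn n : (n.+1 <= h0 (nP n))%N.
  elim: n => [|n IH].
    by rewrite (h0_ext hF (C' := fun=> 0)) ?(h0_zero hF) // => Q _; rewrite /nP mulr0n.
  have hd := divisor_mulpt n hP.
  have := H0_step hF hP (h0_spec hF hd); rewrite mulptS => -[[_ sub]|[h _]]; last first.
    by rewrite (h0E h).
  have : H0 (nP n) (g ^+ n.+1).
    apply: sub; apply/(H0P hF) => Q hQ; rewrite -mulNrn.
    by apply: (vgeX hF hQ); move/(H0P hF): gH; apply.
  move/(H0P hF)/(_ P hP)/vge_neq0; rewrite expf_neq0 // => /(_ isT).
  by rewrite (ordX hF hP) // og /nP /point_divisor eqxx; lia.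
(* C0 attains the genus. For N > deg C0 the divisor N P - C0 is equivalent to an effective one of
   degree N - deg C0, so h0(N P) <= h0(C0) + N - deg C0 = N, against h0(N P) >= N + 1. *)
have [C0 hC0 dC0] := genus_eq.
pose N := (`|degree iota C0|.+1)%N.
have hNP := divisor_mulpt N hP; have hN := divisorN hC0.
have hD := divisorD hNP hN.
have dD := degreeD hNP hN; rewrite degreeN // degree_mulpt // in dD.
have [|f f0 hf] := h0_pos hF hD.
  by have := genus_le hD; rewrite dD /N; lia.
have [hEff dE E0] := effective_of hD f0 hf.
have := h0_eff hC0 hEff E0; rewrite dE dD -dC0.
rewrite (h0_ext hF (C' := fun Q => nP N Q + ord Q f)) => [|Q _]; last by rewrite /nP; ring.
rewrite (h0_mul hF hNP f0) addrCA subrr addr0 lez_nat => h1.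
by have := leq_trans (hn N) h1; rewrite ltnn.
Qed.

(** A nonzero section makes C equivalent to an effective divisor of degree 1, which is a point. *)
Lemma h0_deg1 C : divisor iota C -> degree iota C = 1 -> h0 C = 1%N.
Proof.
move=> hC dC; have [|f f0 hf] := h0_pos hF hC; first by have := genus_le hC; lia.
have [hd e ge] := effective_of hC f0 hf; rewrite dC in e.
have [|P hP EP] := eff_pos hd ge; first by rewrite e.
have := degree0_ge0 (divisor_subpt hP hd) (subpt_eff ge EP).
rewrite degree_subpt // e subrr => /(_ erefl) eq0.
rewrite -(h0_mul hF hC f0) -(h0_point hP); apply: (h0_ext hF) => Q hQ.
by have := eq0 Q hQ; rewrite /subpt => /eqP; rewrite subr_eq0 => /eqP.
Qed.

Theorem riemann_roch C : divisor iota C -> 1 <= degree iota C -> (h0 C)%:Z = degree iota C.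
Proof.
move: {2}(`|degree iota C|%N) (leqnn `|degree iota C|%N) => n; elim: n C => [|n IH] C le hC dC.
  lia.
have [e|n1] := eqVneq (degree iota C) 1; first by rewrite e h0_deg1.
have [P hP] := place_ex; have hS := divisor_subpt hP hC.
have dS := degree_subpt hP hC.
have := IH _ _ hS; rewrite dS => /(_ ltac:(lia) ltac:(lia)) h1.
have := h0_addpt_le hF hP hS; rewrite subptK; have := genus_le hC; lia.
Qed.

Lemma section_exact C P : divisor iota C -> place iota P -> 2 <= degree iota C ->
  exists2 f, H0 C f & f != 0 /\ ord P f = - C P.
Proof.
move=> hC hP dC; have hS := divisor_subpt hP hC; have dS := degree_subpt hP hC.
have := h0_addpt_lt hF hP hS; rewrite subptK; apply.
have := riemann_roch hC; have := riemann_roch hS; rewrite dS; lia.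
Qed.

Lemma mulpt_sections P n f : place iota P -> H0 (fun Q => point_divisor P Q *+ n) f <->
  vge P (- n%:Z) f /\ forall Q, place iota Q -> Q <> P -> vge Q 0 f.
Proof.
move=> hP; rewrite (H0P hF); split=> [h|[h1 h2] Q hQ].
  split; first by have := h P hP; rewrite /point_divisor eqxx natz.
  by move=> Q hQ /eqP/negPf n'; have := h Q hQ; rewrite /point_divisor n' mul0rn oppr0.
rewrite /point_divisor; case: eqP => [->|n']; first by rewrite natz.
by rewrite mul0rn oppr0; apply: h2.
Qed.

Lemma pole_section P n : place iota P -> (2 <= n)%N ->
  exists2 f, H0 (fun Q => point_divisor P Q *+ n) f & f != 0 /\ ord P f = - n%:Z.
Proof.
move=> hP n2; have [|f hf [f0 e]] := section_exact (divisor_mulpt n hP) hP.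
  by rewrite degree_mulpt.
by exists f => //; split=> //; rewrite e /point_divisor eqxx natz.
Qed.

Lemma other_place P : place iota P -> exists2 Q, place iota Q & Q <> P.
Proof.
move=> hP; have [f hf [f0 e]] := pole_section hP (leqnn 2).
have nf : ~ range iota f^-1.
  move=> [a _ ea]; have : a != 0 by rewrite -(fmorph_eq0 iota) ea invr_eq0.
  by move/(ord_const hF hP); rewrite ea (ordV hF hP) // e.
have [Q hQ nQ] := pole_ex nf; exists Q => // eQ; apply: nQ; rewrite eQ; apply/(place_ord hF hP); right.
by rewrite (ordV hF hP) // e.
Qed.

End Elliptic.

Lemma mulrn_int (x : int) n : x *+ n = x * n%:Z.
Proof. by rewrite -mulr_natr natz. Qed.

(** * Frobenius on the function field *)

Section Frobenius.
Variables (L : fieldType) (q : nat) (hq : [pchar L].-nat q).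

(** The proof about q is an argument so that the ring morphism structure, which depends on it, can
    be attached to this function. *)
Definition frob (_ : [pchar L].-nat q) (x : L) : L := x ^+ q.

Let frobB : zmod_morphism (frob hq).
Proof.
move=> x y; rewrite /frob.
have e : (x - y) ^+ q + y ^+ q = x ^+ q by rewrite -exprDn_pchar // subrK.
by rewrite -e addrK.
Qed.

Let frobM : monoid_morphism (frob hq).
Proof. by split; [rewrite /frob expr1n|move=> x y; rewrite /frob exprMn]. Qed.

HB.instance Definition _ := GRing.isZmodMorphism.Build L L (frob hq) frobB.
HB.instance Definition _ := GRing.isMonoidMorphism.Build L L (frob hq) frobM.

Lemma frobE (x : L) : frob hq x = x ^+ q. Proof. by []. Qed.

End Frobenius.

Section FrobeniusCurve.
Variables (k : closedFieldType) (F : fieldType) (iota : {rmorphism k -> F}).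
Hypothesis hE : elliptic_curve iota.
Implicit Types (P Q : set F) (C E : set F -> int).
Local Notation H0 := (global_sections iota).
Local Notation h0 := (h0 iota).
Let hF : function_field_1 iota := proj1 hE.

Lemma vge_sum_distinct P n m (w : 'I_m -> F) : place iota P ->
  (forall i j, i != j -> w i != 0 -> w j != 0 -> ord P (w i) != ord P (w j)) ->
  vge P n (\sum_i w i) -> forall i, vge P n (w i).
Proof.
move=> hP hw hs i; apply: contrapT => ni.
have wi0 : w i != 0 by apply/eqP => e; apply: ni; left.
case: (Order.TotalTheory.arg_minP (P := fun i => w i != 0) (fun i => ord P (w i)) wi0).
move=> l wl minl; have le : ord P (w l) + 1 <= n.
  have : ~~ (n <= ord P (w i)) by apply/negP => h; apply: ni; right.
  have := minl i wi0; lia.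
have : vge P (ord P (w l) + 1) (w l); last by rewrite vge_neq0 // lezD1 ltxx.
have e : w l = \sum_i w i - \sum_(i | i != l) w i by rewrite (bigD1 l) //= addrK.
rewrite [X in vge _ _ X]e.
apply: (vgeB hF hP); first exact: (vge_le le hs).
apply: (vge_sum hF hP) => j jl; case: (eqVneq (w j) 0) => [->|wj]; [by left|right].
by have := minl j wj; have := hw j l jl wj wl; lia.
Qed.

Section Free.
Variables (q : nat) (hq : [pchar F].-nat q).
Let q0 : (0 < q)%N. Proof. by have /andP[] := hq. Qed.

Definition distinct_mod P m (v : 'I_m -> F) : Prop :=
  (forall i, v i != 0) /\
  forall i j (a : int), i != j -> ord P (v i) - ord P (v j) != a *+ q.

(** The order of c^q is a multiple of q, so the terms have pairwise distinct orders and cannot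
    cancel. *)
Lemma frob_vge P n m (v c : 'I_m -> F) : place iota P -> distinct_mod P v ->
  vge P n (\sum_i c i ^+ q * v i) -> forall i, vge P n (c i ^+ q * v i).
Proof.
move=> hP [v0 hv]; apply: vge_sum_distinct => // i j ij.
rewrite !mulf_eq0 !negb_or => /andP[ci vi] /andP[cj vj]; apply/negP => /eqP e.
have ci0 : c i != 0 by move: ci; rewrite expf_eq0 q0.
have cj0 : c j != 0 by move: cj; rewrite expf_eq0 q0.
have /eqP[] := hv i j (ord P (c j) - ord P (c i)) ij; move: e.
rewrite !(ordM hF hP) // !(ordX hF hP) // mulrnBl => e.
by apply/eqP; rewrite -subr_eq0; apply/eqP; move: e => /eqP; rewrite -subr_eq0 => /eqP <-; ring.
Qed.

Lemma frob_free P m (v : 'I_m -> F) : place iota P -> distinct_mod P v -> kfree (frob hq) v.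
Proof.
move=> hP dv c hc i; apply/eqP/negPn/negP => ci0.
have [v0 _] := dv.
have h := @frob_vge P (ord P (c i ^+ q * v i) + 1) _ _ c hP dv.
have h' := h (or_introl hc) i; move: h'.
by rewrite vge_neq0 ?mulf_neq0 ?expf_neq0 // lezD1 ltxx.
Qed.

Lemma kroot (a : k) : exists b, b ^+ q = a.
Proof.
have [|b /rootP] := @closed_rootP _ ('X^q - a%:P) _.
  by rewrite size_XnsubC //; case: (q) q0.
by rewrite hornerD hornerN hornerXn hornerC => /eqP; rewrite subr_eq0 => /eqP; exists b.
Qed.

(** The field F has degree at most q over F^q, by Riemann-Roch. If b is a basis of H^0(n P) and C
    bounds the poles of all z_i, the products b_l^q z_i would be (q + 1) n independent elements of
    H^0(C + q n P), whose dimension is deg C + q n; n is taken larger than deg C. Independence over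
    k uses q-th roots in k. *)
Lemma frob_dep (z : 'I_q.+1 -> F) : ~ kfree (frob hq) z.
Proof.
move=> fz.
have z0 i : z i != 0.
  apply/eqP => e; have := fz (fun j => (j == i)%:R); rewrite comb_delta e.
  by move=> /(_ erefl i)/eqP; rewrite eqxx oner_eq0.
pose C P : int := \sum_i `|ord P (z i)|.
have hC : divisor iota C.
  rewrite /C; elim: (index_enum _) => [|i r IH].
    have -> : (fun P => \sum_(i <- [::]) `|ord P (z i)|) = fun=> 0 by apply/funext => P; rewrite big_nil.
    exact: divisor0.
  have -> : (fun P => \sum_(i <- i :: r) `|ord P (z i)|) =
     fun P => `|ord P (z i)| + \sum_(i <- r) `|ord P (z i)|.
    by apply/funext => P; rewrite big_cons.
  apply: divisorD => //; have /divisorP[s [us sp s0]] := divisor_ord hF (z0 i).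
  by apply/divisorP; exists s; split=> // P hP n; rewrite s0 ?normr0.
have [P hP] := place_ex hE.
pose n := (`|degree iota C|.+1)%N.
have C0 Q : place iota Q -> 0 <= C Q by move=> _; apply: sumr_ge0.
have dC := degree_ge0 hC C0.
pose nP m : set F -> int := fun Q => point_divisor P Q *+ m.
have hn m : divisor iota (nP m) by apply: divisor_mulpt.
have hW := divisorD hC (hn (q * n)%N).
have dW := degreeD hC (hn (q * n)%N); rewrite degree_mulpt // in dW.
have rW := riemann_roch hE hW; rewrite dW in rW.
have [v [_ _ sv]] := h0_spec hF hW.
have nn : h0 (nP n) = n.
  by have := riemann_roch hE (hn n); rewrite degree_mulpt //; lia.
have hb := h0_spec hF (hn n); rewrite nn in hb; have [b [Hb fb _]] := hb.
have := @free_le_fin _ _ iota ('I_q.+1 * 'I_n)%type _ (fun il => b il.2 ^+ q * z il.1) v.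
rewrite card_prod !card_ord => le.
have : (q.+1 * n <= h0 (fun Q => C Q + nP (q * n)%N Q)%R)%N.
  apply: le => [c hc [i l]|[i l] /=]; last first.
    apply: sv; apply/(H0P hF) => Q hQ; rewrite opprD addrC; apply: (vgeM hF hQ).
      rewrite /nP mulnC mulrnA -mulNrn; apply: (vgeX hF hQ).
      by have /(H0P hF) := Hb l; apply.
    right; rewrite lerNl; apply: le_trans (_ : `|ord Q (z i)| <= _); first lia.
    by rewrite /C (bigD1 i) //= lerDl; apply: sumr_ge0.
  have /choice[r hr] := kroot.
  have /fz/(_ i) : comb (frob hq) (fun i => comb iota (fun l => r (c (i, l))) b) z = 0.
    rewrite -[RHS]hc; transitivity (\sum_i \sum_l iota (c (i, l)) * (b l ^+ q * z i)).
      apply: eq_bigr => j _; rewrite [in LHS]/comb (rmorph_sum (frob hq)) mulr_suml.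
      by apply: eq_bigr => m _; rewrite /= frobE exprMn -rmorphXn hr mulrA.
    by rewrite pair_bigA; apply: eq_bigr => -[].
  by move/fb/(_ l) => e; rewrite -(hr (c (i, l))) e expr0n gtn_eqF.
rewrite -lez_nat rW PoszM; lia.
Qed.

Lemma frob_span (v : 'I_q -> F) : kfree (frob hq) v -> forall f, kspan (frob hq) v f.
Proof. by move=> fv f; apply: contrapT => nf; apply: (@frob_dep (ext f v)); apply: free_ext. Qed.

End Free.

(** * From a divisor divisible by p to a splitting of Frobenius *)

Section Purity.
Variables (p : nat) (char_k : p \in [pchar k]).
Let char_F : p \in [pchar F] := rmorph_pchar iota char_k.
Let p_prime : prime p := pcharf_prime char_F.
Variable hp : [pchar F].-nat p.
Let p0 : (0 < p)%N := prime_gt0 p_prime.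

(* X^p - h^p = (X - h)^p has no factor over F^p, as its subleading coefficient would be -j h. *)
Lemma frob_powers_free h : ~ (exists g, g ^+ p = h) ->
  kfree (frob hp) (fun i : 'I_p => h ^+ i).
Proof.
move=> nh c hc.
pose g := \poly_(i < p) oapp c 0 (insub i) : {poly F}.
have cE (i : 'I_p) : g`_i = c i by rewrite coef_poly ltn_ord valK.
suff g0 : g = 0 by move=> i; rewrite -cE g0 coef0.
apply: contrapT => /eqP g0.
pose fp := frob hp.
have gh : root (map_poly fp g) h.
  apply/rootP; rewrite -[RHS]hc (horner_coef_wide (n := p)); last by rewrite size_map_poly; apply: size_poly.
  by apply: eq_bigr => i _; rewrite coef_map cE.
pose w : {poly F} := 'X^p - h%:P.
have ew : map_poly fp w = ('X - h%:P) ^+ p.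
  have hp' : [pchar {poly F}].-nat p by rewrite pnatE // pchar_poly.
  rewrite rmorphB /= map_polyXn map_polyC /= /fp frobE.
  have : ('X - h%:P) ^+ p + h%:P ^+ p = 'X^p by rewrite -exprDn_pchar // subrK.
  by move=> <-; rewrite -polyC_exp addrK.
pose d := gcdp g w.
have dw : map_poly fp d %| ('X - h%:P) ^+ p by rewrite -ew dvdp_map dvdp_gcdr.
have dh : root (map_poly fp d) h.
  by rewrite /d gcdp_map root_gcd gh ew rootE horner_exp hornerXsubC subrr expf_eq0 p0 eqxx.
have d0 : d != 0 by rewrite gcdp_eq0 negb_and g0.
have sd : (size d <= p)%N.
  apply: leq_trans (dvdp_leq g0 (dvdp_gcdl _ _)) _; exact: size_poly.
have [j le /eqpP[[a b] /= /andP[a0 b0] e]] := dvdp_exp_XsubCP dw.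
have sj : size d = j.+1.
  have := congr1 (fun r : {poly F} => size r) e.
  by rewrite !size_scale // size_map_poly size_exp_XsubC.
have j0 : (0 < j)%N.
  rewrite lt0n; apply/eqP => j0; move: dh; rewrite j0 expr0 in e.
  have := congr1 (fun r : {poly F} => r.[h]) e; rewrite !hornerZ hornerC mulr1.
  by move=> e1 /rootP e2; move: e1; rewrite e2 mulr0 => /esym/eqP; rewrite (negPf b0).
have lead : a * (d`_j) ^+ p = b.
  have := congr1 (fun r : {poly F} => r`_j) e; rewrite !coefZ coef_map /= => ->.
  have := monicP (monic_exp j (monicXsubC h)); rewrite /lead_coef size_exp_XsubC /= => ->.
  by rewrite mulr1.
have sub : a * (d`_j.-1) ^+ p = b * (- (j%:R * h)).
  have := congr1 (fun r : {poly F} => r`_j.-1) e; rewrite !coefZ coef_map /= => ->.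
  congr (_ * _); rewrite -[j](prednK j0) /=.
  elim: (j.-1) => [|m IH]; first by rewrite expr1 coefB coefX coefC /= sub0r mul1r.
  rewrite exprS mulrBl coefB coefXM /= coefCM IH.
  have := monicP (monic_exp m.+1 (monicXsubC h)); rewrite /lead_coef size_exp_XsubC /= => ->.
  by rewrite -[m.+2]addn1 natrD; ring.
have jn0 : (j%:R : F) != 0.
  rewrite -(dvdn_pcharf char_F) gtnNdvd //.
  by rewrite -sj.
have dj0 : d`_j != 0 by have := d0; rewrite -lead_coef_eq0 /lead_coef sj.
apply: nh; exists (- (d`_j.-1 / (d`_j * j%:R))).
rewrite -[LHS]/(frob hp _) rmorphN fmorph_div rmorphM rmorph_nat /= /frob.
have djp : d`_j ^+ p != 0 by rewrite expf_neq0.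
apply: (mulfI a0); apply: (mulIf jn0); apply: (mulIf djp).
transitivity (- (a * d`_j.-1 ^+ p)); first by field; rewrite jn0 djp.
by rewrite sub -lead; ring.
Qed.

End Purity.
End FrobeniusCurve.

Section Splitting.
Variables (k : closedFieldType) (F : fieldType) (iota : {rmorphism k -> F}).
Hypothesis hE : elliptic_curve iota.
Implicit Types (P Q : set F) (C E : set F -> int).
Local Notation H0 := (global_sections iota).
Let hF : function_field_1 iota := proj1 hE.
Variables (p : nat) (char_k : p \in [pchar k]).
Let char_F : p \in [pchar F] := rmorph_pchar iota char_k.
Let p_prime : prime p := pcharf_prime char_F.
Let hp : [pchar F].-nat p. Proof. by rewrite pnatE. Qed.
Let p0 : (0 < p)%N := prime_gt0 p_prime.

Lemma kfree_uniq (k' L : fieldType) (mu : {rmorphism k' -> L}) n (v : 'I_n -> L) c d :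
  kfree mu v -> comb mu c v = comb mu d v -> forall i, c i = d i.
Proof.
move=> fv e i; apply/eqP; rewrite -subr_eq0; apply/eqP.
by apply: (fv (fun i => c i - d i)); rewrite combB e subrr.
Qed.

(* The p-linear map sending sum_i c_i^p h^i to c_0 splits Frobenius; it preserves sections, since
   H^0(np D) is the sum of the H^0(n D + i D')^p h^i by a count of dimensions. *)
Lemma F_pure_of_torsion (D D' : set F -> int) (h : F) (R : comNzRingType)
    (j : {rmorphism R -> {poly F}}) :
  divisor iota D -> degree iota D = 1 -> h != 0 -> ~ (exists g, g ^+ p = h) ->
  (forall Q, place iota Q -> ord Q h = D' Q *+ p) ->
  injective j -> range j = section_ring iota D -> F_pure p R.
Proof.
move=> hD dD hn0 nh hD' j_inj j_range.
pose v (i : 'I_p) := h ^+ i; have fv : kfree (frob hp) v by apply: (frob_powers_free iota char_k).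
pose i0 : 'I_p := Ordinal p0.
have /choice[cc ccE] : forall f, exists c, f = comb (frob hp) c v.
  by move=> f; apply: (frob_span hE fv).
pose phi f := cc f i0.
have phiE f c : f = comb (frob hp) c v -> phi f = c i0.
  move=> e; exact: (kfree_uniq fv (etrans (esym (ccE f)) e)).
have phiD f g : phi (f + g) = phi f + phi g.
  by rewrite (@phiE _ (fun i => cc f i + cc g i)) // combD -!ccE.
have phiM a f : phi (a ^+ p * f) = a * phi f.
  by rewrite (@phiE _ (fun i => a * cc f i)) // combZ -ccE.
have phiC a : phi (a ^+ p) = a.
  rewrite (@phiE _ (fun i => a * (i == i0)%:R)) ?eqxx ?mulr1 //.
  by rewrite combZ comb_delta /v expr0 mulr1.
have e0 : (0 : F) ^+ p = 0 by rewrite expr0n gtn_eqF.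
have phi0 : phi 0 = 0 by rewrite -{1}e0 phiC.
have pn0 : (p%:Z != 0) by lia.
have hdD' : divisor iota D'.
  apply: (sub_finite_set _ (divisor_ord hF hn0)) => Q [hQ n0] /=; split=> //.
  by rewrite hD' // mulrn_eq0 negb_or -lt0n p0.
have dD' : degree iota D' = 0.
  have := deg_ord hE hn0; rewrite (degree_ext (C' := fun Q => D' Q *+ p)) // degreeMn //.
  by move=> /eqP; rewrite mulrn_eq0 gtn_eqF //= => /eqP.
(* For n > 0, each of the p divisors [W i] has degree n, so the products b^p h^i with b in a basis
   of H^0(W i) number p n, the dimension of H^0(p n D). Degree 0 is outside Riemann-Roch, and there
   f is a constant. *)
have phiH n f : H0 (fun P => D P *+ (p * n)) f -> H0 (fun P => D P *+ n) (phi f).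
  case: n => [|n] hf.
    have : H0 (fun=> 0) f by rewrite muln0 in hf.
    move/(const_H0 hF) => [a _ <-]; have [b <-] := kroot hp a.
    rewrite rmorphXn phiC; apply: (H0_mono hF (C := fun=> 0)) => //.
    by apply/(const_H0 hF); exists b.
  pose W (i : 'I_p) Q := D Q *+ n.+1 + D' Q *+ i.
  have hW i : divisor iota (W i) by apply: divisorD; apply: divisorMn.
  have dW i : degree iota (W i) = n.+1%:Z.
    rewrite degreeD; try exact: divisorMn.
    by rewrite !degreeMn // dD dD' mul0rn addr0 natz.
  have rr i : h0 iota (W i) = n.+1.
    by have := riemann_roch hE (hW i); rewrite dW; lia.
  have /choice[b hb] : forall i, exists b : 'I_n.+1 -> F,
      [/\ forall l, H0 (W i) (b l), kfree iota b & H0 (W i) `<=` kspan iota b].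
    by move=> i; have := h0_spec hF (hW i); rewrite rr.
  pose w (il : 'I_p * 'I_n.+1) := b il.1 il.2 ^+ p * h ^+ il.1.
  have hS : divisor iota (fun P => D P *+ (p * n.+1)) by apply: divisorMn.
  have dS : kdim iota (H0 (fun P => D P *+ (p * n.+1))) #|{: 'I_p * 'I_n.+1}|.
    have := h0_spec hF hS; have := riemann_roch hE hS; rewrite degreeMn // dD card_prod !card_ord.
    rewrite natz lez_nat muln_gt0 p0 => /(_ isT) e; have -> : h0 iota (fun P => D P *+ (p * n.+1)) = (p * n.+1)%N by lia.
    by [].
  have Sw i : H0 (fun P => D P *+ (p * n.+1)) (w i).
    apply/(H0P hF) => Q hQ; have [hbi _ _] := hb i.1.
    have h1 : vge Q (- W i.1 Q *+ p) (b i.1 i.2 ^+ p).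
      by apply: (vgeX hF hQ); move/(H0P hF): (hbi i.2); apply.
    have h2 : vge Q (D' Q *+ p *+ i.1) (h ^+ i.1) by apply: (vgeX hF hQ); right; rewrite hD'.
    apply: vge_le (vgeM hF hQ h1 h2); rewrite le_eqVlt; apply/orP; left; apply/eqP.
    by rewrite /W !mulrn_int PoszM; ring.
  have comp (c : 'I_p * 'I_n.+1 -> k) : exists2 d : 'I_p -> 'I_n.+1 -> k, (forall i l, d i l ^+ p = c (i, l)) &
      \sum_i iota (c i) * w i = comb (frob hp) (fun i => comb iota (d i) (b i)) v.
    have /choice[r hr] := @kroot k _ _ hp; exists (fun i l => r (c (i, l))) => //.
    transitivity (\sum_i \sum_l iota (c (i, l)) * w (i, l)).
      by rewrite pair_bigA; apply: eq_bigr => -[].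
    apply: eq_bigr => i _; rewrite [in RHS]/comb (rmorph_sum (frob hp)) mulr_suml.
    by apply: eq_bigr => m _; rewrite /= frobE exprMn -rmorphXn hr mulrA.
  have fw : kfree_fin iota w.
    move=> c; have [d ed ->] := comp c; move/fv => e [i l].
    have [_ fb _] := hb i; have := fb _ (e i) l => dl.
    by rewrite -ed dl expr0n gtn_eqF.
  have [c ef] := free_spans_fin dS Sw fw hf.
  have [d ed e] := comp c; rewrite e in ef.
  rewrite (phiE _ _ ef); have [hbi _ _] := hb i0.
  apply: subspace_comb; first exact: H0_subspace.
  by move=> l; have := hbi l; congr (H0 _ _); apply/funext => Q; rewrite /W mulr0n addr0.
(* The splitting on the graded ring: degrees not divisible by p are sent to 0, and degree p n to
   degree n. *)
pose psi (s : {poly F}) := \poly_(n < size s) phi s`_(p * n).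
have psiE s n : (psi s)`_n = phi s`_(p * n).
  rewrite coef_poly; case: ltnP => // le; rewrite nth_default ?phi0 //.
  by apply: leq_trans le _; rewrite leq_pmull.
have psiD s t : psi (s + t) = psi s + psi t.
  by apply/polyP => n; rewrite coefD !psiE coefD phiD.
have hp' : [pchar {poly F}].-nat p by rewrite pnatE // pchar_poly.
have psiM a : forall s, psi (a ^+ p * s) = a * psi s.
  rewrite -[a]coefK poly_def.
  apply: (big_ind (fun a => forall s, psi (a ^+ p * s) = a * psi s)) => [s|x y hx hy s|i _ s].
  - by rewrite expr0n gtn_eqF // !mul0r; apply/polyP => n; rewrite psiE !coef0 phi0.
  - by rewrite exprDn_pchar // !mulrDl psiD hx hy.
  - apply/polyP => n; rewrite psiE exprZn -exprM -!scalerAl !coefZ !coefXnM.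
    rewrite [(i * p)%N]mulnC ltn_pmul2l //; case: ltnP => _.
      by rewrite !mulr0.
    by rewrite psiE phiM mulnBr.
have psi1 : psi 1 = 1.
  apply/polyP => n; rewrite psiE !coef1 muln_eq0 gtn_eqF //=.
  by case: (n == 0)%N => //=; rewrite -[in LHS](expr1n F p) phiC.
have /choice[Phi PhiE] : forall r, exists r', j r' = psi (j r).
  move=> r; have hs : section_ring iota D (psi (j r)).
    move=> n; rewrite psiE; apply: phiH.
    by have : section_ring iota D (j r); [rewrite -j_range; exists r|apply].
  by rewrite -j_range in hs; case: hs => r' _ e; exists r'.
move=> N x hx; have := hx N (fun x s => Phi s *: x).
have -> : Phi 1 = 1 by apply: j_inj; rewrite PhiE rmorph1 psi1.
rewrite scale1r; apply; split.
- by move=> y z s; rewrite scalerDr.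
- move=> y s t; rewrite -scalerDl; congr (_ *: _); apply: j_inj.
  by rewrite rmorphD !PhiE rmorphD psiD.
- move=> a y s; rewrite scalerA mulrC; congr (_ *: _); apply: j_inj.
  by rewrite rmorphM !PhiE rmorphM rmorphXn psiM.
Qed.

(** By induction on e: if f is a p-th power, its root has divisor p^(e-1) (P - P0); otherwise f
    produces a splitting of Frobenius. For e = 0, both 1 and 1/f lie in H^0(P), which is
    one-dimensional, so f would be constant. *)
Lemma no_torsion (D : set F -> int) (R : comNzRingType) (j : {rmorphism R -> {poly F}}) :
  divisor iota D -> degree iota D = 1 -> injective j -> range j = section_ring iota D ->
  ~ F_pure p R ->
  forall e P P0 f, place iota P -> place iota P0 -> P <> P0 -> f != 0 ->
    ~ (forall Q, place iota Q -> ord Q f = (point_divisor P Q - point_divisor P0 Q) *+ p ^ e).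
Proof.
move=> hD dD j_inj j_range nF e P P0 f hP hP0 nPP; elim: e f => [|e IH] f f0 hf.
  have := h0_point hE hP; have hd := divisor_point hP0.
  rewrite -(h0_ext hF (C := fun Q => point_divisor P0 Q + ord Q f)) => [|Q hQ]; last first.
    by rewrite hf // mulr1n addrCA subrr addr0.
  have H1 : H0 (point_divisor P) 1.
    apply/(H0P hF) => Q hQ; right; rewrite (ord_one hF hQ) /point_divisor; case: (Q == P) => //=.
  have Hf : H0 (point_divisor P) f^-1.
    apply/(H0P hF) => Q hQ; right; rewrite (ordV hF hQ) // hf // mulr1n /point_divisor.
    by case: (Q == P); case: (Q == P0) => //=; lia.
  have hS := h0_spec hF (divisor_point hP); rewrite (h0_point hE hP) in hS.
  move=> _; have [b [_ fb sb]] := hS.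
  have [c1 e1] := sb _ H1; have [c2 e2] := sb _ Hf.
  rewrite /comb big_ord1 in e1; rewrite /comb big_ord1 in e2.
  have c10 : c1 ord0 != 0.
    by apply/eqP => z; move: e1; rewrite z rmorph0 mul0r => /eqP; rewrite oner_eq0.
  have ef : f^-1 = iota (c2 ord0 / c1 ord0).
    have i1 : iota (c1 ord0) != 0 by rewrite fmorph_eq0.
    have eb : b ord0 = (iota (c1 ord0))^-1 by apply: (mulfI i1); rewrite -e1 mulfV.
    by rewrite fmorph_div e2 eb.
  have c0 : c2 ord0 / c1 ord0 != 0 by rewrite -(fmorph_eq0 iota) -ef invr_eq0.
  have := ordV hF hP f0; rewrite ef (ord_const hF hP c0) hf // mulr1n /point_divisor eqxx.
  by case: eqP => //=.
have pn0 : (p%:Z != 0) by lia.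
have [[g eg]|ng] := pselect (exists g, g ^+ p = f).
  have g0 : g != 0 by apply: contra_neq f0 => g0; rewrite -eg g0 expr0n gtn_eqF.
  apply: (IH g) => // Q hQ; have := hf Q hQ; rewrite -eg (ordX hF hQ) // expnS mulnC mulrnA.
  by rewrite !(mulrn_int _ p) => /(mulIf pn0).
apply: nF; refine (F_pure_of_torsion (D' := fun Q => (point_divisor P Q - point_divisor P0 Q) *+ p ^ e)
  hD dD f0 ng _ j_inj j_range).
by move=> Q hQ; rewrite hf // expnSr mulrnA.
Qed.

End Splitting.

(** * Local bases of sections *)

Section LocalBases.
Variables (k : closedFieldType) (F : fieldType) (iota : {rmorphism k -> F}).
Hypothesis hE : elliptic_curve iota.
Implicit Types (P Q : set F) (C E : set F -> int).
Local Notation H0 := (global_sections iota).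
Let hF : function_field_1 iota := proj1 hE.

Definition Hn P0 n : set F := H0 (fun Q => point_divisor P0 Q *+ n).

Variables (P0 : set F) (hP0 : place iota P0).

Lemma HnP n f : Hn P0 n f <-> vge P0 (- n%:Z) f /\ forall Q, place iota Q -> Q <> P0 -> vge Q 0 f.
Proof. exact: mulpt_sections. Qed.

Lemma HnE n f : Hn P0 n f <-> forall Q, place iota Q -> vge Q (- (point_divisor P0 Q *+ n)) f.
Proof. exact: (H0P hF). Qed.

Lemma Hn_mono n m : (n <= m)%N -> Hn P0 n `<=` Hn P0 m.
Proof.
move=> le; apply: (H0_mono hF) => Q hQ; rewrite !mulrn_int /point_divisor.
by case: (Q == P0) => /=; lia.
Qed.

Lemma Hn_dim n : (0 < n)%N -> kdim iota (Hn P0 n) n.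
Proof.
move=> n0; have hd := divisor_mulpt n hP0.
have := riemann_roch hE hd; rewrite degree_mulpt // => /(_ ltac:(lia)) e.
by have := h0_spec hF hd; have -> : h0 iota (fun Q => point_divisor P0 Q *+ n) = n by lia.
Qed.

Lemma Hn0 f : Hn P0 0 f <-> range iota f.
Proof.
rewrite -(const_H0 hF) /Hn.
by have -> : (fun Q => point_divisor P0 Q *+ 0) = (fun=> 0) by apply/funext.
Qed.

Lemma Hn_sub n : subspace iota (Hn P0 n). Proof. exact: (H0_subspace hF). Qed.

Lemma kfree_distinct P m (w : 'I_m -> F) : place iota P -> (forall i, w i != 0) ->
  (forall i j, i != j -> ord P (w i) != ord P (w j)) -> kfree iota w.
Proof.
move=> hP w0 hw c hc i; apply/eqP/negPn/negP => ci.
have : vge P (ord P (w i) + 1) (iota (c i) * w i).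
  apply: (vge_sum_distinct hE (w := fun i => iota (c i) * w i) hP); last by left.
  move=> l l' ll; rewrite !mulf_eq0 !negb_or !fmorph_eq0 => /andP[cl _] /andP[cl' _].
  by rewrite !(ordM hF hP) ?fmorph_eq0 // !(ord_const hF hP) // !add0r; apply: hw.
rewrite vge_neq0 ?mulf_neq0 ?fmorph_eq0 // (ordM hF hP) ?fmorph_eq0 // (ord_const hF hP) // add0r.
by rewrite lezD1 ltxx.
Qed.

Variables (q : nat) (hq : [pchar F].-nat q).
Hypothesis no_tors : forall P f, place iota P -> P <> P0 -> f != 0 ->
  ~ (forall Q, place iota Q -> ord Q f = (point_divisor P Q - point_divisor P0 Q) *+ q).
Let q0 : (0 < q)%N. Proof. by have /andP[] := hq. Qed.

Let dlt P : int := point_divisor P0 P.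

(** Sections of n P0 - r P have exact order at P as soon as n - r >= 2. In degree 1 the single zero
    of the section may be P itself, and then its divisor is n (P - P0). *)
Lemma section_near P n r : place iota P -> (r < n)%N ->
  exists f, [/\ f != 0, Hn P0 n f &
    ord P f = r%:Z - dlt P *+ n \/
    n = r.+1 /\ forall Q, place iota Q -> ord Q f = (point_divisor P Q - point_divisor P0 Q) *+ n].
Proof.
move=> hP lt.
pose C r Q : int := point_divisor P0 Q *+ n + - (point_divisor P Q *+ r).
have hn := divisor_mulpt n hP0; have hr r := divisor_mulpt r hP.
have hC r' : divisor iota (C r') by apply: divisorD => //; apply/divisorN.
have dC r' : degree iota (C r') = n%:Z - r'%:Z.
  by rewrite degreeD ?degreeN ?degree_mulpt //; apply: divisorN.
have CP r' : - C r' P = r'%:Z - dlt P *+ n.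
  by rewrite /C /dlt [point_divisor P P]/point_divisor eqxx natz; ring.
have sub r' f : H0 (C r') f -> Hn P0 n f.
  apply: (H0_mono hF) => Q hQ; rewrite /C /point_divisor !mulrn_int.
  by case: (Q == P) => /=; lia.
have [n2|n1] : (r.+2 <= n)%N \/ n = r.+1 by lia.
  have [|f hf [f0 e]] := section_exact hE (hC r) hP; first by rewrite dC; lia.
  by exists f; split=> //; [apply: sub hf|left; rewrite e CP].
have [|f f0 hf] := h0_pos hF (hC r).
  by have := riemann_roch hE (hC r); rewrite dC => /(_ ltac:(lia)); lia.
exists f; split=> //; first exact: sub hf.
have /(H0P hF)/(_ P hP) := hf; rewrite CP vge_neq0 // => ge.
have [e|n1'] := eqVneq (ord P f) (r%:Z - dlt P *+ n); first by left.
right; split=> // Q hQ.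
have hf' : H0 (C r.+1) f.
  apply/(H0P hF) => R hR; have [->|nR] := pselect (R = P).
    by rewrite CP; right; rewrite -[r.+1]addn1 PoszD; lia.
  by have /(H0P hF)/(_ R hR) := hf; rewrite /C /point_divisor; move/eqP/negPf: nR => -> /=; rewrite !mul0rn.
have -> := section_deg0 hE (hC r.+1) _ f0 hf' hQ; last by rewrite dC; lia.
by rewrite /C n1 mulrnBl; ring.
Qed.

(** Up to the twist at P0, the a_m have the orders 0, ..., q - 1 at P. The predicate M marks those
    already available in H^0(i P0), where they form a k-basis; the others come from H^0((i + q)
    P0). *)
Lemma local_basis P i : place iota P -> (i < q)%N -> ~ (P = P0 /\ i = 0%N) ->
  exists (M : 'I_q -> bool) (a : 'I_q -> F),
  [/\ forall m, a m != 0 /\ ord P (a m) = m%:Z - dlt P *+ (if M m then i else i + q),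
      forall m, Hn P0 (if M m then i else i + q) (a m)
    & forall f, Hn P0 i f -> exists2 c, (forall m, ~~ M m -> c m = 0) & f = comb iota c a].
Proof.
move=> hP iq nP0.
(* The orders at P of H^0(i P0), shifted to start at 0, are 0, ..., i - 2 and one more, t. It is i -
   1 unless i P and i P0 are equivalent (as for P = P0), when it is i. *)
have [t [f0 [[tq ti] f00 f0H f0P]]] : exists t f, [/\ (t < q)%N /\ (i.-1 <= t)%N, f != 0, Hn P0 i f
     & ord P f = t%:Z - dlt P *+ i].
  case: i iq nP0 => [|i] iq nP0.
    exists 0%N, 1; split=> //; first exact: oner_neq0.
      by apply/Hn0; exists 1; rewrite ?rmorph1.
    by rewrite (ord_one hF hP) mulr0n subr0.
  have [f [f0 fH [e|[_ e]]]] := section_near hP (ltnSn i).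
    by exists i, f; split=> //; split=> //; apply: ltnW.
  exists i.+1, f; split=> //; rewrite e // /dlt [point_divisor P P]/point_divisor eqxx mulrnBl natz.
  by [].
pose d := (maxn i 1)%N.
have slt (l : 'I_d) : ((if (l < i.-1)%N then l : nat else t) < q)%N.
  by case: ifP => // _; have := ltn_ord l; rewrite /d; lia.
pose sg (l : 'I_d) : 'I_q := Ordinal (slt l).
pose M m := [exists l, sg l == m].
have sg_inj : injective sg.
  move=> l l' /(congr1 val) /= e; apply: val_inj => /=; move: e (ltn_ord l) (ltn_ord l').
  rewrite /d; move: (nat_of_ord l) (nat_of_ord l') => x y.
  by case: ltnP => h1; case: ltnP => h2 h3 h4 h5; lia.
have dimM : kdim iota (Hn P0 i) d.
  rewrite /d; case: (posnP i) => [->|i0]; last by rewrite (maxn_idPl i0); apply: Hn_dim.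
  have -> : Hn P0 0 = range iota by apply/funext => f; apply/propext; apply: Hn0.
  exact: kdim_const.
have /choice[a ha] : forall m : 'I_q, exists a, [/\ a != 0, Hn P0 (if M m then i else i + q)%N a
    & ord P a = m%:Z - dlt P *+ (if M m then i else i + q)].
  move=> m; case: ifP => [/existsP[l /eqP <-]|nM] /=.
    case: ltnP => [lt|le]; last by exists f0.
    have [|f [f1 fH [e|[e _]]]] := @section_near P i l hP; first by lia.
      by exists f; split.
    by exfalso; move: lt e; lia.
  have lt : (m < i + q)%N by apply: ltn_addl.
  have [f [f1 fH [e|[e e']]]] := section_near hP lt; first by exists f; split.
  (* The degree-one exception needs m + 1 = i + q, hence i = 0 and m = q - 1; the section would have
     divisor q (P - P0), which is what the torsion hypothesis forbids for P <> P0. *)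
  have i0 : i = 0%N by have := ltn_ord m; lia.
  exfalso; have [eP|neP] := pselect (P = P0); first by apply: nP0.
  by apply: (no_tors hP neP f1) => Q hQ; rewrite e' // i0.
exists M, a; split.
- by move=> m; have [] := ha m.
- by move=> m; have [] := ha m.
move=> f fH.
have Msg l : M (sg l) by apply/existsP; exists l.
have [||c ec] := @free_spans _ _ iota _ _ (fun l => a (sg l)) dimM _ _ f fH.
- by move=> l; have [_ + _] := ha (sg l); rewrite Msg.
- apply: (kfree_distinct hP) => [l|l l' ll]; first by have [] := ha (sg l).
  have [_ _ ->] := ha (sg l); have [_ _ ->] := ha (sg l'); rewrite !Msg.
  apply/negP => /eqP/addIr e; move/negP: ll; apply; apply/eqP/sg_inj/val_inj.
  by move: e => -[].
exists (fun m => \sum_(l | sg l == m) c l).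
  move=> m nM; rewrite big1 // => l /eqP e; move/negP: nM; case; rewrite -e; exact: Msg.
rewrite ec /comb (partition_big sg xpredT) //=; apply: eq_bigr => m _.
rewrite rmorph_sum mulr_suml; apply: eq_bigr => l /eqP <- //.
Qed.

(** The degrees i and i + q agree modulo q, so the order of a_m is m plus a constant modulo q. *)
Lemma local_basis_free P i (M : 'I_q -> bool) (a : 'I_q -> F) : place iota P ->
  (forall m, a m != 0 /\ ord P (a m) = m%:Z - dlt P *+ (if M m then i else i + q)) ->
  distinct_mod q P a.
Proof.
move=> hP ha; split=> [m|l m c lm]; first by have [] := ha m.
have [_ ->] := ha l; have [_ ->] := ha m; apply/negP => /eqP e.
have [d [d' [e1 e2]]] : exists d d' : int, (if M l then i else i + q)%N%:Z = i%:Z + d * q%:Z /\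
    (if M m then i else i + q)%N%:Z = i%:Z + d' * q%:Z.
  exists (~~ M l)%:Z, (~~ M m)%:Z; case: (M l); case: (M m) => /=; lia.
have : l%:Z - m%:Z = (c + dlt P * (d - d')) * q%:Z.
  move: e; rewrite !mulrn_int => e.
  have : l%:Z - m%:Z = c * q%:Z + dlt P * ((if M l then i else i + q)%N%:Z - (if M m then i else i + q)%N%:Z).
    by rewrite -e; ring.
  by rewrite e1 e2 => ->; ring.
have := ltn_ord l; have := ltn_ord m => lm1 lm2 e3.
have lm' : l != m :> nat by apply: contra lm => /eqP/val_inj ->.
have [c0|c0|c0] := ltgtP (c + dlt P * (d - d')) 0; move: e3; nia.
Qed.

End LocalBases.

(** * The relation expressing 1 by functions with poles of orders 2 to q + 1 *)

Section Key.
Variables (k : closedFieldType) (F : fieldType) (iota : {rmorphism k -> F}).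
Hypothesis hE : elliptic_curve iota.
Let hF : function_field_1 iota := proj1 hE.
Variables (q : nat) (hq : [pchar F].-nat q) (q2 : (1 < q)%N).
Variables (P0 : set F) (hP0 : place iota P0).
Hypothesis no_tors : forall P f, place iota P -> P <> P0 -> f != 0 ->
  ~ (forall Q, place iota Q -> ord Q f = (point_divisor P Q - point_divisor P0 Q) *+ q).
Let q0 : (0 < q)%N. Proof. exact: ltnW. Qed.
Local Notation Hn n := (Hn iota P0 n%N).
Local Notation fr := (frob hq).

Lemma approx (f : F) : exists y, (forall Q, place iota Q -> Q <> P0 -> vge Q 0 y) /\
  vge P0 (- 1) (y + f).
Proof.
have [n hn] : exists n : nat, vge P0 (- n%:Z) f.
  by exists `|ord P0 f|%N; right; lia.
elim: n f hn => [|n IH] f hf.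
  exists 0; split=> [Q _ _|]; first by left.
  by rewrite add0r; apply: vge_le hf; lia.
case: n IH hf => [_ hf|n IH hf].
  by exists 0; split=> [Q _ _|]; [left|rewrite add0r].
have [g gH [g0 og]] := pole_section hE hP0 (isT : (2 <= n.+2)%N).
have [a ha] := vge_residue hF hP0 hf g0 og.
have [|y [hy1 hy2]] := IH (f - iota a * g).
  by apply: vge_le ha; lia.
exists (y - iota a * g); split=> [Q hQ nQ|]; last first.
  by move: hy2; congr (vge _ _ _); ring.
apply: (vgeB hF hQ); first exact: hy1.
apply: (vgeZ hF hQ); have /mulpt_sections[//|//|_] := gH; exact.
Qed.

Lemma Hn1_const f : Hn 1 f -> range iota f.
Proof.
have sub : range iota `<=` Hn 1.
  by move=> x hx; apply: (Hn_mono hE (isT : (0 <= 1)%N)); apply/(Hn0 hE P0).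
have sR : subspace iota (range iota).
  have -> : range iota = Hn 0 by apply/funext => t; apply/propext; split=> /(Hn0 hE P0).
  exact: Hn_sub.
exact: (dim_eq (kdim_const iota) (Hn_dim hE hP0 (isT : (0 < 1)%N)) sub sR).
Qed.

(** A change of family with constant coefficients changes the Frobenius coordinates through q-th
    roots of these constants, so it preserves regularity of the coordinates. *)
Lemma comb_change n m (z : 'I_n -> F) (a : 'I_n -> F) (B : 'I_m -> F) :
  (forall l, kspan iota B (a l)) ->
  exists r : 'I_n -> 'I_m -> k,
  comb fr z a = comb fr (fun m => \sum_l z l * iota (r l m)) B.
Proof.
move=> /choice[d hd]; have /choice[r hr] := @kroot k _ _ hq.
exists (fun l m => r (d l m)); rewrite /comb.
under eq_bigr => l _ do rewrite hd /comb mulr_sumr.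
rewrite exchange_big; apply: eq_bigr => i _ /=; rewrite (rmorph_sum fr) mulr_suml.
by apply: eq_bigr => l _; rewrite rmorphM /= !frobE -rmorphXn hr mulrA.
Qed.

Let iq1_lt : (q.-1 < q)%N. Proof. by rewrite prednK. Qed.
Let iq1 : 'I_q := Ordinal iq1_lt.

Section Relation.
Variables (A b : 'I_q -> F).
Hypothesis A0 : forall m, A m != 0.
Hypothesis oA : forall m : 'I_q, ord P0 (A m) = - (m.+2)%:Z.
Hypothesis AH : forall m : 'I_q, Hn m.+2 (A m).
Hypothesis eb : 1 = comb fr b A.

Lemma pole_distinct : distinct_mod q P0 A.
Proof.
split=> // l m c lm; rewrite !oA mulrn_int; apply/negP => /eqP e.
have := ltn_ord l; have := ltn_ord m => h1 h2.
have lm' : l != m :> nat by apply: contra lm => /eqP/val_inj ->.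
by have [c0|c0|c0] := ltgtP c 0; move: e; nia.
Qed.

Let ordA c m : c != 0 -> ord P0 (c ^+ q * A m) = ord P0 c * q%:Z - (m.+2)%:Z.
Proof.
by move=> c0; rewrite (ordM hF hP0) ?expf_neq0 // (ordX hF hP0) // oA mulrn_int.
Qed.

Let vgeA n c m (t : int) : vge P0 n (c ^+ q * A m) -> (t - 1) * q%:Z < n + (m.+2)%:Z -> vge P0 t c.
Proof.
case: (eqVneq c 0) => [->|c0]; first by left.
by rewrite !vge_neq0 ?mulf_neq0 ?expf_neq0 // ordA //; nia.
Qed.

Let Avge n c (m : 'I_q) (t : int) : vge P0 t c -> n <= t * q%:Z - (m.+2)%:Z -> vge P0 n (c ^+ q * A m).
Proof.
case: (eqVneq c 0) => [->|c0]; first by rewrite expr0n gtn_eqF // mul0r; left.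
by rewrite !vge_neq0 ?mulf_neq0 ?expf_neq0 // ordA //; nia.
Qed.

Let comb_vge n c : vge P0 n (comb fr c A) -> forall m, vge P0 n (c m ^+ q * A m).
Proof. exact: (frob_vge hE hq hP0 pole_distinct). Qed.

Let fA : kfree fr A. Proof. exact: (frob_free hE hP0 pole_distinct). Qed.

Let vb m : vge P0 0 (b m ^+ q * A m).
Proof. by apply: comb_vge; rewrite -eb; right; rewrite (ord_one hF hP0). Qed.

(** Each term of the relation is regular at P0, the orders being distinct, so b_m must cancel a pole
    of A_m. *)
Lemma relation_vge1 m : vge P0 1 (b m).
Proof. by apply: vgeA (vb m) _; rewrite subrr mul0r. Qed.

(** Only A_(q-2) has pole order divisible by q. All other terms vanish at P0, so this one must have
    the order 0 of the constant 1. *)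
Lemma relation_ord1 (m : 'I_q) : m = q.-2 :> nat -> b m != 0 /\ ord P0 (b m) = 1.
Proof.
move=> em.
have n2 : ~ vge P0 2 (b m).
  move=> h; have : vge P0 1 (1 : F); last by rewrite vge_neq0 ?oner_neq0 // (ord_one hF hP0).
  rewrite eb; apply: (vge_sum hF hP0) => l _; case: (eqVneq l m) => [->|lm].
    by apply: Avge h _; rewrite em; lia.
  case: (eqVneq (b l) 0) => [->|bl]; first by rewrite /= !frobE expr0n gtn_eqF // mul0r; left.
  have := vb l; rewrite /= frobE !vge_neq0 ?mulf_neq0 ?expf_neq0 // ordA // => h'.
  have lm' : l != m :> nat by apply: contra lm => /eqP/val_inj ->.
  have ll := ltn_ord l; rewrite em in lm'; move: (ord P0 (b l)) h' => o h'.
  by have [c|c|c] := ltgtP o 1; [nia|nia|rewrite c in h' *; lia].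
have b0 : b m != 0 by apply/eqP => e; apply: n2; left.
split=> //; have := relation_vge1 m; rewrite vge_neq0 // => h1.
have : ~~ (2 <= ord P0 (b m)) by apply/negP => h; apply: n2; right.
lia.
Qed.

(** Exchanging A_(q-1), whose pole has order q + 1, for 1 gives a k-basis of H^0(q P0). It will be a
    basis over F^q adapted to all places other than P0, while A is adapted to P0; comparing the two
    determines b_(q-1). *)
Let B m := if m == iq1 then 1 else A m.

Let BH m : Hn q (B m).
Proof.
rewrite /B; case: eqP => [_|/eqP mq].
  by apply: (Hn_mono hE (leq0n q)); apply/(Hn0 hE P0); exists 1; rewrite ?rmorph1.
apply: (Hn_mono hE _ (AH m)); have := ltn_ord m.
have : m != q.-1 :> nat by apply: contra mq => /eqP e; apply/eqP/val_inj.
lia.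
Qed.

Lemma pole_span : Hn q `<=` kspan iota B.
Proof.
apply: (free_spans (Hn_dim hE hP0 q0) BH).
have B0 m : B m != 0 by rewrite /B; case: (eqVneq m iq1) => _; rewrite ?oner_neq0.
have oB1 : ord P0 (B iq1) = 0 by rewrite /B eqxx (ord_one hF hP0).
have oB m : m != iq1 -> ord P0 (B m) = - (m.+2)%:Z by rewrite /B => /negPf ->.
apply: (kfree_distinct hE hP0) => // l m lm.
case: (eqVneq l iq1) lm => [el|l1]; case: (eqVneq m iq1) => [em|m1]; rewrite ?el ?em ?eqxx // => lm.
- by rewrite oB1 oB.
- by rewrite oB1 oB.
- by rewrite !oB //; apply: contra lm => /eqP/oppr_inj[] /val_inj ->.
Qed.

Let basis_at P : place iota P -> P <> P0 -> exists a : 'I_q -> F,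
  [/\ forall l, a l != 0 /\ ord P (a l) = l%:Z, distinct_mod q P a & forall l, kspan iota B (a l)].
Proof.
move=> hP nP; have [|M [a [ha aH _]]] := local_basis hE hP0 hq no_tors hP q0; first by case.
exists a; split.
- move=> l; have [h1 ->] := ha l; split=> //; rewrite /point_divisor.
  by case: eqP => //= _; rewrite mul0rn subr0.
- exact: (local_basis_free hq hP ha).
- by move=> l; apply: pole_span; apply: (Hn_mono hE _ (aH l)); case: ifP.
Qed.

Let fB : kfree fr B.
Proof.
have [P hP nP] := other_place hE hP0; have [a [_ da aB]] := basis_at hP nP.
apply: (span_free (frob_free hE hP da)) => l.
have [r e] := comb_change (fun l' => (l' == l)%:R) aB.
by rewrite comb_delta in e; rewrite e; eexists.
Qed.

(** Near P the basis of orders 0, ..., q - 1 has regular coordinates. It consists of sections of q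
    P0, hence of constant combinations of B, so the coordinates in B are regular as well. *)
Let reg P y m : place iota P -> P <> P0 -> vge P 0 (comb fr y B) -> vge P 0 (y m).
Proof.
move=> hP nP hf; have [a [oa da aB]] := basis_at hP nP.
have [z ez] := frob_span hE (frob_free hE hP da) (comb fr y B).
have [r e] := comb_change z aB.
rewrite (kfree_uniq fB (etrans ez e) m).
apply: (vge_sum hF hP) => l _; rewrite mulrC; apply: (vgeZ hF hP).
have [a0 oal] := oa l.
have : vge P 0 (z l ^+ q * a l) by apply: (frob_vge hE hq hP da); rewrite ez in hf.
case: (eqVneq (z l) 0) => [->|z0]; first by left.
rewrite !vge_neq0 ?mulf_neq0 ?expf_neq0 // (ordM hF hP) ?expf_neq0 // (ordX hF hP) // oal mulrn_int.
have := ltn_ord l; nia.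
Qed.

Let B1 : B iq1 = 1. Proof. by rewrite /B eqxx. Qed.

Let toA y : comb fr y B =
  comb fr (fun m => if m == iq1 then y iq1 * b iq1 else y m + y iq1 * b m) A.
Proof.
rewrite {1}/comb (bigD1 iq1) //= B1 eb /comb mulr_sumr (bigD1 iq1) //=.
rewrite [RHS](bigD1 iq1) //= eqxx rmorphM -!mulrA -addrA; congr (_ + _).
rewrite -big_split; apply: eq_bigr => m /negPf mq /=; rewrite /B mq.
by rewrite rmorphD rmorphM; ring.
Qed.

Let b0 : b iq1 != 0.
Proof.
apply/eqP => e.
have e1 : comb fr (fun m => (m == iq1)%:R) B = comb fr (fun m => if m == iq1 then 0 else b m) B.
  rewrite comb_delta B1 toA eqxx mul0r eb; apply: eq_bigr => m _.
  by case: eqP => [->|_]; rewrite ?e // mul0r addr0.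
by have /eqP := kfree_uniq fB e1 iq1; rewrite eqxx oner_eq0.
Qed.

Let N := `|ord P0 (b iq1)|%N.

Let oN : ord P0 (b iq1) = N%:Z.
Proof.
have : vge P0 2 (b iq1) by apply: vgeA (vb iq1) _ => /=; lia.
by rewrite vge_neq0 ?b0 // /N; lia.
Qed.

Let spanB f : exists y, f = comb fr y B. Proof. exact: (frob_span hE fB). Qed.

(** In the basis A, a pole of order at most 2q leaves the last coordinate [y iq1 * b iq1] regular
    and the others with at most a simple pole. The place P0 gives the pole bounds and [reg] gives
    regularity elsewhere. *)
Let coord_pole y : Hn (q + q) (comb fr y B) ->
  Hn N (y iq1) /\ forall m, m != iq1 -> vge P0 (-1) (y m + y iq1 * b m).
Proof.
move=> /(HnP hE hP0)[h1 h2]; have h3 := h1; rewrite toA in h3.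
have h4 := comb_vge h3; split; last first.
  move=> m mq; have := h4 m; rewrite (negPf mq) => h5; apply: vgeA h5 _; lia.
apply/(HnP hE hP0); split; last by move=> Q hQ nQ; apply: reg => //; apply: h2.
have := h4 iq1; rewrite eqxx => /(@vgeA _ _ _ 0) /= h5.
have : vge P0 0 (y iq1 * b iq1) by apply: h5; lia.
rewrite -oN => h6; apply/(vge_shift hF hP0 _ _ b0); by rewrite addNr.
Qed.

Let coordD n (c : 'I_n -> k) (g : 'I_n -> F) (y : 'I_n -> 'I_q -> F) :
  (forall i, g i = comb fr (y i) B) ->
  comb iota (fun i => c i ^+ q) g = comb fr (fun m => comb iota c (y ^~ m)) B.
Proof.
move=> hg; rewrite /comb; under eq_bigr => i _ do rewrite hg /comb mulr_sumr.
rewrite exchange_big; apply: eq_bigr => m _ /=; rewrite (rmorph_sum fr) mulr_suml.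
by apply: eq_bigr => i _; rewrite rmorphM /= !frobE rmorphXn mulrA.
Qed.

(** The functions 1 and those of pole orders q + 1, ..., 2q have last coordinates in H^0(N P0), and
    these are independent. A combination with last coordinate 0 has its other coordinates in
    H^0(P0), hence constant, so it lies in H^0(q P0); this leaves only a multiple of 1, whose last
    coordinate is not 0. *)
Let N_ge : (q < N)%N.
Proof.
have /choice[g hg] : forall i : 'I_q.+1, exists g, [/\ g != 0, Hn (q + q) g &
    ord P0 g = if i == ord0 then 0 else - (q + i)%N%:Z].
  move=> i; case: (eqVneq i ord0) => [_|i0].
    exists 1; split; rewrite ?oner_neq0 ?(ord_one hF hP0) //.
    by apply: (Hn_mono hE (leq0n _)); apply/(Hn0 hE P0); exists 1; rewrite ?rmorph1.
  have i1 : (0 < i)%N by rewrite lt0n; apply: contra i0 => /eqP e; apply/eqP/val_inj.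
  have [|f fH [f0 of_]] := pole_section hE hP0 (n := q + i); first by lia.
  by exists f; split=> //; apply: (Hn_mono hE _ fH); have := ltn_ord i; lia.
have /choice[y hy] : forall i, exists y, g i = comb fr y B by move=> i; apply: spanB.
have hc i : Hn N (y i iq1).
  by have [_ h _] := hg i; rewrite hy in h; have [] := coord_pole h.
have N1 : (0 < N)%N.
  have := relation_vge1 iq1; rewrite vge_neq0 ?b0 // oN; lia.
apply: (kdim_free_le (Hn_dim hE hP0 N1) hc) => c hcc.
pose f := comb iota (fun i => c i ^+ q) g.
have ef : f = comb fr (fun m => comb iota c (y ^~ m)) B by apply: coordD.
have fH : Hn (q + q) f.
  by apply: subspace_comb; [apply: Hn_sub|move=> i; have [] := hg i].
have [_ h1] := coord_pole (eq_ind _ _ fH _ ef).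
have /choice[d hd] : forall m, exists d, m != iq1 -> comb iota c (y ^~ m) = iota d.
  move=> m; case: (eqVneq m iq1) => [_|mq]; first by exists 0.
  suff /Hn1_const[d _ e] : Hn 1 (comb iota c (y ^~ m)) by exists d.
  apply/(HnP hE hP0); split.
    by have := h1 m mq; rewrite hcc mul0r addr0.
  move=> Q hQ nQ; apply: (reg (y := fun m => comb iota c (y ^~ m))) => //.
  by rewrite -ef; have /(HnP hE hP0)[_] := fH; apply.
have fq : Hn q f.
  rewrite ef; apply: (@big_ind _ (fun x => Hn q x)) => [||m _].
  - by have [] := Hn_sub hE P0 q.
  - by have [] := Hn_sub hE P0 q.
  case: (eqVneq m iq1) => [->|mq].
    rewrite hcc rmorph0 mul0r; by have [] := Hn_sub hE P0 q.
  rewrite hd // /= !frobE -rmorphXn; have [_ _] := Hn_sub hE P0 q; apply; exact: BH.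
have czero i : i != ord0 -> c i = 0.
  move=> i0; apply/eqP/negPn/negP => ci.
  have ci' : iota (c i ^+ q) != 0 by rewrite fmorph_eq0 expf_neq0.
  have : vge P0 (- q%:Z) (iota (c i ^+ q) * g i).
    apply: (vge_sum_distinct hE (w := fun i => iota (c i ^+ q) * g i) hP0); last first.
      by have /(HnP hE hP0)[] := fq.
    move=> l m lm; rewrite !mulf_eq0 !negb_or !fmorph_eq0 => /andP[cl gl] /andP[cm gm].
    rewrite !(ordM hF hP0) ?fmorph_eq0 // !(ord_const hF hP0) // !add0r.
    have ogE i' : ord P0 (g i') = if i' == ord0 then 0 else - (q + i')%N%:Z by have [] := hg i'.
    rewrite !ogE; case: (eqVneq l ord0) lm => [el|l0]; case: (eqVneq m ord0) => [em|m0];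
      rewrite ?el ?em ?eqxx // => lm; apply/negP => /eqP.
    - move: m0; rewrite -val_eqE /=; lia.
    - move: l0; rewrite -val_eqE /=; lia.
    - by move/oppr_inj => -[] /addnI/val_inj e; rewrite e eqxx in lm.
  have [g0 _ og] := hg i.
  rewrite vge_neq0 ?mulf_neq0 // (ordM hF hP0) // (ord_const hF hP0) ?expf_neq0 // og (negPf i0) add0r.
  move: i0; rewrite -val_eqE /=; lia.
move=> i; case: (eqVneq i ord0) => [->|/czero //].
have [g0 _ og] := hg ord0; rewrite eqxx in og.
have y0 : y ord0 iq1 != 0.
  apply/eqP => z; move: hcc.
  have [_ g0H _] := hg ord0; have g0C : range iota (g ord0).
    apply/(Hn0 hE P0)/(HnP hE hP0); split; first by right; rewrite og.
    by have /(HnP hE hP0)[] := g0H.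
  case: g0C => a _ ea _; have a0 : a != 0 by rewrite -(fmorph_eq0 iota) ea.
  have [s es] := @kroot k _ _ hq a.
  have e1 : comb fr (fun m => iota s * (m == iq1)%:R) B = comb fr (y ord0) B.
    by rewrite combZ comb_delta B1 mulr1 /= !frobE -rmorphXn es -hy ea.
  have := kfree_uniq fB e1 iq1; rewrite eqxx mulr1 z => /eqP; rewrite fmorph_eq0 => /eqP s0.
  by move: a0; rewrite -es s0 expr0n gtn_eqF // eqxx.
move: hcc; rewrite /comb (bigD1 ord0) //= big1 ?addr0 => [/eqP|j /czero ->]; last by rewrite rmorph0 mul0r.
by rewrite mulf_eq0 (negPf y0) orbF fmorph_eq0 => /eqP.
Qed.

(** With last coordinate xi, the other coordinates are chosen by [approx] to cancel the principal
    parts of xi b_m up to a simple pole, which 2q allows. *)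
Let lift_section xi : Hn N xi -> exists f y, [/\ Hn (q + q) f, f = comb fr y B & y iq1 = xi].
Proof.
move=> /(HnP hE hP0)[x1 x2].
have /choice[z hz] : forall m, exists y, (forall Q, place iota Q -> Q <> P0 -> vge Q 0 y) /\
    vge P0 (-1) (y + xi * b m) by move=> m; apply: approx.
pose y m := if m == iq1 then xi else z m.
exists (comb fr y B), y; split; rewrite // /y ?eqxx //.
apply/(HnP hE hP0); split.
  rewrite toA; apply: (vge_sum hF hP0) => m _; rewrite /= !frobE /y eqxx.
  case: (eqVneq m iq1) => [->|mq].
    apply: (@Avge _ _ _ 0); last by rewrite /=; lia.
    have vbN : vge P0 N%:Z (b iq1) by right; rewrite oN.
    by have := vgeM hF hP0 x1 vbN; rewrite addNr.
  have [_ h] := hz m; apply: Avge h _.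
  have : m != q.-1 :> nat by apply: contra mq => /eqP e; apply/eqP/val_inj.
  have := ltn_ord m; lia.
move=> Q hQ nQ; apply: (vge_sum hF hQ) => m _; rewrite -[0]addr0; apply: (vgeM hF hQ).
  rewrite /= !frobE -(mul0rn _ q); apply: (vgeX hF hQ); rewrite /y.
  by case: ifP => _; [apply: x2|have [h _] := hz m; apply: h].
by have /(HnP hE hP0)[_] := BH m; apply.
Qed.

(** Lifts of a basis of H^0(N P0) together with the q - 1 functions A_m, m < q - 1, whose last
    coordinate is 0, are independent in H^0(2q P0); hence N + q - 1 <= 2q. *)
Let N_le : (N <= q.+1)%N.
Proof.
have N1 : (0 < N)%N by apply: leq_ltn_trans N_ge.
have [beta [bH fb _]] := Hn_dim hE hP0 N1.
have /choice[f /choice[y hfy]] : forall l, exists f y, [/\ Hn (q + q) f, f = comb fr y B & y iq1 = beta l].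
  by move=> l; apply: lift_section.
have qq : (0 < q + q)%N by rewrite addn_gt0 q0.
have [v [_ _ sv]] := Hn_dim hE hP0 qq.
pose w (s : 'I_N + 'I_q.-1) := match s with inl l => f l | inr m => A (lift iq1 m) end.
have ltm (m : 'I_q.-1) : lift iq1 m != iq1 by rewrite eq_sym neq_lift.
have le := @free_le_fin _ _ iota _ _ w v.
have : (N + q.-1 <= q + q)%N; last by lia.
move: le; rewrite card_sum !card_ord; apply=> [c hc|s]; last first.
  apply: sv; case: s => [l|m] /=; first by have [] := hfy l.
  apply: (Hn_mono hE _ (AH _)); have := ltn_ord (lift iq1 m); lia.
have /choice[r hr] := @kroot k _ _ hq.
rewrite big_sumType /= in hc.
have e1 : comb fr (fun m => comb iota (fun l => r (c (inl l))) (y ^~ m) +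
    (if unlift iq1 m is Some m' then iota (r (c (inr m'))) else 0)) B = 0.
  rewrite combD -[RHS]hc; congr (_ + _).
    rewrite -(coordD (fun l => r (c (inl l))) (g := f)); last by move=> l; have [] := hfy l.
    by apply: eq_bigr => l _; rewrite hr.
  rewrite /comb (bigD1_ord iq1) //= unlift_none rmorph0 mul0r add0r.
  apply: eq_bigr => m _; rewrite liftK /= !frobE -rmorphXn hr /B.
  by rewrite (negPf (ltm m)).
have c1 l : c (inl l) = 0.
  have := fB e1 iq1; rewrite unlift_none addr0 => e2.
  have e3 : comb iota (fun l => r (c (inl l))) beta = 0.
    by rewrite -[RHS]e2; apply: eq_bigr => l' _; have [_ _ ->] := hfy l'.
  by have rl := fb _ e3 l; rewrite -(hr (c (inl l))) rl expr0n gtn_eqF.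
case=> [l|m]; first exact: c1.
have := fB e1 (lift iq1 m); rewrite liftK {1}/comb big1 ?add0r => [/eqP|l _]; last first.
  have : r (c (inl l)) ^+ q == 0 by rewrite hr c1.
  by rewrite expf_eq0 => /andP[_ /eqP ->]; rewrite rmorph0 mul0r.
by rewrite fmorph_eq0 => /eqP e2; rewrite -(hr (c (inr m))) e2 expr0n gtn_eqF.
Qed.

Lemma relation_last (m : 'I_q) : m = q.-1 :> nat -> b m != 0 /\ ord P0 (b m) = (q.+1)%:Z.
Proof.
move=> em; have -> : m = iq1 by apply: val_inj.
by split; [apply: b0|rewrite oN; congr Posz; apply/eqP; rewrite eqn_leq N_le N_ge].
Qed.

End Relation.

Lemma relation : exists A b : 'I_q -> F,
  [/\ forall m : 'I_q, A m != 0 /\ ord P0 (A m) = - (m.+2)%:Z, forall m : 'I_q, Hn m.+2 (A m),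
      distinct_mod q P0 A, 1 = comb fr b A &
   [/\ forall m, vge P0 1 (b m),
      Hn q `<=` kspan iota (fun m : 'I_q => if m == q.-1 :> nat then 1 else A m),
      forall m : 'I_q, m = q.-2 :> nat -> b m != 0 /\ ord P0 (b m) = 1 &
      forall m : 'I_q, m = q.-1 :> nat -> b m != 0 /\ ord P0 (b m) = (q.+1)%:Z]].
Proof.
have /choice[A hA] : forall m : 'I_q, exists f, [/\ f != 0, ord P0 f = - (m.+2)%:Z & Hn m.+2 f].
  by move=> m; have [f fH [f0 e]] := pole_section hE hP0 (isT : (1 < m.+2)%N); exists f.
have A0 (m : 'I_q) : A m != 0 by have [] := hA m.
have oA (m : 'I_q) : ord P0 (A m) = - (m.+2)%:Z by have [] := hA m.
have AH (m : 'I_q) : Hn m.+2 (A m) by have [] := hA m.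
have dA := pole_distinct A0 oA.
have [b eb] := frob_span hE (frob_free hE hP0 dA) 1.
exists A, b; split=> //; split.
- exact: (relation_vge1 A0 oA eb).
- exact: (pole_span A0 oA AH).
- exact: (relation_ord1 A0 oA eb).
- exact: (relation_last A0 oA AH eb).
Qed.

End Key.

Lemma subn_inj_le (a b c : nat) : (b <= a)%N -> (c <= a)%N -> (a - b = a - c)%N -> b = c.
Proof. lia. Qed.

(** * The charts of the blowup *)

Section PolynomialRings.
Variables (F K : fieldType) (phi : {rmorphism F -> K}).
Implicit Types (A P : set F) (X : K) (f g : {poly F}).

Definition ev X f : K := (map_poly phi f).[X].

Lemma evD X f g : ev X (f + g) = ev X f + ev X g. Proof. by rewrite /ev rmorphD hornerD. Qed.
Lemma evN X f : ev X (- f) = - ev X f. Proof. by rewrite /ev rmorphN hornerN. Qed.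
Lemma evM X f g : ev X (f * g) = ev X f * ev X g. Proof. by rewrite /ev rmorphM hornerM. Qed.
Lemma evC X c : ev X c%:P = phi c. Proof. by rewrite /ev map_polyC hornerC. Qed.
Lemma evX X : ev X 'X = X. Proof. by rewrite /ev map_polyX hornerX. Qed.
Lemma ev0 X : ev X 0 = 0. Proof. by rewrite -[0]/(0%:P) evC rmorph0. Qed.
Lemma ev1 X : ev X 1 = 1. Proof. by rewrite -[1]/(1%:P) evC rmorph1. Qed.
Lemma evXn X n : ev X 'X^n = X ^+ n.
Proof. by rewrite /ev map_polyXn hornerXn. Qed.
Lemma evexp X f n : ev X (f ^+ n) = ev X f ^+ n.
Proof. by rewrite /ev rmorphXn horner_exp. Qed.
Lemma evZ X c f : ev X (c *: f) = phi c * ev X f.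
Proof. by rewrite -mul_polyC evM evC. Qed.
Lemma ev_sum X I (r : seq I) (Q : pred I) (f : I -> {poly F}) :
  ev X (\sum_(i <- r | Q i) f i) = \sum_(i <- r | Q i) ev X (f i).
Proof. by apply: (big_morph (ev X)); [apply: evD|apply: ev0]. Qed.
Lemma evE X f n : (size f <= n)%N -> ev X f = \sum_(i < n) phi f`_i * X ^+ i.
Proof.
move=> le; rewrite /ev (horner_coef_wide (n := n)) ?size_map_poly //.
by apply: eq_bigr => i _; rewrite coef_map.
Qed.

Definition generates X : Prop :=
  (forall f, ev X f = 0 -> f = 0) /\ forall z, exists f g, g != 0 /\ z = ev X f / ev X g.

Lemma ev_neq0 X f : generates X -> f != 0 -> ev X f != 0.
Proof. by move=> [tX _] f0; apply: contra_neq f0; apply: tX. Qed.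

Lemma ev_inj X f g : generates X -> ev X f = ev X g -> f = g.
Proof.
move=> [tX _] e; apply/eqP; rewrite -subr_eq0; apply/eqP/tX.
by rewrite evD evN e subrr.
Qed.

Lemma generates_neq0 X : generates X -> X != 0.
Proof. by move=> /(ev_neq0 (f := 'X)); rewrite polyX_eq0 evX; apply. Qed.

Lemma ev_comp X c f : ev X (f \Po (c *: 'X)) = ev (phi c * X) f.
Proof.
rewrite (evE (phi c * X) (leqnn (size f))) comp_polyE ev_sum; apply: eq_bigr => i _.
by rewrite evZ exprZn evZ evXn rmorphXn exprMn.
Qed.

Lemma generates_scale X c : generates X -> c != 0 -> generates (phi c * X).
Proof.
move=> gX c0; have cK f : (f \Po (c *: 'X)) \Po (c^-1 *: 'X) = f.
  by rewrite -comp_polyA comp_polyZ comp_polyX scalerA mulfV // scale1r comp_polyXr.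
have cK' f : (f \Po (c^-1 *: 'X)) \Po (c *: 'X) = f.
  by rewrite -comp_polyA comp_polyZ comp_polyX scalerA mulVf // scale1r comp_polyXr.
split=> [f|z].
  by rewrite -ev_comp => /(proj1 gX) e; rewrite -(cK f) e comp_poly0.
have [f [g [g0 e]]] := proj2 gX z; exists (f \Po (c^-1 *: 'X)), (g \Po (c^-1 *: 'X)).
split; last by rewrite -!ev_comp !cK'.
by apply: contra_neq g0 => e0; rewrite -(cK' g) e0 comp_poly0.
Qed.

Definition revp n f : {poly F} := \poly_(i < n.+1) f`_(n - i)%N.

Lemma ev_rev X f n : X != 0 -> (size f <= n.+1)%N -> X ^+ n * ev X^-1 f = ev X (revp n f).
Proof.
move=> X0 le; rewrite (evE _ le) (evE X (size_poly _ _)) mulr_sumr (reindex_inj rev_ord_inj) /=.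
apply: eq_bigr => i _; rewrite subSS coef_poly ltn_ord.
have le' : (i <= n)%N by rewrite -ltnS.
by rewrite exprV_cancel ?leq_subr // subKn // mulrC.
Qed.

Lemma generates_inv X : generates X -> generates X^-1.
Proof.
move=> gX; have X0 := generates_neq0 gX.
split=> [f e|z].
  have /(ev_rev X0) := leqnSn (size f); rewrite e mulr0 => /esym/(proj1 gX) r0.
  apply/polyP => i; rewrite coef0; case: (leqP (size f) i) => [le|lt]; first exact: nth_default.
  have := congr1 (fun h : {poly F} => h`_(size f - i)%N) r0.
  by rewrite coef0 coef_poly ltnS leq_subr subKn // ltnW.
have [f [g [g0 e]]] := proj2 gX z.
pose n := maxn (size f) (size g).
have rr (h : {poly F}) : (size h <= n)%N -> ev X^-1 (revp n h) = X^-1 ^+ n * ev X h.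
  by move=> le; rewrite -ev_rev ?invrK ?invr_eq0 // ltnW.
exists (revp n f), (revp n g); split.
  apply/eqP => r0; have /eqP := rr g (leq_maxr _ _); rewrite r0 ev0 eq_sym mulf_eq0.
  by rewrite expf_eq0 invr_eq0 (negPf X0) andbF (negPf (ev_neq0 gX g0)).
rewrite !rr ?leq_maxl ?leq_maxr // e.
have h1 := ev_neq0 gX g0; have h2 : X^-1 ^+ n != 0 by rewrite expf_neq0 // invr_eq0.
by rewrite -[LHS]mulr1 -(mulfV h2) invfM; ring.
Qed.

Lemma image_subring A : subring A -> subring (phi @` A).
Proof.
move=> rA; apply/subringP; split; first by exists 1; rewrite ?rmorph1 //; apply: sub1.
- by move=> _ _ [x Ax <-] [y Ay <-]; exists (x - y); rewrite ?rmorphB //; apply: subB.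
- by move=> _ _ [x Ax <-] [y Ay <-]; exists (x * y); rewrite ?rmorphM //; apply: subM.
Qed.

Lemma polyring_image A X : polyring (phi @` A) X = [set ev X f | f in polyover A].
Proof.
rewrite eqEsubset; split=> [_ [g hg <-]|_ [f hf <-]].
  have /choice[a ha] : forall i, exists a, A a /\ phi a = g`_i.
    by move=> i; have [a Aa e] := hg i; exists a.
  exists (\poly_(i < size g) a i) => [i|].
    rewrite coef_poly; case: ltnP => _; first by have [] := ha i.
    have [Aa e] := ha (size g); rewrite nth_default // in e.
    by move/eqP: e; rewrite fmorph_eq0 => /eqP <-.
  rewrite /ev; congr (_.[X]); apply/polyP => i; rewrite coef_map coef_poly.
  case: ltnP => le; first by have [_] := ha i.
  by rewrite [LHS]rmorph0 nth_default.
by exists (map_poly phi f) => // i; rewrite coef_map; exists f`_i.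
Qed.

(** F[X] is a principal ideal domain: in lowest terms, the denominator of an integral fraction
    divides a power of the numerator, hence is constant. *)
Lemma polyF_normal X : generates X ->
  integral_closure (polyring (range phi) X) `<=` polyring (range phi) X.
Proof.
move=> gX z [G [Gm hG /rootP Gz]].
have [f [g [g0 e]]] := proj2 gX z.
have /choice[a ha] : forall i, exists a, ev X a = G`_i.
  by move=> i; have := hG i; rewrite polyring_image => -[a _ ea]; exists a.
pose d := gcdp f g.
have d0 : d != 0 by rewrite gcdp_eq0 negb_and g0 orbT.
pose f' := f %/ d; pose g' := g %/ d.
have ef : f = f' * d by rewrite divpK // dvdp_gcdl.
have eg : g = g' * d by rewrite divpK // dvdp_gcdr.
have g'0 : g' != 0 by apply: contra_neq g0 => h; rewrite eg h mul0r.
have cop : coprimep f' g' by rewrite coprimep_div_gcd // g0 orbT.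
have eg0 := ev_neq0 gX g'0; have ed0 := ev_neq0 gX d0.
have ez : z * ev X g' = ev X f'.
  by rewrite e ef eg !evM; field; rewrite ed0 eg0.
have [n sG] : exists n, size G = n.+1.
  by exists (size G).-1; rewrite prednK // lt0n size_poly_eq0 monic_neq0.
have Gn : G`_n = 1 by move/monicP: Gm; rewrite /lead_coef sG.
have dvd : g' %| f' ^+ n.
  pose s := \sum_(i < n) a i * f' ^+ i * g' ^+ (n - i).-1.
  have -> : f' ^+ n = - s * g'.
    apply: (ev_inj gX); rewrite evM evN evexp ev_sum.
    move: Gz; rewrite horner_coef sG big_ord_recr /= Gn mul1r => /eqP; rewrite addrC addr_eq0 => /eqP h.
    rewrite -ez exprMn h !mulNr mulr_suml mulr_suml; congr (- _); apply: eq_bigr => i _.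
    rewrite !evM !evexp -ez ha exprMn.
    have -> : ev X g' ^+ n = ev X g' ^+ i * ev X g' ^+ (n - i).-1 * ev X g'.
      by rewrite -mulrA -exprSr -exprD; congr (_ ^+ _); have := ltn_ord i; lia.
    by ring.
  exact: dvdp_mull.
have : g' %| 1.
  rewrite -(Gauss_dvdpr 1 (q := f' ^+ n)); last by rewrite coprimep_sym coprimep_expl.
  by rewrite mulr1.
rewrite dvdp1 => /size_poly1P[c c0 eg'].
rewrite polyring_image; exists (c^-1 *: f') => //.
apply: (mulIf eg0); rewrite ez eg' evZ evC mulrC mulrA -rmorphM mulfV //.
by rewrite rmorph1 mul1r.
Qed.

Lemma val_max A (s : seq F) x : valuation_ring A -> x \in s -> x != 0 ->
  exists2 y, y \in s & y != 0 /\ forall z, z \in s -> A (z / y).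
Proof.
move=> vA; have rA := val_sub vA.
elim: s x => [//|a s IH] x; rewrite inE => xs x0.
have [h|[y ys [y0 hy]]] : (forall z, z \in s -> z = 0) \/
    exists2 y, y \in s & y != 0 /\ forall z, z \in s -> A (z / y).
  have [[y [ys y0]]|no] := pselect (exists y, y \in s /\ y != 0).
    by right; apply: IH ys y0.
  by left=> z zs; apply/eqP/negPn/negP => z0; apply: no; exists z.
- have ea : x = a.
    by case/orP: xs => [/eqP //|/h e]; rewrite e eqxx in x0.
  have a0 : a != 0 by rewrite -ea.
  exists a; rewrite ?inE ?eqxx //; split=> // z; rewrite inE => /orP[/eqP ->|/h ->].
    by rewrite divff //; apply: sub1.
  by rewrite mul0r; apply: sub0.
- case: (vA.2 (a / y)) => h.
    exists y; rewrite ?inE ?ys ?orbT //; split=> // z; rewrite inE => /orP[/eqP -> //|]; exact: hy.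
  have [a0|a0] := eqVneq a 0.
    exists y; rewrite ?inE ?ys ?orbT //; split=> // z; rewrite inE => /orP[/eqP ->|]; last exact: hy.
    by rewrite a0 mul0r; apply: sub0.
  exists a; rewrite ?inE ?eqxx //; split=> // z; rewrite inE => /orP[/eqP ->|zs].
    by rewrite divff //; apply: sub1.
  have -> : z / a = (z / y) * (a / y)^-1 by field; rewrite a0 y0.
  by apply: subM => //; apply: hy.
Qed.

(** Gauss's lemma: the product of the first unit coefficients is the only unit contribution to its
    coefficient. *)
Lemma primitive_mul A f g : valuation_ring A -> polyover A f -> polyover A g ->
  (exists i, ~ nonunits A f`_i) -> (exists i, ~ nonunits A g`_i) ->
  exists i, ~ nonunits A (f * g)`_i.
Proof.
move=> vA hf hg [i0 hi] [j0 hj]; have rA := val_sub vA.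
have first (h : nat -> F) l : ~ nonunits A (h l) ->
    exists l', ~ nonunits A (h l') /\ forall i, (i < l')%N -> nonunits A (h i).
  move=> hl; have ex : exists l, `[< ~ nonunits A (h l) >] by exists l; apply/asboolP.
  case: (ex_minnP ex) => l' /asboolP hl' mn; exists l'; split=> // i lt.
  apply: contrapT => n; have : (l' <= i)%N by apply: mn; apply/asboolP.
  by rewrite leqNgt lt.
have [i [ni mi]] := first (fun i => f`_i) i0 hi; have [j [nj mj]] := first (fun i => g`_i) j0 hj.
exists (i + j)%N; rewrite coefM.
have lt : (i < (i + j).+1)%N by rewrite ltnS leq_addr.
rewrite (bigD1 (Ordinal lt)) //= addKn => n.
have ui : unit_in A f`_i by apply/unit_nonunits.
have uj : unit_in A g`_j by apply/unit_nonunits.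
have uij := unit_inM rA ui uj.
have nn : ~ nonunits A (f`_i * g`_j) by apply/unit_nonunits => //; case: uij.
apply: nn.
move: n; set s := (X in nonunits _ (_ + X)) => n.
have -> : f`_i * g`_j = (f`_i * g`_j + s) - s by rewrite addrK.
apply: nonunitsD => //; apply: nonunitsN => //; rewrite /s.
apply: big_ind => [||l]; [exact: nonunits0|by move=> x y; apply: nonunitsD|].
rewrite -val_eqE /= => li; have := ltn_ord l => ll.
have [lt'|gt|e] := ltngtP (l : nat) i; last by rewrite e eqxx in li.
  by rewrite mulrC; apply: nonunitsM => //; apply: mi.
by apply: nonunitsM => //; apply: mj; lia.
Qed.

(** An integral element is f(X) with f over F. If f is not over A, dividing by a coefficient c of
    largest pole gives a primitive h, and the equation divided by c^n writes h^n with nonunit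
    coefficients, against Gauss's lemma. *)
Lemma polyring_normal A X : valuation_ring A -> generates X ->
  integral_closure (polyring (phi @` A) X) `<=` polyring (phi @` A) X.
Proof.
move=> vA gX z hz; have rA := val_sub vA.
have : polyring (range phi) X z.
  apply: polyF_normal => //; apply: integral_mono hz.
  by rewrite !polyring_image => _ [f hf <-]; exists f.
rewrite !polyring_image => -[f _ ef]; exists f => //.
apply: contrapT => nf; case: hz => G [Gm hG /rootP Gz].
have /choice[a ha] : forall i, exists a, polyover A a /\ ev X a = G`_i.
  by move=> i; have := hG i; rewrite polyring_image => -[a Aa ea]; exists a.
have [n sG] : exists n, size G = n.+1.
  by exists (size G).-1; rewrite prednK // lt0n size_poly_eq0 monic_neq0.
have Gn : G`_n = 1 by move/monicP: Gm; rewrite /lead_coef sG.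
have [j nj] : exists j, ~ A f`_j.
  by apply: contrapT => no; apply: nf => i; apply: contrapT => h; apply: no; exists i.
have fj0 : f`_j != 0 by apply/eqP => e; apply: nj; rewrite e; apply: sub0.
have js : f`_j \in (f : seq F).
  by rewrite mem_nth // ltnNge; apply/negP => h; move: fj0; rewrite nth_default ?eqxx.
have [c /(nthP 0)[l _ el] [c0 hc]] := val_max vA js fj0.
have hc' i : A (f`_i / c).
  case: (ltnP i (size f)) => h; first by apply: hc; rewrite mem_nth.
  by rewrite nth_default // mul0r; apply: sub0.
have nc : nonunits A c^-1.
  by apply: not_val_nonunits => // Ac; apply: nj; have := subM rA (hc' j) Ac; rewrite divfK.
pose h := c^-1 *: f.
have hh : polyover A h by move=> i; rewrite coefZ mulrC.
have ph : exists i, ~ nonunits A h`_i.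
  by exists l; rewrite coefZ el mulVf //; apply: nonunits1.
have phn m : polyover A (h ^+ m) /\ exists i, ~ nonunits A (h ^+ m)`_i.
  elim: m => [|m [oh IH]]; first by split; [have [] := polyover_subring rA|exists 0%N; rewrite coef1; apply: nonunits1].
  by rewrite exprS; split; [have [_ _] := polyover_subring rA; apply|apply: primitive_mul].
have [_ [i]] := phn n; apply.
have -> : h ^+ n = - \sum_(m < n) c^-1 ^+ (n - m) *: (a m * h ^+ m).
  apply: (ev_inj gX); rewrite evN ev_sum evexp evZ ef exprMn.
  move: Gz; rewrite horner_coef sG big_ord_recr /= Gn mul1r => /eqP; rewrite addrC addr_eq0 => /eqP ->.
  rewrite mulrN mulr_sumr; congr (- _); apply: eq_bigr => m _.
  rewrite evZ evM evexp evZ ef; have [_ ->] := ha m.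
  rewrite rmorphXn exprMn mulrCA [RHS]mulrCA; congr (_ * _).
  by rewrite mulrA -exprD subnK // ltnW.
rewrite coefN coef_sum; apply: nonunitsN => //.
apply: big_ind => [||m _]; [exact: nonunits0|by move=> x y; apply: nonunitsD|].
rewrite coefZ mulrC; have -> : c^-1 ^+ (n - m) = c^-1 ^+ (n - m).-1 * c^-1.
  by rewrite -exprSr prednK // subn_gt0.
rewrite mulrA; apply: nonunitsM => //; apply: subM => //.
  have [_ _ hM] := polyover_subring rA; apply: hM; [by have [] := ha m|by have [] := phn m].
by apply: subX => //; case: nc.
Qed.

(* A[a, b] with a b = d in A: it is the intersection of A[a, 1/a] and A[b, 1/b]. *)
Lemma cross_normal A (a b : K) d : valuation_ring A -> generates a -> generates b ->
  A d -> d != 0 -> a * b = phi d ->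
  integral_closure (polyring (polyring (phi @` A) a) b) `<=`
  polyring (polyring (phi @` A) a) b.
Proof.
move=> vA ga gb Ad d0 ab z hz; have rA := val_sub vA; have rI := image_subring rA.
have [a0 b0] := (generates_neq0 ga, generates_neq0 gb).
have ra := polyring_subring a rI; have rb := polyring_subring b rI.
have rab := polyring_subring b ra.
have pd0 : phi d != 0 by rewrite fmorph_eq0.
(* As y = d/x, a power of x clears the denominators of all coefficients of the equation of z, so x^N
   z is integral over the normal ring A[x]. *)
have laurent (x y : K) : generates x -> x * y = phi d ->
    (forall t, polyring (polyring (phi @` A) a) b t -> exists n, polyring (phi @` A) x (x ^+ n * t)) ->
    exists n, polyring (phi @` A) x (x ^+ n * z).
  move=> gx xy hxy; have rx := polyring_subring x rI.
  have [G [Gm hG /rootP Gz]] := hz.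
  have [N hN] : exists N, forall i, polyring (phi @` A) x (x ^+ N * G`_i).
    have [N hN] : exists N, forall i, (i < size G)%N -> polyring (phi @` A) x (x ^+ N * G`_i).
      elim: (size G) => [|m [N hN]]; first by exists 0%N.
      have [n hn] := hxy _ (hG m); exists (N + n)%N => i; rewrite ltnS leq_eqVlt.
      have px l := subX rx l (polyring_gen x rI).
      move=> /orP[/eqP ->|/hN h].
        by rewrite exprD -mulrA; apply: subM.
      by rewrite exprD mulrAC mulrC; apply: subM.
    exists N => i; case: (ltnP i (size G)) => [/hN //|le].
    by rewrite nth_default // mulr0; apply: sub0.
  exists N; apply: polyring_normal => //.
  have [n sG] : exists n, size G = n.+1.
    by exists (size G).-1; rewrite prednK // lt0n size_poly_eq0 monic_neq0.
  have Gn : G`_n = 1 by move/monicP: Gm; rewrite /lead_coef sG.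
  exists (\poly_(i < n.+1) (G`_i * (x ^+ N) ^+ (n - i))); split.
  - apply/monicP; rewrite lead_coef_poly //= ?subnn ?Gn ?mulr1 //; exact: oner_neq0.
  - move=> i; rewrite coef_poly; case: ltnP => [|_]; last exact: sub0.
    rewrite ltnS leq_eqVlt => /orP[/eqP ->|lt]; first by rewrite subnn Gn mulr1; apply: sub1.
    rewrite -(subnSK lt) exprS mulrA [_ * (_ ^+ N)]mulrC.
    by apply: subM => //; apply: subX => //; apply: subX => //; apply: polyring_gen.
  - apply/rootP; transitivity ((x ^+ N) ^+ n * G.[z]); last by rewrite Gz mulr0.
    rewrite horner_poly horner_coef sG mulr_sumr; apply: eq_bigr => i _.
    have le : (i <= n)%N by rewrite -ltnS.
    by rewrite exprMn -[X in _ = _ ^+ X * _](subnK le) exprD; ring.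
have step (x y : K) (t : K) : x * y = phi d -> (exists n, polyring (phi @` A) x (x ^+ n * t)) ->
    forall l, exists n, polyring (phi @` A) x (x ^+ n * (t * y ^+ l)).
  move=> xy [n hn] l; have rx := polyring_subring x rI; exists (n + l)%N.
  have -> : x ^+ (n + l) * (t * y ^+ l) = x ^+ n * t * (phi d) ^+ l by rewrite -xy exprMn exprD; ring.
  by apply: subM => //; apply: subX => //; apply: sub_polyring => //; exists d.
have sumc (x : K) m (t : 'I_m -> K) : (forall i, exists n, polyring (phi @` A) x (x ^+ n * t i)) ->
    exists n, polyring (phi @` A) x (x ^+ n * \sum_i t i).
  have rx := polyring_subring x rI.
  elim: m t => [|m IH] t ht; first by exists 0%N; rewrite big_ord0 mulr0; apply: sub0.
  have [n1 h1] := ht ord0; have [n2 h2] := IH (fun i => t (lift ord0 i)) (fun i => ht (lift ord0 i)).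
  have px l := subX rx l (polyring_gen x rI).
  exists (n1 + n2)%N; rewrite big_ord_recl mulrDr; apply: subD => //.
    by rewrite exprD mulrAC mulrC; apply: subM.
  by rewrite exprD -mulrA; apply: subM.
have [n hn] : exists n, polyring (phi @` A) a (a ^+ n * z).
  apply: (laurent a b) => // _ [G hG <-]; rewrite horner_coef; apply: (sumc _ _) => i.
  by apply: (step a b) => //; exists 0%N; rewrite mul1r.
have [m hm] : exists n, polyring (phi @` A) b (b ^+ n * z).
  apply: (laurent b a) => //; first by rewrite mulrC.
  move=> _ [G hG <-]; rewrite horner_coef; apply: (sumc _ _) => i.
  have rbb := rb; have [H hH <-] := hG i; rewrite horner_coef.
  have [l hl] : exists n, polyring (phi @` A) b (b ^+ n * \sum_(j < size H) H`_j * a ^+ j).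
    apply: (sumc _ _) => j; apply: (step b a); first by rewrite mulrC.
    by exists 0%N; rewrite mul1r; apply: sub_polyring.
  by exists l; rewrite mulrA; apply: subM => //; apply: subX => //; apply: polyring_gen.
rewrite polyring_image in hn; rewrite polyring_image in hm.
case: hn hm => [f hf ef] [g hg eg].
pose M := (size f + m)%N.
(* From a^n z = f(a) and a = d/b, both f' and g times a power of X are polynomials with value b^M z
   at b, hence equal. So f_i d^(i-n) lies in A; this is the coefficient of b^(n-i) in z for i <
   n. *)
pose f' := \sum_(i < size f) (f`_i * d ^+ i / d ^+ n) *: 'X^(n + M - i).
have ef' : f' = g * 'X^(size f).
  apply: (ev_inj gb); rewrite evM evXn eg ev_sum.
  apply: (mulfI (expf_neq0 n a0)).
  have -> : a ^+ n * (b ^+ m * z * b ^+ size f) = (a ^+ n * z) * b ^+ M by rewrite /M exprD; ring.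
  rewrite -ef (evE a (leqnn _)) mulr_sumr mulr_suml; apply: eq_bigr => i _.
  rewrite evZ evXn fmorph_div rmorphM !rmorphXn -ab !exprMn.
  have le : (i <= n + M)%N by rewrite /M; have := ltn_ord i; lia.
  have -> : b ^+ M = b ^+ (n + M - i) * b ^+ i / b ^+ n.
    by rewrite -exprD subnK // exprD mulrC mulKf ?expf_neq0.
  by field; rewrite !expf_neq0.
have coefs (i : 'I_(size f)) : A (f`_i * d ^+ i / d ^+ n).
  have : A f'`_(n + M - i).
    by rewrite ef' coefMXn; case: ifP => _; [apply: sub0|apply: hg].
  rewrite coef_sum (bigD1 i) //= coefZ coefXn eqxx mulr1 big1 ?addr0 // => j ji.
  rewrite coefZ coefXn; case: eqP => [e|_]; rewrite ?mulr0 //.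
  have leM (l : 'I_(size f)) : (l <= n + M)%N.
    by rewrite addnA addnAC; apply: leq_trans (leq_addl _ _); apply: ltnW.
  by move: ji; rewrite -val_eqE /= (subn_inj_le (leM i) (leM j) e) eqxx.
have -> : z = \sum_(i < size f) phi f`_i * a ^+ i / a ^+ n.
  by rewrite -mulr_suml -(evE a (leqnn _)) ef mulrC mulKf ?expf_neq0.
have Ka l := subX rab l (sub_polyring b ra (polyring_gen a rI)).
have Kb l := subX rab l (polyring_gen b ra).
have Kc c : A c -> polyring (polyring (phi @` A) a) b (phi c).
  by move=> Ac; do 2!apply: sub_polyring => //; exists c.
apply: sub_sum => // i _; case: (leqP n i) => le.
  rewrite -(subnK le) exprD mulrA mulfK ?expf_neq0 //; apply: subM => //; exact: Kc.
have -> : phi f`_i * a ^+ i / a ^+ n = phi (f`_i * d ^+ i / d ^+ n) * b ^+ (n - i).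
  rewrite fmorph_div rmorphM !rmorphXn -ab !exprMn.
  have -> : b ^+ n = b ^+ (n - i) * b ^+ i by rewrite -exprD subnK // ltnW.
  by field; rewrite !expf_neq0.
by apply: subM => //; apply: Kc.
Qed.

End PolynomialRings.

(** * The affine curve E minus a point *)

Section AffineCurve.
Variables (k : closedFieldType) (F : fieldType) (iota : {rmorphism k -> F}).
Hypothesis hE : elliptic_curve iota.
Implicit Types (P Q : set F) (E : set F -> int).
Local Notation H0 := (global_sections iota).
Let hF : function_field_1 iota := proj1 hE.

Definition regular_off P (f : F) : Prop := forall Q, place iota Q -> Q <> P -> vge Q 0 f.

Lemma separate P Q E : place iota P -> place iota Q -> Q <> P -> divisor iota E ->
  (forall S, place iota S -> 0 <= E S) -> E Q = 0 ->
  exists2 c, c != 0 /\ ord Q c = 0 & forall S, place iota S -> S <> P -> E S <= ord S c.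
Proof.
move=> hP hQ nQ dE E0 EQ.
pose n := (`|degree iota E| + 2)%N.
have hn := divisor_mulpt n hP.
have hC := divisorD hn (divisorN dE).
have [|f fH [f0 e]] := section_exact hE hC hQ.
  by rewrite degreeD ?degreeN ?degree_mulpt //; [rewrite /n; lia|apply: divisorN].
have off S : S <> P -> point_divisor P S = 0 by rewrite /point_divisor => /eqP/negPf ->.
exists f; first by split=> //; rewrite e EQ off // mul0rn.
move=> S hS nS; have /(H0P hF)/(_ S hS) := fH.
by rewrite vge_neq0 // off // mul0rn add0r opprK.
Qed.

(** The local ring at Q is a localization of the affine ring of E minus P: c0 vanishes along the
    poles of a other than P but not at Q. *)
Lemma affine_fraction P Q a : place iota P -> place iota Q -> Q <> P -> vge Q 0 a ->
  exists c0 c1, [/\ c0 != 0, ord Q c0 = 0, regular_off P c0, regular_off P c1 & a = c1 / c0].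
Proof.
move=> hP hQ nQ ha; have [->|a0] := eqVneq a 0.
  exists 1, 0; split; rewrite ?oner_neq0 ?(ord_one hF hQ) ?mul0r //.
    by move=> S hS _; right; rewrite (ord_one hF hS).
  by move=> S _ _; left.
pose E S : int := if 0 <= ord S a then 0 else - ord S a.
have E0 S : 0 <= E S by rewrite /E; case: ifP => //; lia.
have dE : divisor iota E.
  have /divisorP[s [us sp s0]] := divisor_ord hF a0; apply/divisorP; exists s; split=> // S hS nS.
  by rewrite /E s0 ?lexx.
have EQ : E Q = 0 by move: ha; rewrite vge_neq0 // /E => ->.
have [c [c0 oc] hc] := separate hP hQ nQ dE (fun S _ => E0 S) EQ.
exists c, (c * a); split=> //.
- move=> S hS nS; right; exact: le_trans (E0 S) (hc S hS nS).
- move=> S hS nS; right; rewrite (ordM hF hS) //; have := hc S hS nS; rewrite /E.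
  by case: ifP; lia.
- by rewrite mulrAC divff // mul1r.
Qed.

(** Weierstrass coordinates generate the affine ring: every n >= 2 is 2 i + 3 j, so leading terms
    are removed until a constant remains, pole order 1 being impossible. *)
Lemma gen_by_two P (A : set F) x2 x3 : place iota P -> subring A -> range iota `<=` A ->
  A x2 -> A x3 -> regular_off P x2 -> regular_off P x3 ->
  x2 != 0 -> ord P x2 = - 2 -> x3 != 0 -> ord P x3 = - 3 ->
  forall f, regular_off P f -> A f.
Proof.
move=> hP rA kA A2 A3 r2 r3 x20 o2 x30 o3 f rf.
have [n hn] : exists n : nat, vge P (- n%:Z) f by exists `|ord P f|%N; right; lia.
elim: n f rf hn => [|n IH] f rf hf.
  apply: kA; apply/(const_H0 hF)/(H0P hF) => Q hQ; rewrite oppr0.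
  by have [->//|nQ] := pselect (Q = P); apply: rf.
have [n0|n1] := posnP n.
  rewrite {}n0 in hf IH.
  apply: kA; apply: (Hn1_const hE hP); apply/(HnP hE hP); split=> // Q hQ nQ; exact: rf.
have [i [j e]] : exists i j, (2 * i + 3 * j = n.+1)%N.
  have := odd_double_half n.+1; case o: (odd n.+1) => /= e.
    by exists (n.+1./2 - 1)%N, 1%N; lia.
  by exists n.+1./2, 0%N; lia.
pose g := x2 ^+ i * x3 ^+ j.
have g0 : g != 0 by rewrite mulf_neq0 ?expf_neq0.
have og : ord P g = - n.+1%:Z.
  by rewrite (ordM hF hP) ?expf_neq0 // !(ordX hF hP) // o2 o3 !mulrn_int; lia.
have Ag : A g by apply: subM => //; apply: subX.
have [a ha] := vge_residue hF hP hf g0 og.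
rewrite -[f](subrK (iota a * g)); apply: subD => //; last by apply: subM => //; apply: kA; exists a.
apply: IH; last by apply: vge_le ha; lia.
move=> Q hQ nQ; apply: (vgeB hF hQ); first exact: rf.
apply: (vgeZ hF hQ); rewrite -[0]addr0; apply: (vgeM hF hQ).
  by rewrite -(mul0rn _ i); apply: (vgeX hF hQ); apply: r2.
by rewrite -(mul0rn _ j); apply: (vgeX hF hQ); apply: r3.
Qed.

End AffineCurve.

(** * The cone, its charts and the modification they form *)

Section Cone.
Variables (k : closedFieldType) (F : fieldType) (iota : {rmorphism k -> F}).
Hypothesis hE : elliptic_curve iota.
Let hF : function_field_1 iota := proj1 hE.
Variables (K : fieldType) (phi : {rmorphism F -> K}) (T : K) (gT : generates phi T).
Variables (P0 : set F) (hP0 : place iota P0) (q : nat) (q2 : (1 < q)%N).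
Implicit Types (V C : set K) (P Q : set F).
Local Notation Hn n := (Hn iota P0 n%N).

Definition cone : set K := [set ev phi T f | f in [set f : {poly F} | forall n, Hn n f`_n]].

Lemma cone_mono n f : Hn n f -> cone (phi f * T ^+ n).
Proof.
move=> fH; exists (f *: 'X^n); last by rewrite evZ evXn.
move=> m /=; rewrite coefZ coefXn; case: eqP => [->|_]; rewrite ?mulr1 //.
by rewrite mulr0; have [] := Hn_sub hE P0 m.
Qed.

Lemma cone_min C : subring C -> (forall n f, Hn n f -> C (phi f * T ^+ n)) -> cone `<=` C.
Proof.
move=> rC h _ [f fH <-]; rewrite (evE phi T (leqnn _)); apply: sub_sum => // i _.
exact: h.
Qed.

Lemma coneT : cone T.
Proof.
rewrite -[T]mul1r -(rmorph1 phi) -[T]expr1; apply: cone_mono.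
by apply: (Hn_mono hE (leq0n 1)); apply/(Hn0 hE P0); exists 1; rewrite ?rmorph1.
Qed.

Lemma cone_const a : cone (phi (iota a)).
Proof.
by rewrite -[phi _]mulr1 -(expr0 T); apply: cone_mono; apply/(Hn0 hE P0); exists a.
Qed.

Lemma cone_subring : subring cone.
Proof.
apply/subringP; split.
- by have := cone_const 1; rewrite !rmorph1.
- move=> _ _ [f hf <-] [g hg <-]; exists (f - g); last by rewrite evD evN.
  by move=> n /=; rewrite coefB; apply: subspaceB (hf n) (hg n); apply: Hn_sub.
- move=> _ _ [f hf <-] [g hg <-]; exists (f * g); last by rewrite evM.
  move=> n /=; rewrite coefM; apply/(HnE hE) => Q hQ; apply: (vge_sum hF hQ) => i _.
  have /(HnE hE)/(_ Q hQ) h1 := hf i; have /(HnE hE)/(_ Q hQ) h2 := hg (n - i)%N.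
  have := vgeM hF hQ h1 h2; rewrite -opprD -mulrnDr subnKC //.
  by rewrite -ltnS.
Qed.

(* The local ring of E at the image of the center of V; it is F at the generic point. *)
Definition VF V : set F := [set f | V (phi f)].

Lemma VF_val V : valuation_ring V -> valuation_ring (VF V).
Proof.
move=> [rV dV]; split; last by move=> x; rewrite /VF /= fmorphV; apply: dV.
apply/subringP; split; rewrite /VF /=; first by rewrite rmorph1; apply: sub1.
- by move=> x y; rewrite rmorphB; apply: subB.
- by move=> x y; rewrite rmorphM; apply: subM.
Qed.

Section Center.
Variables (V : set K) (vV : valuation_ring V) (RV : cone `<=` V).
Let rV := val_sub vV.

Lemma VF_const : range iota `<=` VF V.
Proof. by move=> _ [a _ <-]; apply: RV; apply: cone_const. Qed.

Lemma VF_place : VF V <> setT -> place iota (VF V).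
Proof. by move=> n; split=> //; [apply: VF_val|apply: VF_const]. Qed.

Lemma VT : V T. Proof. exact: RV coneT. Qed.

Lemma VF_fraction P a : place iota P -> VF V <> P -> V (phi a) ->
  exists c0 c1, [/\ regular_off iota P c0, regular_off iota P c1, unit_in V (phi c0) & a = c1 / c0].
Proof.
move=> hP nP Va.
have done Q : place iota Q -> Q <> P -> vge Q 0 a -> (forall x, x != 0 -> ord Q x = 0 -> V (phi x) /\ V (phi x^-1)) ->
    exists c0 c1, [/\ regular_off iota P c0, regular_off iota P c1, unit_in V (phi c0) & a = c1 / c0].
  move=> hQ nQ aQ hu; have [c0 [c1 [c00 oc r0 r1 e]]] := affine_fraction hE hP hQ nQ aQ.
  exists c0, c1; split=> //; have [h1 h2] := hu c0 c00 oc.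
  by split; rewrite ?fmorph_eq0 // -fmorphV.
have [eT|nT] := pselect (VF V = setT); last first.
  have hV := VF_place nT; apply: (done (VF V)) => // [|x x0 ox]; first exact/(place_ord hF hV).
  split; apply/(place_ord hF hV); right; rewrite ?ox //.
  by rewrite (ordV hF hV) // ox.
have all x : V (phi x) by have : VF V x by rewrite eT.
have [Q hQ nQ] := other_place hE hP.
have [//|aQ] := pselect (vge Q 0 a); first by move=> aQ; apply: (done Q).
have a0 : a != 0 by apply/eqP => e; apply: aQ; left.
have aQ' : vge Q 0 a^-1.
  right; rewrite (ordV hF hQ) //.
  have : ~~ (0 <= ord Q a) by apply/negP => h; apply: aQ; right.
  lia.
have [c0 [c1 [c00 _ r0 r1 e]]] := affine_fraction hE hP hQ nQ aQ'.
have c10 : c1 != 0 by apply/eqP => z; move: a0; rewrite -invr_eq0 e z mul0r eqxx.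
exists c1, c0; split=> //; first by split; rewrite ?fmorph_eq0 // -fmorphV.
by rewrite -[a]invrK e invf_div.
Qed.

End Center.

Variables (P1 : set F) (hP1 : place iota P1) (nP1 : P1 <> P0).
Variables (w : F) (ow : ord P0 w = 1) (w0 : w != 0) (wreg : regular_off iota P1 w).

Let pw0 : phi w != 0. Proof. by rewrite fmorph_eq0. Qed.
Let T0 : T != 0. Proof. exact: generates_neq0 gT. Qed.
Let rP0 : subring P0. Proof. exact: place_sub hP0. Qed.
Let P0w n : P0 (w ^+ n).
Proof. by apply/(place_ord hF hP0); right; rewrite (ordX hF hP0) // ow; lia. Qed.

(** The coefficients are taken in a whole local ring of E, or in F itself when V is trivial on F.
    This makes normality easy to prove; finite generation over the cone is only recovered for the
    localization at V. *)
Definition chart V : set K :=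
  if `[< VF V = P0 >] then
    if `[< V (T / phi w ^+ q) >] then polyring (phi @` P0) (T / phi w ^+ q)
    else polyring (polyring (phi @` P0) (T / phi w)) (phi w ^+ q / T)
  else polyring (phi @` VF V) T.

Definition Y V : set K := loc V (chart V).

Lemma chart_off V : VF V <> P0 -> chart V = polyring (phi @` VF V) T.
Proof. by rewrite /chart => n; rewrite asboolF. Qed.

Lemma chart_1 V : VF V = P0 -> V (T / phi w ^+ q) ->
  chart V = polyring (phi @` P0) (T / phi w ^+ q).
Proof. by move=> e h; rewrite /chart asboolT // asboolT. Qed.

Lemma chart_2 V : VF V = P0 -> ~ V (T / phi w ^+ q) ->
  chart V = polyring (polyring (phi @` P0) (T / phi w)) (phi w ^+ q / T).
Proof. by move=> e h; rewrite /chart asboolT // asboolF. Qed.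

Let rimg : subring (phi @` P0). Proof. exact: image_subring. Qed.

Lemma Hn_P0 n f : Hn n f -> P0 (f * w ^+ n).
Proof.
move=> /(HnP hE hP0)[h _]; apply/(place_ord hF hP0); rewrite -(addNr n%:Z).
by apply: (vgeM hF hP0) => //; right; rewrite (ordX hF hP0) // ow natz.
Qed.

Lemma cone_sub_P0 C : subring C -> phi @` P0 `<=` C -> C (T / phi w) -> cone `<=` C.
Proof.
move=> rC hP hT; apply: cone_min => // n f fH.
have -> : phi f * T ^+ n = phi (f * w ^+ n) * (T / phi w) ^+ n.
  by rewrite rmorphM rmorphXn expr_div_n; field; rewrite expf_neq0.
by apply: subM => //; [apply: hP; exists (f * w ^+ n) => //; apply: Hn_P0|apply: subX].
Qed.

Lemma Tw_chart1 C : subring C -> phi @` P0 `<=` C -> C (T / phi w ^+ q) -> C (T / phi w).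
Proof.
move=> rC hP hT; have -> : T / phi w = phi (w ^+ q.-1) * (T / phi w ^+ q).
  by rewrite rmorphXn -[X in _ / _ ^+ X](prednK (ltnW q2)) exprS; field; rewrite expf_neq0.
by apply: subM => //; apply: hP; exists (w ^+ q.-1).
Qed.

Section Charts.
Variables (V : set K) (vV : valuation_ring V) (RV : cone `<=` V).
Let rV := val_sub vV.

(** No section with a simple pole exists in degree 1, but one with a double pole in degree 2 shows
    that the square of T/w lies in V, and V is integrally closed. *)
Lemma V_Tw : VF V = P0 -> V (T / phi w).
Proof.
move=> e; have [f fH [f0 of_]] := pole_section hE hP0 (isT : (1 < 2)%N).
have Px : P0 (f * w ^+ 2)^-1.
  apply/(place_ord hF hP0); right; rewrite (ordV hF hP0) ?mulf_neq0 ?expf_neq0 //.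
  by rewrite (ordM hF hP0) ?expf_neq0 // (ordX hF hP0) // of_ ow.
have V2 : V ((T / phi w) ^+ 2).
  have -> : (T / phi w) ^+ 2 = phi (f * w ^+ 2)^-1 * (phi f * T ^+ 2).
    rewrite fmorphV rmorphM rmorphXn; have pf0 : phi f != 0 by rewrite fmorph_eq0.
    by field; rewrite pw0 pf0.
  apply: subM => //; last by apply: RV; apply: cone_mono.
  by have : VF V (f * w ^+ 2)^-1 by rewrite e.
have [//|h] := vV.2 (T / phi w).
have -> : T / phi w = (T / phi w) ^+ 2 * (T / phi w)^-1 by field; rewrite pw0 T0.
exact: subM.
Qed.

Lemma img_sub : phi @` VF V `<=` V. Proof. by move=> _ [x hx <-]. Qed.

Lemma V_wT : ~ V (T / phi w ^+ q) -> V (phi w ^+ q / T).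
Proof. by move=> n; have [//|] := vV.2 (T / phi w ^+ q); rewrite invf_div. Qed.

Lemma chart_subring : subring (chart V).
Proof.
have rVF : subring (phi @` VF V) by apply: image_subring; apply: val_sub; apply: VF_val.
rewrite /chart; case: asboolP => _; last exact: polyring_subring.
by case: asboolP => _; do !apply: polyring_subring.
Qed.

Lemma chart_sub : chart V `<=` V.
Proof.
have [e|n] := pselect (VF V = P0); last first.
  by rewrite chart_off //; apply: polyring_min => //; [apply: img_sub|apply: VT].
have hP : phi @` P0 `<=` V by rewrite -e; apply: img_sub.
have [h|h] := pselect (V (T / phi w ^+ q)).
  by rewrite chart_1 //; apply: polyring_min.
rewrite chart_2 //; apply: polyring_min => //; last exact: V_wT.
by apply: polyring_min => //; apply: V_Tw.
Qed.

Lemma cone_chart : cone `<=` chart V.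
Proof.
have [e|n] := pselect (VF V = P0); last first.
  rewrite chart_off //; have vVF := VF_val vV.
  have rI := image_subring phi (val_sub vVF).
  apply: cone_min => [|m f fH]; first exact: polyring_subring.
  apply: subM; first exact: polyring_subring.
    apply: sub_polyring => //; exists f => //.
    have [->//|nT] := pselect (VF V = setT); have hV := VF_place vV RV nT.
    by apply/(place_ord hF hV); have /(HnP hE hP0)[_] := fH; apply.
  by apply: subX; [apply: polyring_subring|apply: polyring_gen].
have [h|h] := pselect (V (T / phi w ^+ q)).
  rewrite chart_1 //; have rp := polyring_subring (T / phi w ^+ q) rimg.
  apply: cone_sub_P0 => //; first exact: sub_polyring.
  by apply: Tw_chart1 => //; [apply: sub_polyring|apply: polyring_gen].
rewrite chart_2 //; have rp := polyring_subring (T / phi w) rimg.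
apply: cone_sub_P0; first exact: polyring_subring.
  by move=> x hx; do 2!apply: sub_polyring => //.
by apply: sub_polyring => //; apply: polyring_gen.
Qed.

Lemma Y_subring : subring (Y V).
Proof. exact: loc_subring rV chart_subring. Qed.

Lemma chart_Y : chart V `<=` Y V. Proof. exact: sub_loc rV chart_subring. Qed.

Lemma Y_dominated : dominates V (Y V).
Proof. exact: dominates_loc rV chart_subring chart_sub. Qed.

Lemma Y_normal : integral_closure (Y V) `<=` Y V.
Proof.
apply: int_closed_loc => //; first exact: chart_subring.
have vP0 : valuation_ring P0 by case: hP0.
have gw : generates phi (T / phi w).
  by rewrite mulrC -fmorphV; apply: generates_scale => //; rewrite invr_eq0.
have gwq : generates phi (T / phi w ^+ q).
  by rewrite mulrC -rmorphXn -fmorphV; apply: generates_scale => //; rewrite invr_eq0 expf_neq0.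
have [e|n] := pselect (VF V = P0); last first.
  by rewrite chart_off //; apply: polyring_normal => //; apply: VF_val.
have [h|h] := pselect (V (T / phi w ^+ q)).
  by rewrite chart_1 //; apply: polyring_normal.
rewrite chart_2 //; apply: (cross_normal (d := w ^+ q.-1)) => //.
- by rewrite -invf_div; apply: generates_inv.
- by rewrite expf_neq0.
- by rewrite rmorphXn -[X in _ ^+ X / T](prednK (ltnW q2)) exprS; field; rewrite pw0 T0.
Qed.

Lemma VF_regular P x : regular_off iota P x -> VF V <> P -> V (phi x).
Proof.
move=> rx nP; have [eT|nT] := pselect (VF V = setT); first by have : VF V x by rewrite eT.
have hV := VF_place vV RV nT.
by have /(place_ord hF hV) : vge (VF V) 0 x by apply: rx.
Qed.

(** Two Weierstrass functions with poles at P suffice to put the whole local ring [VF V] in the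
    localization: they generate the affine ring of E minus P, of which [VF V] consists of
    fractions. *)
Lemma img_loc P C x2 x3 : place iota P -> subring C -> cone `<=` C -> VF V <> P ->
  regular_off iota P x2 -> regular_off iota P x3 ->
  x2 != 0 -> ord P x2 = - 2 -> x3 != 0 -> ord P x3 = - 3 ->
  C (phi x2) -> C (phi x3) -> phi @` VF V `<=` loc V C.
Proof.
move=> hP rC RC nP r2 r3 x20 o2 x30 o3 C2 C3 _ [a Va <-].
have [c0 [c1 [rc0 rc1 u ->]]] := VF_fraction vV RV hP nP Va.
have rA : subring [set f | C (phi f)].
  apply/subringP; split=> /=; first by rewrite rmorph1; apply: sub1.
  - by move=> x y; rewrite rmorphB; apply: subB.
  - by move=> x y; rewrite rmorphM; apply: subM.
have kA : range iota `<=` [set f | C (phi f)] by move=> _ [b _ <-]; apply: RC; apply: cone_const.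
have gen := gen_by_two hE hP rA kA C2 C3 r2 r3 x20 o2 x30 o3.
by exists (phi c1), (phi c0); split; rewrite ?fmorph_div //; apply: gen.
Qed.

Lemma loc_eq2 C C' : subring C -> subring C' -> C `<=` loc V C' -> C' `<=` loc V C ->
  loc V C = loc V C'.
Proof.
move=> rC rC' h h'; rewrite eqEsubset; split.
  by rewrite -(loc_idem rV rC'); apply: loc_mono.
by rewrite -(loc_idem rV rC); apply: loc_mono.
Qed.

Lemma Y_eq C : subring C -> C `<=` Y V -> chart V `<=` loc V C -> loc V C = Y V.
Proof. by move=> rC h1 h2; apply: loc_eq2 => //; apply: chart_subring. Qed.

End Charts.

Lemma sections_23 P : place iota P -> exists x2 x3, [/\ regular_off iota P x2, regular_off iota P x3,
  x2 != 0 /\ ord P x2 = - 2 & x3 != 0 /\ ord P x3 = - 3].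
Proof.
move=> hP; have [x2 h2 [x20 o2]] := pole_section hE hP (isT : (1 < 2)%N).
have [x3 h3 [x30 o3]] := pole_section hE hP (isT : (1 < 3)%N).
exists x2, x3; split=> //; first by have /(HnP hE hP)[_] := h2.
by have /(HnP hE hP)[_] := h3.
Qed.

Lemma modification_Y : modification cone [set Y V | V in [set V | valuation_ring V /\ cone `<=` V]].
Proof.
have [f2 [f3 [rf2 rf3 [f20 of2] [f30 of3]]]] := sections_23 hP0.
have [x2 [x3 [rx2 rx3 [x20 ox2] [x30 ox3]]]] := sections_23 hP1.
(* Besides P0, w may have other zeros. Inverting d, which vanishes at them at least as much as w,
   removes them from the charts that involve T/w and T/w^q. *)
have [d [d0 od] hd] : exists2 d, d != 0 /\ ord P0 d = 0 &
    forall S, place iota S -> S <> P1 -> S <> P0 -> ord S w <= ord S d.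
  pose E S : int := if `[< S = P0 \/ S = P1 >] then 0 else `|ord S w|.
  have dE : divisor iota E.
    have /divisorP[s [us sp s0]] := divisor_ord hF w0; apply/divisorP; exists s; split=> // S hS nS.
    by rewrite /E; case: asboolP => // _; rewrite s0.
  have [||c [c0 oc] hc] := @separate _ _ _ hE P1 P0 E hP1 hP0 (fun e => nP1 (esym e)) dE.
  - by move=> S _; rewrite /E; case: asboolP.
  - by rewrite /E asboolT //; left.
  exists c => // S hS n1 n0; apply: le_trans (hc S hS n1).
  by rewrite /E asboolF; [apply: ler_norm|case].
(* A valuation ring containing f2 is not centered over P0, and one containing x2 is not centered
   over P1. So the first chart covers the part off P0, and the other two cover the neighborhood of
   P0. *)
pose l1 := [:: phi f2; phi f3].
pose l2 := [:: phi x2; phi x3; phi d^-1; T / phi w ^+ q].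
pose l3 := [:: phi x2; phi x3; phi d^-1; T / phi w; phi w ^+ q / T].
have nP01 : P0 <> P1 by move=> e; apply: nP1.
have d_P0 : P0 d^-1 by apply/(place_ord hF hP0); right; rewrite (ordV hF hP0) // od.
have not_in P x V : place iota P -> ord P x = - 2 -> x != 0 -> V (phi x) -> VF V <> P.
  move=> hP ox x0 Vx e; have : P x by rewrite -e.
  by move/(place_ord hF hP); rewrite vge_neq0 // ox.
apply: (modification_of_charts (s := [:: l1; l2; l3])).
  move=> V vV RV; have rV := val_sub vV.
  have [e|n] := pselect (VF V = P0); last first.
    exists l1; first by rewrite inE eqxx.
    move=> x; rewrite /= !inE => /orP[] /eqP ->.
      exact: (VF_regular vV RV rf2).
    exact: (VF_regular vV RV rf3).
  have n1 : VF V <> P1 by rewrite e.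
  have h2 := VF_regular vV RV rx2 n1; have h3 := VF_regular vV RV rx3 n1.
  have hd' : V (phi d^-1) by have : VF V d^-1 by rewrite e.
  have [h|h] := pselect (V (T / phi w ^+ q)).
    exists l2; first by rewrite !inE eqxx orbT.
    by move=> x; rewrite /= !inE => /or4P[] /eqP ->.
  exists l3; first by rewrite !inE eqxx !orbT.
  move=> x; rewrite /= !inE => /or4P[/eqP ->|/eqP ->|/eqP ->|/orP[] /eqP ->] //.
    exact: V_Tw.
  exact: V_wT.
move=> V l vV RV; have rV := val_sub vV; rewrite !inE => hl lV.
pose C := adjoin cone [set` l]; have rC : subring C by apply: adjoin_subring.
have RC : cone `<=` C by apply: sub_adjoin.
have lC x : x \in l -> C x by move=> xl; apply: adjoin_gen.
have rL : subring (loc V C) by apply: loc_subring.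
have CL : C `<=` loc V C by apply: sub_loc.
have rY := Y_subring vV; have cY := chart_Y vV.
have coneY : cone `<=` Y V by apply: subset_trans cY; apply: cone_chart.
have imgY : VF V <> P0 -> phi @` VF V `<=` Y V.
  move=> n; apply: subset_trans cY; rewrite chart_off //; apply: sub_polyring.
  by apply: image_subring; apply: val_sub; apply: VF_val.
apply: Y_eq => //.
  apply: adjoin_min => // x; case/or3P: hl => /eqP el.
  - have n0 : VF V <> P0 by apply: (not_in _ f2) => //; apply: lV; rewrite el /= inE eqxx.
    rewrite el /= !inE => /orP[] /eqP ->; apply: imgY => //.
      by exists f2 => //; apply: lV; rewrite el /= inE eqxx.
    by exists f3 => //; apply: lV; rewrite el /= !inE eqxx orbT.
  - have Vl y : y \in l2 -> V y by move=> yl; apply: lV; rewrite el.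
    have n1 : VF V <> P1 by apply: (not_in _ x2) => //; apply: Vl; rewrite inE eqxx.
    have [e|n] := pselect (VF V = P0).
      have h : V (T / phi w ^+ q) by apply: Vl; rewrite !inE eqxx !orbT.
      have imgP : phi @` P0 `<=` Y V.
        by apply: subset_trans cY; rewrite chart_1 //; apply: sub_polyring.
      rewrite el /= !inE => /or4P[] /eqP ->; last by apply: cY; rewrite chart_1 //; apply: polyring_gen.
      + by apply: imgP; exists x2 => //; rewrite -e; apply: Vl; rewrite inE eqxx.
      + by apply: imgP; exists x3 => //; rewrite -e; apply: Vl; rewrite !inE eqxx orbT.
      + by apply: imgP; exists d^-1.
    have in_img y : V (phi y) -> Y V (phi y) by move=> hy; apply: imgY => //; exists y.
    rewrite el /= !inE => /or4P[] /eqP ->.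
    + by apply: in_img; apply: Vl; rewrite inE eqxx.
    + by apply: in_img; apply: Vl; rewrite !inE eqxx orbT.
    + by apply: in_img; apply: Vl; rewrite !inE eqxx !orbT.
    + have hw : V (phi w^-1).
        have [eT|nT] := pselect (VF V = setT); first by have : VF V w^-1 by rewrite eT.
        have hV := VF_place vV RV nT; have Vd : VF V d^-1 by apply: Vl; rewrite !inE eqxx !orbT.
        have /(place_ord hF hV) : vge (VF V) 0 w^-1; last by [].
        right; rewrite (ordV hF hV) //; move/(place_ord hF hV): Vd.
        by rewrite vge_neq0 ?invr_eq0 // (ordV hF hV) //; have := hd _ hV n1 n; lia.
      apply: subM => //; first exact/coneY/coneT.
      by rewrite -exprVn -fmorphV; apply: subX => //; apply: in_img.
  - have Vl y : y \in l3 -> V y by move=> yl; apply: lV; rewrite el.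
    have n1 : VF V <> P1 by apply: (not_in _ x2) => //; apply: Vl; rewrite inE eqxx.
    have hb : V (phi w ^+ q / T) by apply: Vl; rewrite !inE eqxx !orbT.
    have [e|n] := pselect (VF V = P0).
      have [imgP hTw hwT] : [/\ phi @` P0 `<=` Y V, Y V (T / phi w) & Y V (phi w ^+ q / T)].
        have [h|h] := pselect (V (T / phi w ^+ q)).
          have imgP : phi @` P0 `<=` Y V.
            by apply: subset_trans cY; rewrite chart_1 //; apply: sub_polyring.
          have hT : Y V (T / phi w ^+ q) by apply: cY; rewrite chart_1 //; apply: polyring_gen.
          split=> //; first exact: Tw_chart1.
          rewrite -invf_div; apply: loc_unit => //; first exact: chart_subring.
          by split=> //; rewrite ?mulf_neq0 ?invr_eq0 ?expf_neq0 // invf_div.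
        have rp := polyring_subring (T / phi w) rimg.
        have cY' := cY; rewrite chart_2 // in cY'; split.
        - by apply: subset_trans cY' => y hy; do 2!apply: sub_polyring => //.
        - by apply: cY'; apply: sub_polyring => //; apply: polyring_gen.
        - by apply: cY'; apply: polyring_gen.
      rewrite el /= !inE => /or4P[/eqP ->|/eqP ->|/eqP ->|/orP[] /eqP ->] //.
      + by apply: imgP; exists x2 => //; rewrite -e; apply: Vl; rewrite inE eqxx.
      + by apply: imgP; exists x3 => //; rewrite -e; apply: Vl; rewrite !inE eqxx orbT.
      + by apply: imgP; exists d^-1.
    have in_img y : V (phi y) -> Y V (phi y) by move=> hy; apply: imgY => //; exists y.
    have hw : V (phi w^-1).
      have [eT|nT] := pselect (VF V = setT); first by have : VF V w^-1 by rewrite eT.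
      have hV := VF_place vV RV nT; have Vd : VF V d^-1 by apply: Vl; rewrite !inE eqxx !orbT.
      have /(place_ord hF hV) : vge (VF V) 0 w^-1; last by [].
      right; rewrite (ordV hF hV) //; move/(place_ord hF hV): Vd.
      by rewrite vge_neq0 ?invr_eq0 // (ordV hF hV) //; have := hd _ hV n1 n; lia.
    have Vw : V (phi w) by apply: (VF_regular vV RV wreg).
    have VTi : V T^-1.
      have -> : T^-1 = phi w^-1 ^+ q * (phi w ^+ q / T).
        by rewrite fmorphV exprVn; field; rewrite T0 expf_neq0.
      by apply: subM => //; apply: subX.
    have YTi : Y V T^-1.
      apply: loc_unit => //; first exact: chart_subring.
        exact/coneY/coneT.
      by split=> //; apply: VT.
    rewrite el /= !inE => /or4P[/eqP ->|/eqP ->|/eqP ->|/orP[] /eqP ->].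
    + by apply: in_img; apply: Vl; rewrite inE eqxx.
    + by apply: in_img; apply: Vl; rewrite !inE eqxx orbT.
    + by apply: in_img; apply: Vl; rewrite !inE eqxx !orbT.
    + by apply: subM => //; [apply/coneY/coneT|rewrite -fmorphV; apply: in_img].
    + by apply: subM => //; apply: subX => //; apply: in_img.
have [n0|[e12 [h23 n1]]] : (VF V <> P0 /\ l = l1) \/ ((l = l2 \/ l = l3) /\
    [/\ C (phi x2), C (phi x3) & V (phi x2)] /\ VF V <> P1).
  case/or3P: hl => /eqP el; [left|right|right].
  - by split=> //; apply: (not_in _ f2) => //; apply: lV; rewrite el /= inE eqxx.
  - have Vx2 : V (phi x2) by apply: lV; rewrite el /= inE eqxx.
    split; first by left.
    by split; [split=> //; apply: lC; rewrite el /l1 /l2 /l3 !inE eqxx ?orbT|apply: (not_in _ x2)].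
  - have Vx2 : V (phi x2) by apply: lV; rewrite el /= inE eqxx.
    split; first by right.
    by split; [split=> //; apply: lC; rewrite el /l1 /l2 /l3 !inE eqxx ?orbT|apply: (not_in _ x2)].
- have [n el] := n0; rewrite chart_off //; apply: polyring_min => //; last by (apply: (CL); apply: (RC); apply: coneT).
  apply: (img_loc vV RV hP0 rC RC n rf2 rf3) => //; apply: lC; rewrite el /l1 /l2 /l3 !inE eqxx ?orbT //.
- have [C2 C3 _] := h23.
  have img : phi @` VF V `<=` loc V C by apply: (img_loc vV RV hP1 rC RC n1 rx2 rx3).
  have [e|n] := pselect (VF V = P0); last first.
    by rewrite chart_off //; apply: polyring_min => //; (apply: (CL); apply: (RC); apply: coneT).
  rewrite e in img; have [h|h] := pselect (V (T / phi w ^+ q)).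
    rewrite chart_1 //; apply: polyring_min => //.
    case: e12 => el; first by apply: (CL); apply: (lC); rewrite el /l2 !inE eqxx !orbT.
    have hb : loc V C (phi w ^+ q / T) by apply: (CL); apply: (lC); rewrite el /l1 /l2 /l3 !inE eqxx !orbT.
    have ub : unit_in V (phi w ^+ q / T).
      split; rewrite ?mulf_neq0 ?invr_eq0 ?expf_neq0 ?invf_div //.
      by apply: lV; rewrite el /= !inE eqxx !orbT.
    by have := loc_unit rV rC hb ub; rewrite invf_div.
  case: e12 => el; first by exfalso; apply: h; apply: lV; rewrite el /= !inE eqxx !orbT.
  rewrite chart_2 //; apply: polyring_min => //; last by apply: (CL); apply: (lC); rewrite el /l1 /l2 /l3 !inE eqxx !orbT.
  by apply: polyring_min => //; apply: (CL); apply: (lC); rewrite el /l1 /l2 /l3 !inE eqxx !orbT.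
Qed.

End Cone.

(** * Flattening *)

Section FrobeniusSpan.
Variables (K : fieldType) (q : nat) (hqK : [pchar K].-nat q).
Let q0 : (0 < q)%N. Proof. by have /andP[] := hqK. Qed.

Definition fspan (B : set K) (I : finType) (e : I -> K) : set K :=
  [set x | exists2 c : I -> K, (forall i, B (c i)) & x = \sum_i c i ^+ q * e i].

Section Closure.
Variables (B : set K) (rB : subring B) (I : finType) (e : I -> K).

Lemma fspan_gen i : fspan B e (e i).
Proof.
exists (fun j => (j == i)%:R) => [j|]; first by case: eqP => _; [apply: sub1|apply: sub0].
rewrite (bigD1 i) //= eqxx expr1n mul1r big1 ?addr0 // => j /negPf ->.
by rewrite expr0n gtn_eqF // mul0r.
Qed.

Lemma fspan0 : fspan B e 0.
Proof.
exists (fun=> 0) => [_|]; first exact: sub0.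
by rewrite big1 // => i _; rewrite expr0n gtn_eqF // mul0r.
Qed.

Lemma fspanD x y : fspan B e x -> fspan B e y -> fspan B e (x + y).
Proof.
move=> [c hc ->] [d hd ->]; exists (fun i => c i + d i) => [i|]; first exact: subD.
by rewrite -big_split; apply: eq_bigr => i _ /=; rewrite exprDn_pchar // mulrDl.
Qed.

Lemma fspanM a x : B a -> fspan B e x -> fspan B e (a ^+ q * x).
Proof.
move=> Ba [c hc ->]; exists (fun i => a * c i) => [i|]; first exact: subM.
by rewrite mulr_sumr; apply: eq_bigr => i _; rewrite exprMn mulrA.
Qed.

Lemma fspan_sum J (r : seq J) (Q : pred J) (v : J -> K) :
  (forall j, Q j -> fspan B e (v j)) -> fspan B e (\sum_(j <- r | Q j) v j).
Proof. by move=> h; apply: big_ind => //; [apply: fspan0|apply: fspanD]. Qed.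

End Closure.

Implicit Types (R B Y : set K).

Lemma det_in B n (A : 'M[K]_n) : subring B -> (forall i j, B (A i j)) -> B (\det A).
Proof.
move=> rB hA; apply: sub_sum => // s _; apply: subM => //; last exact: sub_prod.
by apply: subX => //; apply: subN => //; apply: sub1.
Qed.

Lemma torsionfree_gen R B r : subring B -> R r -> torsionfree_pullback q R B r.
Proof.
move=> rB Rr; exists 1%N, (fun=> 1), (fun=> r); split=> //; first by move=> _; apply: sub1.
by rewrite big_ord1 expr1n mul1r.
Qed.

Lemma basis_free_pushforward R B (I : finType) (e : I -> K) : subring B ->
  (forall i, R (e i)) -> kfree_fin (frob hqK) e -> R `<=` fspan B e ->
  free_pushforward q B (torsionfree_pullback q R B).
Proof.
move=> rB Re fe sR; exists #|I|, (fun i => e (enum_val i)); split.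
  by move=> i; apply: torsionfree_gen.
move=> x [n [c [m [Bc Rm ->]]]].
have : fspan B e (\sum_i c i ^+ q * m i).
  by apply: (fspan_sum rB) => i _; apply: (fspanM rB) => //; apply: sR.
move=> [d Bd ed]; exists (fun i => d (enum_val i)); split.
  split=> [i|] //; rewrite ed; apply: etrans (esym (comb_enum (frob hqK) e (fun i => d (enum_val i)))).
  by apply: eq_bigr => i _; rewrite enum_rankK.
move=> d' [_ ed']; apply/funext => i.
refine (kfree_uniq (kfree_enum fe) (c := fun i => d (enum_val i)) (d := d') _ i).
rewrite -[RHS]/(\sum_i d' i ^+ q * e (enum_val i)) -ed' ed.
by rewrite comb_enum; apply: eq_bigr => j _; rewrite enum_rankK.
Qed.

(* Over a domain dominated by Y, a basis of the pullback to B becomes one of the pullback to Y;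
   the determinant of the change of basis lies in B and is a unit of Y, hence of B. *)
Lemma coordinates_in R B Y (I : finType) (e : I -> K) : subring B -> subring Y -> R `<=` B ->
  (forall z, exists a b, [/\ R a, R b, b != 0 & z = a / b]) ->
  dominates Y B -> free_pushforward q B (torsionfree_pullback q R B) ->
  (forall i, R (e i)) -> kfree_fin (frob hqK) e -> R `<=` fspan Y e ->
  forall r c, R r -> r = \sum_i c i ^+ q * e i -> forall i, B (c i).
Proof.
move=> rB rY RB hK [BY nBY] [n [m [Nm hm]]] Re fe sR.
have coord x : R x -> exists2 c : 'I_n -> K, (forall i, B (c i)) & x = comb (frob hqK) c m.
  by move=> Rx; have [c [[Bc ex] _]] := hm x (torsionfree_gen rB Rx); exists c.
(* Uniqueness of coordinates is only known over B; a relation over K is multiplied by a common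
   denominator in R. *)
have fm : kfree (frob hqK) m.
  move=> c hc i.
  have [b [b0 Rb hb]] : exists b, [/\ b != 0, R b & forall i, B (b * c i)].
    elim: (n) c {hc i m Nm hm coord} => [|l IH] c.
      have [_ [b [_ Rb b0 _]]] := hK 1; exists b; split=> // -[] //.
    have [b [b0 Rb hb]] := IH (fun i => c (lift ord0 i)).
    have [a1 [b1 [Ra1 Rb1 b10 e1]]] := hK (c ord0).
    have [x [y [Rx Ry y0 ey]]] := hK ((b * b1)^-1).
    have bb0 : b * b1 != 0 by rewrite mulf_neq0.
    have x0 : x != 0 by apply/eqP => z; move: ey; rewrite z mul0r => /eqP; rewrite invr_eq0 (negPf bb0).
    have eyx : y = b * b1 * x.
      have : (b * b1)^-1 * y = x by rewrite ey divfK.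
      by move=> <-; rewrite mulrA mulfV // mul1r.
    exists y; split=> // i; case: (unliftP ord0 i) => [j ->|->].
      rewrite eyx; have -> : b * b1 * x * c (lift ord0 j) = x * (b1 * (b * c (lift ord0 j))) by ring.
      by apply: subM => //; [apply: RB|apply: subM => //; apply: RB].
    rewrite eyx e1; have -> : b * b1 * x * (a1 / b1) = b * x * a1 by field.
    by apply: subM => //; [apply: subM => //; apply: RB|apply: RB].
  have h0 : torsionfree_pullback q R B 0.
    by exists 0%N, (fun=> 0), (fun=> 0); split; rewrite ?big_ord0 // => -[].
  have [d [_ ud]] := hm 0 h0.
  have u1 : d = fun i => b * c i.
    apply: ud; split=> //; rewrite -[RHS]/(comb (frob hqK) (fun i => b * c i) m).
    by rewrite combZ hc mulr0.
  have u2 : d = fun=> 0.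
    apply: ud; split=> [_|]; first exact: sub0.
    by rewrite big1 // => l _; rewrite expr0n gtn_eqF // mul0r.
  have : b * c i = 0 by rewrite -[LHS]/((fun i => b * c i) i) -u1 u2.
  by move/eqP; rewrite mulf_eq0 (negPf b0) => /eqP.
pose N := #|I|; pose e' (i : 'I_N) := e (enum_val i).
have fe' : kfree (frob hqK) e' by apply: kfree_enum.
have /choice[M hM] : forall i : 'I_N, exists c : 'I_n -> K, (forall l, B (c l)) /\ e' i = comb (frob hqK) c m.
  by move=> i; have [c Bc ec] := coord (e' i) (Re _); exists c.
have sY x : torsionfree_pullback q R B x -> exists c : 'I_N -> K,
    (forall l, Y (c l)) /\ x = comb (frob hqK) c e'.
  move=> [l [c [r [Bc Rr ->]]]].
  have : fspan Y e (\sum_i c i ^+ q * r i).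
    by apply: (fspan_sum rY) => i _; apply: (fspanM rY); [apply: BY|apply: sR].
  move=> [d Yd ed]; exists (fun i => d (enum_val i)); split=> //.
  by rewrite ed comb_enum; apply: eq_bigr => i _; rewrite enum_rankK.
have /choice[Lc hL] : forall i : 'I_n, exists c : 'I_N -> K, (forall l, Y (c l)) /\ m i = comb (frob hqK) c e'.
  by move=> i; apply: sY.
pose MM : 'M[K]_(N, n) := \matrix_(i, l) M i l.
pose LL : 'M[K]_(n, N) := \matrix_(i, l) Lc i l.
have mulE a b d (X : 'M[K]_(a, b)) (Z : 'M[K]_(b, d)) (u : 'I_a -> K) (v : 'I_b -> K) (t : 'I_d -> K) :
    (forall i, u i = comb (frob hqK) (X i) v) -> (forall i, v i = comb (frob hqK) (Z i) t) ->
    forall i, u i = comb (frob hqK) ((X *m Z) i) t.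
  move=> h1 h2 i; rewrite h1 /comb; under eq_bigr => l _ do rewrite h2 /comb mulr_sumr.
  rewrite exchange_big; apply: eq_bigr => l _ /=; rewrite mxE (rmorph_sum (frob hqK)) mulr_suml.
  by apply: eq_bigr => s _; rewrite rmorphM /= mulrA.
have eM i : e' i = comb (frob hqK) (MM i) m.
  by have [_ ->] := hM i; apply: eq_bigr => l _; rewrite mxE.
have eL i : m i = comb (frob hqK) (LL i) e'.
  by have [_ ->] := hL i; apply: eq_bigr => l _; rewrite mxE.
have one_of a (v : 'I_a -> K) (X : 'M[K]_a) : kfree (frob hqK) v ->
    (forall i, v i = comb (frob hqK) (X i) v) -> X = 1%:M.
  move=> fv hv; apply/matrixP => i l; rewrite mxE.
  rewrite eq_sym; apply: (kfree_uniq fv (c := X i) (d := fun l => (l == i)%:R)).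
  by rewrite comb_delta -hv.
have ML : MM *m LL = 1%:M by apply: (one_of _ e') => //; apply: mulE eM eL.
have LM : LL *m MM = 1%:M by apply: (one_of _ m) => //; apply: mulE eL eM.
have eN : n = N by apply/eqP; rewrite eqn_leq (mulmx1_min LM) (mulmx1_min ML).
subst n.
have BM i l : B (MM i l) by rewrite mxE; have [] := hM i.
have dM : B (\det MM) by apply: det_in.
have dL : Y (\det LL) by apply: det_in => // i l; rewrite mxE; have [] := hL i.
have dd : \det MM * \det LL = 1 by rewrite -det_mulmx ML det1.
have d0 : \det MM != 0.
  by apply/eqP => z; move: dd; rewrite z mul0r => /esym/eqP; rewrite oner_eq0.
have [_ _ Bd] : unit_in B (\det MM).
  apply/unit_nonunits => // /nBY; apply/unit_nonunits; first exact: BY.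
  split=> //; first exact: BY.
  suff -> : (\det MM)^-1 = \det LL by [].
  by apply: (mulfI d0); rewrite dd mulfV.
have eLL : LL = (\det MM)^-1 *: \adj MM.
  rewrite -[LL]mulmx1; have -> : 1%:M = (\det MM)^-1 *: (MM *m \adj MM).
    by rewrite mul_mx_adj scale_scalar_mx mulVf.
  by rewrite -scalemxAr mulmxA LM mul1mx.
have BL i l : B (LL i l).
  rewrite eLL !mxE; apply: subM => //; rewrite /cofactor; apply: subM => //.
    by apply: subX => //; apply: subN => //; apply: sub1.
  by apply: det_in => // i' l'; rewrite !mxE; have [] := hM (lift l i').
move=> r c Rr er i; have [d Bd' ed] := coord r Rr.
have er' : r = comb (frob hqK) ((\row_l d l *m LL) 0) e'.
  have h1 (i1 : 'I_1) : r = comb (frob hqK) ((\row_l d l) i1) m.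
    by rewrite ed; apply: eq_bigr => l _; rewrite mxE.
  exact: (mulE _ _ _ (\row_l d l) LL (fun=> r) m e' h1 eL 0).
have ec : r = comb (frob hqK) (fun l => c (enum_val l)) e'.
  by rewrite comb_enum er; apply: eq_bigr => l _; rewrite enum_rankK.
have := kfree_uniq fe' (etrans (esym ec) er') (enum_rank i).
rewrite enum_rankK => ->; rewrite mxE; apply: sub_sum => // l _.
by rewrite mxE; apply: subM.
Qed.

End FrobeniusSpan.

(** * Frobenius bases of the cone over a chart *)

Section Bases.
Variables (k : closedFieldType) (F : fieldType) (iota : {rmorphism k -> F}).
Hypothesis hE : elliptic_curve iota.
Let hF : function_field_1 iota := proj1 hE.
Variables (K : fieldType) (phi : {rmorphism F -> K}) (T : K) (gT : generates phi T).
Variables (P0 : set F) (hP0 : place iota P0) (q : nat) (q2 : (1 < q)%N).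
Variables (hq : [pchar F].-nat q) (hqK : [pchar K].-nat q).
Hypothesis no_tors : forall P f, place iota P -> P <> P0 -> f != 0 ->
  ~ (forall Q, place iota Q -> ord Q f = (point_divisor P Q - point_divisor P0 Q) *+ q).
Variables (w : F) (ow : ord P0 w = 1) (w0 : w != 0).
Implicit Types (V : set K) (P : set F).
Local Notation Hn n := (Hn iota P0 n%N).
Local Notation cone := (cone iota phi T P0).
Local Notation chart := (chart phi T P0 q w).
Local Notation fr := (frob hq).
Let q0 : (0 < q)%N. Proof. exact: ltnW. Qed.
Let T0 : T != 0. Proof. exact: generates_neq0 gT. Qed.
Let pw0 : phi w != 0. Proof. by rewrite fmorph_eq0. Qed.

(** A q-th power has only exponents divisible by q, so the residues of the degree modulo q do not
    mix. *)
Lemma pexp_coef (h : {poly F}) (i i' : 'I_q) l :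
  (h ^+ q * 'X^i')`_(i + l * q)%N = if i == i' then h`_l ^+ q else 0.
Proof.
have hp : [pchar {poly F}].-nat q.
  by apply: sub_in_pnat hq => p _; rewrite pchar_poly.
have e : h ^+ q = \sum_(m < size h) (h`_m ^+ q) *: 'X^(m * q).
  rewrite -{1}[h]coefK poly_def.
  have -> : forall n (u : 'I_n -> {poly F}), (\sum_m u m) ^+ q = \sum_m (u m) ^+ q.
    move=> n u; apply: (big_morph (fun x => x ^+ q)) => [x y|]; first exact: exprDn_pchar.
    by rewrite expr0n gtn_eqF.
  by apply: eq_bigr => m _; rewrite exprZn -exprM.
rewrite e mulr_suml coef_sum.
have ce (m : 'I_(size h)) : (h`_m ^+ q *: 'X^(m * q) * 'X^i')`_(i + l * q)%N =
    if (i == i') && (m == l :> nat) then h`_l ^+ q else 0.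
  rewrite -scalerAl -exprD coefZ coefXn.
  have -> : (i + l * q == m * q + i')%N = (i == i') && (m == l :> nat).
    rewrite -val_eqE /=; have h1 := ltn_ord i; have h2 := ltn_ord i'.
    apply/eqP/andP => [e1|[/eqP -> /eqP ->]]; last by rewrite addnC.
    have e2 : i = i' :> nat.
      by have := congr1 (modn^~ q) e1; rewrite /= addnC !modnMDl !modn_small.
    split; apply/eqP => //; apply/eqP; rewrite -(eqn_pmul2r q0); apply/eqP.
    by move: e1; rewrite e2; lia.
  by case: ifP => [/andP[_ /eqP ->]|_]; rewrite ?mulr1 ?mulr0.
under eq_bigr do rewrite ce.
case: eqP => [_|_] /=; last by rewrite big1.
case: (ltnP l (size h)) => [lt|le].
  by rewrite (bigD1 (Ordinal lt)) //= eqxx big1 ?addr0 // => m; rewrite -val_eqE => /negPf ->.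
rewrite big1 ?nth_default ?expr0n ?gtn_eqF // => m _.
by case: eqP => // e1; have := ltn_ord m; rewrite e1 ltnNge le.
Qed.

Definition monomial_basis (a : 'I_q -> 'I_q -> F) (s : 'I_q -> 'I_q -> nat) (x : 'I_q * 'I_q) : K :=
  phi (a x.1 x.2) * T ^+ (x.1 + q * s x.1 x.2)%N.

(** After clearing denominators, the coefficient of degree i + l q of a relation involves only the
    class i and is a relation over F^q between the functions [a i]. *)
Lemma monomial_free a s : (forall i, kfree fr (a i)) -> kfree_fin (frob hqK) (monomial_basis a s).
Proof.
move=> fa c hc.
have /choice[nd hnd] : forall x, exists nd : {poly F} * {poly F}, nd.2 != 0 /\ c x = ev phi T nd.1 / ev phi T nd.2.
  by move=> x; have [f [g [g0 e]]] := proj2 gT (c x); exists (f, g).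
pose g := \prod_x (nd x).2; pose f x := (nd x).1 * \prod_(y | y != x) (nd y).2.
have g0 : g != 0 by apply/prodf_neq0 => x _; have [] := hnd x.
have eg x : c x * ev phi T g = ev phi T (f x).
  have [d0 ->] := hnd x; rewrite /g (bigD1 x) //= !evM.
  by have h := ev_neq0 gT d0; field.
pose h x := f x * 'X^(s x.1 x.2).
have zero : \sum_x a x.1 x.2 *: (h x ^+ q * 'X^(x.1)) = 0.
  apply: (proj1 gT); rewrite ev_sum; transitivity (ev phi T g ^+ q * \sum_x frob hqK (c x) * monomial_basis a s x);
    last by rewrite hc mulr0.
  rewrite mulr_sumr; apply: eq_bigr => x _.
  rewrite evZ evM evexp evM !evXn -eg /monomial_basis /= /frob exprD exprM !exprMn -!exprM [(q * _)%N]mulnC.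
  by ring.
suff h0 x : h x = 0.
  move=> x; have := h0 x; rewrite /h => /eqP; rewrite mulf_eq0 (negPf (monic_neq0 (monicXn _ _))) orbF => /eqP fx0.
  by apply: (mulIf (ev_neq0 gT g0)); rewrite mul0r eg fx0 ev0.
case: x => i m; apply/polyP => l; rewrite coef0.
have := fa i (fun m => (h (i, m))`_l) _ m; apply.
have := congr1 (fun r : {poly F} => r`_(i + l * q)%N) zero; rewrite coef0 coef_sum => e.
transitivity (\sum_i' \sum_m' (a i' m' *: (h (i', m') ^+ q * 'X^i'))`_(i + l * q)%N); last first.
  by rewrite pair_bigA -[RHS]e; apply: eq_bigr => -[].
rewrite [RHS](bigD1 i) //= [X in _ = _ + X]big1 ?addr0 => [|i' i'i]; last first.
  by rewrite big1 // => m' _; rewrite coefZ pexp_coef eq_sym (negPf i'i) mulr0.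
by apply: eq_bigr => m' _; rewrite coefZ pexp_coef eqxx mulrC.
Qed.

(** The part of F_* of the cone in degrees congruent to i modulo q becomes free over the chart, with
    homogeneous basis a_m in degree i + q s_m. *)
Definition class_ok V (i : nat) (a : 'I_q -> F) (s : 'I_q -> nat) : Prop :=
  [/\ kfree fr a, forall m, Hn (i + q * s m) (a m) &
    forall l f, Hn (i + q * l) f ->
      fspan q (chart V) (fun m => phi (a m) * T ^+ (i + q * s m)%N) (phi f * T ^+ (i + q * l)%N)].

Section AtV.
Variables (V : set K) (vV : valuation_ring V) (RV : cone `<=` V).
Let rc : subring (chart V). Proof. exact: (chart_subring phi T hP0 q w vV). Qed.

Lemma chart_P0 : VF phi V = P0 -> phi @` P0 `<=` chart V /\ chart V (T / phi w).
Proof.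
move=> e; have rI : subring (phi @` P0) by apply: image_subring; apply: place_sub hP0.
have [h|h] := pselect (V (T / phi w ^+ q)).
  rewrite chart_1 //; have sI := sub_polyring (T / phi w ^+ q) rI; split=> //.
  apply: (Tw_chart1 hE gT hP0 q2 ow w0 _ sI); first exact: polyring_subring.
  exact: polyring_gen.
have rp := polyring_subring (T / phi w) rI.
rewrite chart_2 //; split; first by move=> x hx; do 2!apply: sub_polyring => //.
by apply: sub_polyring => //; apply: polyring_gen.
Qed.

(** Provides one place P at which a pole bound suffices for membership in the chart. If V is trivial
    on F any place will do, and one other than P0 is chosen to stay out of the exceptional case. *)
Lemma chart_elements : exists P, [/\ place iota P, P = P0 -> VF phi V = P0 &
  forall c n, vge P (- (point_divisor P0 P *+ n)) c -> chart V (phi c * T ^+ n)].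
Proof.
have off P c n : place iota P -> VF phi V <> P0 -> V (phi c) -> chart V (phi c * T ^+ n).
  move=> hP nV Vc; rewrite chart_off //.
  have rI : subring (phi @` VF phi V) by apply: image_subring; apply: val_sub; apply: VF_val.
  have rp := polyring_subring T rI; apply: subM => //.
    by apply: sub_polyring => //; exists c.
  by apply: subX => //; apply: polyring_gen.
have [eT|nT] := pselect (VF phi V = setT).
  have [P hP nP] := other_place hE hP0; exists P; split=> // c n _; apply: (off P) => //.
    by rewrite eT => e; case: hP0 => _ _; rewrite -e.
  by have : VF phi V c by rewrite eT.
have hV := VF_place hE vV RV nT; exists (VF phi V); split=> // c n.
have [e|nV] := pselect (VF phi V = P0); last first.
  rewrite /point_divisor; move/eqP/negPf: (nV) => ->; rewrite mul0rn oppr0 => /(place_ord hF hV) h.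
  exact: (off (VF phi V)).
rewrite e /point_divisor eqxx natz => hc; have [hP hT] := chart_P0 e.
have -> : phi c * T ^+ n = phi (c * w ^+ n) * (T / phi w) ^+ n.
  by rewrite rmorphM rmorphXn expr_div_n; field; rewrite expf_neq0.
apply: subM => //; last exact: subX.
apply: hP; exists (c * w ^+ n) => //; apply/(place_ord hF hP0); rewrite -(addNr n%:Z).
by apply: (vgeM hF hP0) => //; right; rewrite (ordX hF hP0) // ow natz.
Qed.

Lemma chart_const r : chart V (phi (iota r)).
Proof.
have [P [hP _ h]] := chart_elements; rewrite -[phi _]mulr1 -(expr0 T); apply: h.
by rewrite mulr0n oppr0; apply: vge_const.
Qed.

(** The local basis at P works over the chart. The last clause, in class 1, is what later produces a
    nonconstant function on E inside every local ring of FB. *)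
Lemma class_generic i : (i < q)%N -> ~ (VF phi V = P0 /\ i = 0%N) ->
  exists a s, class_ok V i a s /\ (i = 1%N -> exists f (C : 'I_q -> K) m c,
    [/\ Hn (1 + q) f,
        phi f * T ^+ (1 + q)%N = \sum_m C m ^+ q * (phi (a m) * T ^+ (i + q * s m)%N),
        C m = phi c & ~ range iota c]).
Proof.
move=> iq ni; have [P [hP eP hc]] := chart_elements.
have nPi : ~ (P = P0 /\ i = 0%N) by move=> [/eP e1 e2]; apply: ni.
have [M [a [ha aH aM]]] := local_basis hE hP0 hq no_tors hP iq nPi.
have da := local_basis_free hq hP ha.
have fa : kfree fr a := frob_free hE hP da.
pose s m : nat := ~~ M m.
have es m : (if M m then i else (i + q)%N) = (i + q * s m)%N.
  by rewrite /s; case: (M m); rewrite /= ?muln0 ?addn0 ?muln1.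
have aH' m : Hn (i + q * s m) (a m) by rewrite -es; apply: aH.
have oa m : ord P (a m) = m%:Z - point_divisor P0 P *+ (i + q * s m)%N.
  by rewrite -es; have [_] := ha m.
have a0 m : a m != 0 by have [] := ha m.
pose dl : int := point_divisor P0 P.
(* The orders of the a_m, up to the twist, lie in 0, ..., q - 1. Thus a pole bound on the terms
   c_m^q a_m, after division by q, loses less than one unit and gives the bound needed for c_m. *)
have coef l f c : Hn (i + q * l.+1) f -> f = comb fr c a ->
    forall m, vge P (- (dl *+ (l.+1 - s m))) (c m).
  move=> /(HnE hE)/(_ P hP) h1 ef m; rewrite ef in h1.
  have := frob_vge hE hq hP da h1 m.
  case: (eqVneq (c m) 0) => [->|c0]; first by left.
  rewrite !vge_neq0 ?mulf_neq0 ?expf_neq0 // (ordM hF hP) ?expf_neq0 // (ordX hF hP) // oa.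
  rewrite -/dl !mulrn_int; have := ltn_ord m.
  have -> : (l.+1 - s m)%N%:Z = l.+1%:Z - (s m)%:Z by rewrite /s; case: (M m) => /=; lia.
  rewrite !PoszD !PoszM; move: (ord P (c m)) (m : nat) (s m) => o m' s' h2 h3.
  suff : 0 < (o + dl * (l.+1%:Z - s'%:Z) + 1) * q%:Z.
    rewrite pmulr_lgt0 ?ltz_nat //; lia.
  have -> : (o + dl * (l.+1%:Z - s'%:Z) + 1) * q%:Z = o * q%:Z + (dl * (i%:Z + q%:Z * l.+1%:Z) - dl * (i%:Z + q%:Z * s'%:Z)) + q%:Z by ring.
  lia.
have expand l f c : f = comb fr c a ->
    phi f * T ^+ (i + q * l.+1)%N =
    \sum_m (phi (c m) * T ^+ (l.+1 - s m)) ^+ q * (phi (a m) * T ^+ (i + q * s m)%N).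
  move=> ->; rewrite (rmorph_sum phi) mulr_suml; apply: eq_bigr => m _.
  rewrite rmorphM /= frobE rmorphXn exprMn -exprM.
  have -> : (i + q * l.+1 = (l.+1 - s m) * q + (i + q * s m))%N.
    by rewrite /s; case: (M m) => /=; lia.
  by rewrite exprD; ring.
exists a, s; split.
  split=> // l f; case: l => [|l] fH.
    rewrite muln0 addn0 in fH *; have [c c0 ef] := aM f fH.
    have /choice[r hr] := @kroot k _ _ hq.
    exists (fun m => phi (iota (r (c m)))) => [m|]; first exact: chart_const.
    rewrite ef (rmorph_sum phi) mulr_suml; apply: eq_bigr => m _.
    case: (boolP (M m)) => Mm.
      by rewrite rmorphM -!rmorphXn /= hr /s Mm muln0 addn0 mulrA.
    rewrite c0 // !rmorph0 !mul0r; have : r 0 ^+ q == 0 by rewrite hr.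
    by rewrite expf_eq0 => /andP[_ /eqP ->]; rewrite !rmorph0 expr0n gtn_eqF // !mul0r.
  have [c ef] := frob_span hE fa f.
  exists (fun m => phi (c m) * T ^+ (l.+1 - s m)) => [m|]; first by apply: hc; apply: (coef l f).
  exact: expand.
(* If all coordinates in the shifted degrees were constant, the remaining one c_t would satisfy
   c_t^q in H^0((q + 1) P0), hence would have at most a simple pole and be constant too. Then H^0((q
   + 1) P0), of dimension q + 1, would lie in the k-span of the q functions a_m. *)
move=> i1; apply: contrapT => no.
have all_const f c : Hn (1 + q) f -> f = comb fr c a -> forall m, ~~ M m -> range iota (c m).
  move=> fH ef m nM; apply: contrapT => nc; apply: no.
  exists f, (fun m => phi (c m) * T ^+ (1 - s m)), m, (c m); split=> //.
    by have := expand 0%N f c ef; rewrite i1 muln1.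
  by rewrite /s nM subnn mulr1.
have const_a m : M m -> range iota (a m).
  move=> Mm; apply: (Hn1_const hE hP0); have := aH' m.
  by rewrite /s Mm muln0 addn0 i1.
have [t Mt] : exists t, M t.
  apply: contrapT => nM; have H1 : Hn i 1.
    by apply: (Hn_mono hE (leq0n i)); apply/(Hn0 hE P0); exists 1; rewrite ?rmorph1.
  have [c c0 e] := aM 1 H1; have := oner_neq0 F; rewrite e /comb big1 ?eqxx // => m _.
  by rewrite c0 ?rmorph0 ?mul0r //; apply/negP => Mm; apply: nM; exists m.
have uniqM m : M m -> m = t.
  move=> Mm; apply/eqP/negPn/negP => mt.
  have [x _ ex] := const_a m Mm; have [y _ ey] := const_a t Mt.
  have x0 : x != 0 by rewrite -(fmorph_eq0 iota) ex.
  have [r er] := @kroot k _ _ hq x; have [r' er'] := @kroot k _ _ hq y.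
  have e1 : comb fr (fun l => iota r' * (l == m)%:R) a = comb fr (fun l => iota r * (l == t)%:R) a.
    rewrite !combZ !comb_delta /= !frobE -!rmorphXn er er' -ex -ey; exact: mulrC.
  have := kfree_uniq fa e1 m; rewrite eqxx (negPf mt) mulr1 mulr0 => /eqP.
  rewrite fmorph_eq0 => /eqP r0; have := a0 t.
  by rewrite -ey -er' r0 expr0n gtn_eqF // rmorph0 eqxx.
have spanq f : Hn (1 + q) f -> kspan iota a f.
  move=> fH; have [c ef] := frob_span hE fa f.
  have ct : range iota (c t).
    apply: (Hn1_const hE hP0).
    have [x _ ex] := const_a t Mt.
    have x0 : x != 0 by rewrite -(fmorph_eq0 iota) ex.
    have cq : Hn (1 + q) (c t ^+ q).
      have -> : c t ^+ q = iota x^-1 * (f - \sum_(m | m != t) c m ^+ q * a m).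
        rewrite ef /comb (bigD1 t) //= frobE addrK -ex fmorphV.
        by rewrite mulrC mulfK // fmorph_eq0.
      have [_ _ hZ] := Hn_sub hE P0 (1 + q)%N; apply: (hZ).
      apply: (subspaceB (Hn_sub hE P0 (1 + q)%N)) => //; apply: big_ind => [||m mt].
      - by have [] := Hn_sub hE P0 (1 + q)%N.
      - by have [] := Hn_sub hE P0 (1 + q)%N.
      have nM : ~~ M m by apply: contra mt => /uniqM ->.
      have [z _ <-] := all_const f c fH ef m nM; rewrite -rmorphXn; apply: hZ.
      by have := aH' m; rewrite /s nM muln1 i1.
    apply/(HnE hE) => Q hQ; move/(HnE hE)/(_ Q hQ): cq.
    case: (eqVneq (c t) 0) => [->|c0]; first by left.
    rewrite !vge_neq0 ?expf_neq0 // (ordX hF hQ) // !mulrn_int.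
    rewrite /point_divisor; case: (Q == P0) => /=; move: (ord Q (c t)) => o; nia.
  have /choice[z hz] : forall m, exists z, iota z = c m.
    move=> m; case: (boolP (M m)) => [/uniqM ->|nM]; first by case: ct => z _ e; exists z.
    by have [z _ e] := all_const f c fH ef m nM; exists z.
  exists (fun m => z m ^+ q); rewrite ef; apply: eq_bigr => m _.
  by rewrite /= frobE -hz rmorphXn.
have [b [bH fb _]] := Hn_dim hE hP0 (isT : (0 < q.+1)%N).
have := free_le fb (fun i => spanq _ (bH i)); by rewrite ltnn.
Qed.

End AtV.
End Bases.

Lemma kfree_replace (k L : fieldType) (mu : {rmorphism k -> L}) n (A : 'I_n -> L) b x i0 :
  kfree mu A -> x = comb mu b A -> b i0 != 0 -> kfree mu (fun m => if m == i0 then x else A m).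
Proof.
move=> fA ex b0 c hc.
pose c' m := (if m == i0 then 0 else c m) + c i0 * b m.
have h : comb mu c' A = 0.
  rewrite -[RHS]hc combD combZ -ex [RHS]/comb (bigD1 i0) //= eqxx addrC; congr (_ + _).
  rewrite /comb (bigD1 i0) //= eqxx rmorph0 mul0r add0r.
  by apply: eq_bigr => m /negPf ->.
have c0 : c i0 = 0.
  by have := fA c' h i0; rewrite /c' eqxx add0r => /eqP; rewrite mulf_eq0 (negPf b0) orbF => /eqP.
move=> m; have := fA c' h m; rewrite /c' c0 mul0r addr0.
by case: eqP => [->|].
Qed.

(** * The exceptional class: degrees divisible by q over P0 *)

Section ClassZero.
Variables (k : closedFieldType) (F : fieldType) (iota : {rmorphism k -> F}).
Hypothesis hE : elliptic_curve iota.
Let hF : function_field_1 iota := proj1 hE.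
Variables (K : fieldType) (phi : {rmorphism F -> K}) (T : K) (gT : generates phi T).
Variables (P0 : set F) (hP0 : place iota P0) (q : nat) (q2 : (1 < q)%N).
Variables (hq : [pchar F].-nat q) (hqK : [pchar K].-nat q).
Hypothesis no_tors : forall P f, place iota P -> P <> P0 -> f != 0 ->
  ~ (forall Q, place iota Q -> ord Q f = (point_divisor P Q - point_divisor P0 Q) *+ q).
Variables (w : F) (ow : ord P0 w = 1) (w0 : w != 0).
Local Notation Hn n := (Hn iota P0 n%N).
Local Notation cone := (cone iota phi T P0).
Local Notation chart := (chart phi T P0 q w).
Local Notation fr := (frob hq).
Let q0 : (0 < q)%N. Proof. exact: ltnW. Qed.
Let T0 : T != 0. Proof. exact: generates_neq0 gT. Qed.
Let pw0 : phi w != 0. Proof. by rewrite fmorph_eq0. Qed.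
Variables (V : set K) (vV : valuation_ring V) (RV : cone `<=` V) (eV : VF phi V = P0).
Let rc : subring (chart V). Proof. exact: (chart_subring phi T hP0 q w vV). Qed.
Let hP : phi @` P0 `<=` chart V. Proof. by have [] := chart_P0 hE gT hP0 q2 ow w0 eV. Qed.
Let hT : chart V (T / phi w). Proof. by have [] := chart_P0 hE gT hP0 q2 ow w0 eV. Qed.

Let il_lt : (q.-1 < q)%N. Proof. by rewrite prednK. Qed.
Let iy_lt : (q.-2 < q)%N. Proof. by case: (q) q2 => [|[|]]. Qed.
Let il : 'I_q := Ordinal il_lt.
Let iy : 'I_q := Ordinal iy_lt.
Let ily : (il == iy) = false.
Proof. by apply/negbTE; rewrite -val_eqE /=; case: (q) q2 => [|[|n]] //= _; rewrite gtn_eqF. Qed.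

(** The generator of the chart that the F-blowup has to contain, up to a unit at P0. *)
Let Xc : K := if `[< V (T / phi w ^+ q) >] then T / phi w ^+ q else phi w ^+ q / T.

Let pord c : c != 0 -> 0 <= ord P0 c -> chart V (phi c).
Proof. by move=> c0 oc; apply: hP; exists c => //; apply/(place_ord hF hP0); right. Qed.

Let pvge c n : vge P0 (- n%:Z) c -> chart V (phi c * T ^+ n).
Proof.
move=> hc; have -> : phi c * T ^+ n = phi (c * w ^+ n) * (T / phi w) ^+ n.
  by rewrite rmorphM rmorphXn expr_div_n; field; rewrite expf_neq0.
apply: subM => //; last exact: subX.
apply: hP; exists (c * w ^+ n) => //; apply/(place_ord hF hP0); rewrite -(addNr n%:Z).
by apply: (vgeM hF hP0) => //; right; rewrite (ordX hF hP0) // ow natz.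
Qed.

Let negq (x : K) : (- x) ^+ q = - x ^+ q.
Proof. by rewrite -[LHS]/(frob hqK _) rmorphN. Qed.

Lemma class_zero : exists a s, class_ok iota phi T P0 hq w V 0 a s /\
  exists r (C : 'I_q -> K) m c,
  [/\ cone r, r = \sum_m C m ^+ q * (phi (a m) * T ^+ (0 + q * s m)%N),
      c != 0 /\ ord P0 c = 0 & C m = phi c * Xc].
Proof.
have [A [b [hA AH dA eb [b1 spanA hby hbl]]]] := relation hE hq q2 hP0 no_tors.
have [by0 oby] := hby iy erefl; have [bl0 obl] := hbl il erefl.
have A0 m : A m != 0 by have [] := hA m.
have oA m : ord P0 (A m) = - (m.+2)%:Z by have [] := hA m.
have H10 : Hn 0 1 by apply/(Hn0 hE P0); exists 1; rewrite ?rmorph1.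
have fA : kfree fr A := frob_free hE hP0 dA.
have pby0 : phi (b iy) != 0 by rewrite fmorph_eq0.
have pbl0 : phi (b il) != 0 by rewrite fmorph_eq0.
have peb : 1 = \sum_m phi (b m) ^+ q * phi (A m).
  rewrite -(rmorph1 phi) eb (rmorph_sum phi); apply: eq_bigr => m _.
  by rewrite rmorphM /= frobE rmorphXn.
have lastE m : m == il = (m == q.-1 :> nat) by rewrite -val_eqE.
have AHq m : m != il -> Hn q (A m).
  rewrite lastE => ml; apply: (Hn_mono hE _ (AH m)); move: ml (ltn_ord m); clear; move: (m : nat) => m'; lia.
have AHl : Hn (q + q) (A il) by apply: (Hn_mono hE _ (AH il)) => /=; move: q2; clear; lia.
have bsmall m c : c != 0 -> ord P0 c <= 1 -> chart V (phi (b m / c)).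
  move=> c0 oc; apply: hP; exists (b m / c) => //; apply/(place_ord hF hP0).
  have h : vge P0 (- ord P0 c) c^-1 by right; rewrite (ordV hF hP0).
  by apply: vge_le (vgeM hF hP0 (b1 m) h); move: oc; clear; lia.
(* It suffices to generate 1 in degree 0, A_m T^q for m < q - 1, and A_(q-1) T^(2q): H^0(q P0) is
   spanned by 1 and the A_m, and from degree 2q on the coordinates in the basis A have poles small
   enough for the chart. *)
have finish e : fspan q (chart V) e 1 ->
    (forall m, m != il -> fspan q (chart V) e (phi (A m) * T ^+ q)) ->
    fspan q (chart V) e (phi (A il) * T ^+ (q + q)) ->
    forall l f, Hn (0 + q * l) f -> fspan q (chart V) e (phi f * T ^+ (0 + q * l)%N).
  move=> S1 SA Sl l f; rewrite add0n; case: l => [|[|l]] fH.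
  - rewrite muln0 in fH *; move/(Hn0 hE P0): fH => [r _ <-].
    have [r' <-] := @kroot k _ _ hq r; rewrite expr0 !rmorphXn.
    apply: (fspanM rc) => //; rewrite -[phi _]mulr1 -(expr0 T); apply: pvge.
    by rewrite oppr0; apply: vge_const.
  - rewrite muln1 in fH *; have [c ->] := spanA f fH.
    have /choice[r hr] := @kroot k _ _ hq.
    rewrite (rmorph_sum phi) mulr_suml; apply: (fspan_sum hqK rc) => m _.
    have cr : chart V (phi (iota (r (c m)))).
      rewrite -[phi _]mulr1 -(expr0 T); apply: pvge; rewrite oppr0; apply: vge_const => //.
    have hcm : phi (iota (c m)) = phi (iota (r (c m))) ^+ q by rewrite -!rmorphXn hr.
    rewrite rmorphM hcm -mulrA; apply: (fspanM rc) => //.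
    rewrite -lastE; case: eqP => [_|/eqP ml]; last exact: SA.
    by rewrite rmorph1 mul1r -[T ^+ q]mulr1; apply: (fspanM rc) => //; apply/(cone_chart hE gT hP0 q2 ow w0 vV RV)/coneT.
  - have [c ec] := frob_span hE fA f.
    have hf : vge P0 (- (q * l.+2)%N%:Z) (comb fr c A) by rewrite -ec; have /(HnP hE hP0)[] := fH.
    have hv m := frob_vge hE hq hP0 dA hf m.
    rewrite ec (rmorph_sum phi) mulr_suml; apply: (fspan_sum hqK rc) => m _.
    rewrite rmorphM /= frobE rmorphXn.
    have [->|ml] := eqVneq m il.
      have -> : phi (c il) ^+ q * phi (A il) * T ^+ (q * l.+2) =
          (phi (c il) * T ^+ l) ^+ q * (phi (A il) * T ^+ (q + q)).
        have -> : (q * l.+2 = l * q + (q + q))%N by clear; lia.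
        by rewrite exprMn -exprM exprD; ring.
      apply: (fspanM rc) => //; apply: pvge; move: (hv il).
      case: (eqVneq (c il) 0) => [->|c0]; first by left.
      rewrite !vge_neq0 ?mulf_neq0 ?expf_neq0 // (ordM hF hP0) ?expf_neq0 // (ordX hF hP0) // oA mulrn_int /=.
      rewrite PoszM; move: (ord P0 (c il)) => o; move: q0; clear; nia.
    have -> : phi (c m) ^+ q * phi (A m) * T ^+ (q * l.+2) =
        (phi (c m) * T ^+ l.+1) ^+ q * (phi (A m) * T ^+ q).
      have -> : (q * l.+2 = l.+1 * q + q)%N by clear; lia.
      by rewrite exprMn -exprM exprD; ring.
    apply: (fspanM rc); last exact: SA.
    apply: pvge; move: (hv m); case: (eqVneq (c m) 0) => [->|c0]; first by left.
    rewrite !vge_neq0 ?mulf_neq0 ?expf_neq0 // (ordM hF hP0) ?expf_neq0 // (ordX hF hP0) // oA mulrn_int /=.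
    rewrite PoszM; move: (ord P0 (c m)) (m : nat) (ltn_ord m) q0 => o m'; clear; nia.
have [h|h] := pselect (V (T / phi w ^+ q)).
  have hX : chart V (T / phi w ^+ q) by rewrite (chart_1 eV h); apply: polyring_gen; apply: image_subring; apply: place_sub hP0.
  pose a m := if m == il then 1 else A m; pose s m : nat := m != il.
  pose e m := phi (a m) * T ^+ (0 + q * s m)%N.
  (* The relation is solved for A_(q-1) and multiplied by T^(2q). Since b_(q-1) has order q + 1 and
     every b_m order at least 1, the coefficients lie in the chart, and the one at m = q - 2 is
     T/w^q up to a unit. *)
  pose C m := if m == il then T ^+ 2 / phi (b il) else - (T * phi (b m) / phi (b il)).
  have eC : phi (A il) * T ^+ (q + q) = \sum_m C m ^+ q * e m.
    rewrite (bigD1 il) //= /C /e /a /s !eqxx /= muln0 expr0 rmorph1 !mulr1.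
    have -> : \sum_(m | m != il) (if m == il then T ^+ 2 / phi (b il) else - (T * phi (b m) / phi (b il))) ^+ q *
        (phi (if m == il then 1 else A m) * T ^+ (0 + q * (m != il))%N) =
        - (T ^+ q * T ^+ q / phi (b il) ^+ q) * \sum_(m | m != il) phi (b m) ^+ q * phi (A m).
      rewrite mulr_sumr; apply: eq_bigr => m ml; rewrite (negPf ml) /= muln1 add0n negq.
      by rewrite expr_div_n exprMn; field; rewrite expf_neq0.
    have := peb; rewrite (bigD1 il) //= => /(canLR (addKr _)) <-.
    by rewrite expr_div_n -exprM mulnC exprM expr2 exprD; field; rewrite expf_neq0.
  have CB m : chart V (C m).
    rewrite /C; case: eqP => _.
      have -> : T ^+ 2 / phi (b il) = phi (w ^+ q.+1 / b il) * (T / phi w ^+ q) * (T / phi w).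
        by rewrite fmorph_div [w ^+ q.+1]exprS rmorphM rmorphXn; field; rewrite pw0 pbl0 expf_neq0.
      do 2!apply: subM => //; apply: pord; first by rewrite mulf_neq0 ?expf_neq0 ?invr_eq0.
      by rewrite (ord_div hF hP0) ?expf_neq0 // (ordX hF hP0) // ow obl natz subrr.
    apply: subN => //; have -> : T * phi (b m) / phi (b il) = phi (b m / (b il / w ^+ q)) * (T / phi w ^+ q).
      by rewrite !fmorph_div rmorphXn; field; rewrite pbl0 expf_neq0.
    apply: subM => //; apply: bsmall; first by rewrite mulf_neq0 ?invr_eq0 ?expf_neq0.
    by rewrite (ord_div hF hP0) ?expf_neq0 // (ordX hF hP0) // ow obl natz; clear; lia.
  have Se m : fspan q (chart V) e (e m) by apply: (fspan_gen hqK rc).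
  exists a, s; split; first split.
  - by apply: (kfree_replace fA eb); rewrite bl0.
  - move=> m; rewrite /a /s; case: eqP => [_|/eqP ml] /=.
      by rewrite muln0; exact: H10.
    by rewrite muln1; apply: AHq.
  - apply: finish.
    + by have := Se il; rewrite /e /a /s eqxx /= muln0 expr0 rmorph1 mulr1.
    + by move=> m ml; have := Se m; rewrite /e /a /s (negPf ml) /= muln1.
    + by exists C.
  exists (phi (A il) * T ^+ (q + q)), C, iy, (- (b iy * w ^+ q / b il)); split=> //.
  - by apply: cone_mono.
  - rewrite oppr_eq0 !mulf_neq0 ?invr_eq0 ?expf_neq0 //; split=> //.
    rewrite (ordN hF hP0) (ord_div hF hP0) ?mulf_neq0 ?expf_neq0 // (ordM hF hP0) ?expf_neq0 //.
    by rewrite (ordX hF hP0) // ow oby obl natz; clear; lia.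
  - rewrite /C eq_sym ily /Xc asboolT // rmorphN fmorph_div rmorphM rmorphXn.
    by field; rewrite pbl0 expf_neq0.
have hX : chart V (phi w ^+ q / T).
  rewrite (chart_2 eV h); apply: polyring_gen; apply: polyring_subring.
  by apply: image_subring; apply: place_sub hP0.
pose a m := if m == iy then 1 else A m.
pose s m : nat := if m == iy then 0%N else if m == il then 2%N else 1%N.
pose e m := phi (a m) * T ^+ (0 + q * s m)%N.
(* Here the relation is solved for A_(q-2) and multiplied by T^q, and A_(q-1) T^(2q) stays in the
   basis. Its coefficient b_(q-1) / (b_(q-2) T) is w^q/T up to a unit, as the orders are q + 1 and
   1. *)
pose C m := if m == iy then T / phi (b iy) else
  if m == il then - (phi (b il / b iy) / T) else - phi (b m / b iy).
have eC : phi (A iy) * T ^+ q = \sum_m C m ^+ q * e m.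
  rewrite (bigD1 iy) //= {1}/C {1}/e {1}/a {1}/s !eqxx /= muln0 expr0 rmorph1 !mulr1.
  have -> : \sum_(m | m != iy) C m ^+ q * e m =
      - (T ^+ q / phi (b iy) ^+ q) * \sum_(m | m != iy) phi (b m) ^+ q * phi (A m).
    rewrite mulr_sumr; apply: eq_bigr => m my; rewrite /C /e /a /s (negPf my) /= add0n.
    case: eqP => [->|_]; rewrite negq ?fmorph_div !expr_div_n.
      by rewrite muln2 -addnn exprD; field; rewrite !expf_neq0.
    by rewrite muln1; field; rewrite expf_neq0.
  have := peb; rewrite (bigD1 iy) //= => /(canLR (addKr _)) <-.
  by rewrite expr_div_n; field; rewrite expf_neq0.
have CB m : chart V (C m).
  rewrite /C; case: eqP => _.
    have -> : T / phi (b iy) = phi (w / b iy) * (T / phi w).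
      by rewrite fmorph_div; field; rewrite pw0 pby0.
    apply: subM => //; apply: pord; first by rewrite mulf_neq0 ?invr_eq0.
    by rewrite (ord_div hF hP0) // ow oby subrr.
  case: eqP => _; apply: subN => //; last by apply: bsmall => //; rewrite oby.
  have -> : phi (b il / b iy) / T = phi (b il / (b iy * w ^+ q)) * (phi w ^+ q / T).
    by rewrite !fmorph_div rmorphM rmorphXn; field; rewrite T0 pby0 expf_neq0.
  apply: subM => //; apply: pord; first by rewrite !mulf_neq0 ?invr_eq0 ?mulf_neq0 ?expf_neq0.
  rewrite (ord_div hF hP0) ?mulf_neq0 ?expf_neq0 // (ordM hF hP0) ?expf_neq0 // (ordX hF hP0) // ow obl oby natz.
  clear; lia.
have Se m : fspan q (chart V) e (e m) by apply: (fspan_gen hqK rc).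
exists a, s; split; first split.
- by apply: (kfree_replace fA eb); rewrite by0.
- move=> m; rewrite /a /s; case: eqP => [_|/eqP my].
    by rewrite muln0; exact: H10.
  case: eqP => [->|/eqP ml]; first by rewrite muln2 -addnn.
  by rewrite muln1; apply: AHq.
- apply: finish.
  + by have := Se iy; rewrite /e /a /s eqxx /= muln0 expr0 rmorph1 mulr1.
  + move=> m ml; have [->|my] := eqVneq m iy; first by exists C.
    by have := Se m; rewrite /e /a /s (negPf ml) (negPf my) muln1.
  + by have := Se il; rewrite /e /a /s ily eqxx muln2 -addnn add0n.
exists (phi (A iy) * T ^+ q), C, il, (- (b il / (b iy * w ^+ q))); split=> //.
- by apply: (cone_mono hE); apply: AHq; rewrite eq_sym ily.
- rewrite oppr_eq0 !mulf_neq0 ?invr_eq0 ?mulf_neq0 ?expf_neq0 //; split=> //.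
  rewrite (ordN hF hP0) (ord_div hF hP0) ?mulf_neq0 ?expf_neq0 // (ordM hF hP0) ?expf_neq0 //.
  by rewrite (ordX hF hP0) // ow oby obl natz; clear; lia.
- rewrite /C ily eqxx /Xc asboolF // rmorphN !fmorph_div rmorphM rmorphXn.
  by field; rewrite T0 pby0 expf_neq0.
Qed.

End ClassZero.

Lemma integral_idem (K : fieldType) (A : set K) : subring A ->
  integral_closure (integral_closure A) `<=` integral_closure A.
Proof.
move=> rA x hx; apply: integral_of_val => // V vV AV.
by apply: (integral_val vV (integral_val vV AV)).
Qed.

Lemma dominates_trans (K : fieldType) (A B C : set K) : dominates A B -> dominates B C -> dominates A C.
Proof. by move=> [h1 h2] [h3 h4]; split; [apply: subset_trans h1|apply: subset_trans h2]. Qed.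

(** * The normalization of the F-blowup *)

Section FBlowup.
Variables (k : closedFieldType) (F : fieldType) (iota : {rmorphism k -> F}).
Hypothesis hE : elliptic_curve iota.
Let hF : function_field_1 iota := proj1 hE.
Variables (K : fieldType) (phi : {rmorphism F -> K}) (T : K) (gT : generates phi T).
Variables (P0 : set F) (hP0 : place iota P0) (q : nat) (q2 : (1 < q)%N).
Variables (hq : [pchar F].-nat q) (hqK : [pchar K].-nat q).
Hypothesis no_tors : forall P f, place iota P -> P <> P0 -> f != 0 ->
  ~ (forall Q, place iota Q -> ord Q f = (point_divisor P Q - point_divisor P0 Q) *+ q).
Variables (w : F) (ow : ord P0 w = 1) (w0 : w != 0).
Local Notation Hn n := (Hn iota P0 n%N).
Local Notation cone := (cone iota phi T P0).
Local Notation chart := (chart phi T P0 q w).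
Local Notation Y := (Y phi T P0 q w).
Local Notation fr := (frob hq).
Let q0 : (0 < q)%N. Proof. exact: ltnW. Qed.
Let T0 : T != 0. Proof. exact: generates_neq0 gT. Qed.
Let pw0 : phi w != 0. Proof. by rewrite fmorph_eq0. Qed.
Let coneR : subring cone. Proof. exact: cone_subring. Qed.

Lemma cone_regular f : regular_off iota P0 f -> exists n, Hn n f.
Proof.
move=> rf; exists `|ord P0 f|%N; apply/(HnP hE hP0); split=> // .
by right; move: (ord P0 f); clear; lia.
Qed.

Lemma cone_fraction z : exists a b, [/\ cone a, cone b, b != 0 & z = a / b].
Proof.
have rT : subring (setT : set K) by apply/subringP.
have rL : subring (loc setT cone) by apply: loc_subring.
have CL : cone `<=` loc setT cone by apply: sub_loc.
suff [a [b [Ca Cb [_ b0 _] ->]]] : loc setT cone z by exists a, b.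
have fromF x : loc setT cone (phi x).
  have [Q hQ nQ] := other_place hE hP0.
  have reg c : regular_off iota P0 c -> loc setT cone (phi c).
    move=> /cone_regular[n cH].
    exists (phi c * T ^+ n), (T ^+ n); split => //.
    - exact: (cone_mono hE).
    - by apply: subX => //; apply: coneT.
    - by split=> //; rewrite expf_neq0.
    - by rewrite mulfK // expf_neq0.
  have inv y : loc setT cone y -> loc setT cone y^-1.
    have [->|y0 hy] := eqVneq y 0; first by rewrite invr0.
    by apply: loc_unit.
  suff frac y : vge Q 0 y -> loc setT cone (phi y).
    have [|n] := pselect (vge Q 0 x); first exact: frac.
    rewrite -[x]invrK fmorphV; apply/inv/frac; right.
    have [x0|x0] := eqVneq x 0; first by exfalso; apply: n; left.
    rewrite (ordV hF hQ) // oppr_ge0 leNgt; apply/negP => /ltW h; apply: n; by right.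
  move=> ay; have [c0 [c1 [_ _ r0 r1 ->]]] := affine_fraction hE hP0 hQ nQ ay.
  by rewrite fmorph_div; apply: subM => //; [apply: reg|apply/inv/reg].
have evL f : loc setT cone (ev phi T f).
  rewrite (evE phi T (leqnn _)); apply: sub_sum => // i _; apply: subM => //.
  by apply: subX => //; apply: CL; apply: coneT.
have [f [g [g0 ->]]] := proj2 gT z; apply: subM => //; apply: loc_unit => //.
by split=> //; apply: ev_neq0.
Qed.

Section AtV.
Variables (V : set K) (vV : valuation_ring V) (RV : cone `<=` V).
Let rV : subring V. Proof. exact: val_sub. Qed.
Let rc : subring (chart V). Proof. exact: (chart_subring phi T hP0 q w vV). Qed.
Let rY : subring (Y V). Proof. exact: (Y_subring phi T hP0 q w vV). Qed.

Let i0 : 'I_q := Ordinal q0.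
Let i1 : 'I_q := Ordinal q2.

Let Xc : K := if `[< V (T / phi w ^+ q) >] then T / phi w ^+ q else phi w ^+ q / T.

(** Class 1 supplies the nonconstant function and class 0 the element [Xc]; both are coordinates of
    elements of the cone in the same basis. *)
Lemma class_bases : exists a s,
  [/\ forall i : 'I_q, class_ok iota phi T P0 hq w V i (a i) (s i),
    exists r (C : 'I_q -> K) m c,
      [/\ cone r, r = \sum_m C m ^+ q * monomial_basis phi T a s (i1, m), C m = phi c & ~ range iota c] &
    VF phi V = P0 -> exists r (C : 'I_q -> K) m c,
      [/\ cone r, r = \sum_m C m ^+ q * monomial_basis phi T a s (i0, m),
        c != 0 /\ ord P0 c = 0 & C m = phi c * Xc]].
Proof.
have : forall i : 'I_q, exists as_ : ('I_q -> F) * ('I_q -> nat),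
  [/\ class_ok iota phi T P0 hq w V i as_.1 as_.2,
    i = i1 -> exists r (C : 'I_q -> K) m c,
      [/\ cone r, r = \sum_m C m ^+ q * (phi (as_.1 m) * T ^+ (i + q * as_.2 m)%N), C m = phi c & ~ range iota c] &
    i = i0 -> VF phi V = P0 -> exists r (C : 'I_q -> K) m c,
      [/\ cone r, r = \sum_m C m ^+ q * (phi (as_.1 m) * T ^+ (i + q * as_.2 m)%N),
        c != 0 /\ ord P0 c = 0 & C m = phi c * Xc]].
  move=> i; have [[e z]|n] := pselect (VF phi V = P0 /\ i = 0%N :> nat).
    have [a [s [h1 h2]]] := class_zero hE gT hP0 q2 hq hqK no_tors ow w0 vV RV e.
    exists (a, s); rewrite z; split=> // ei; by move: z; rewrite ei.
  have [a [s [h1 h2]]] := class_generic hE gT hP0 q2 hq hqK no_tors ow w0 vV RV (ltn_ord i) n.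
  exists (a, s); split=> //.
    move=> ei; have [|f [C [m [c [fH ef eC nc]]]]] := h2; first by rewrite ei.
    exists (phi f * T ^+ (1 + q)%N), C, m, c; split=> //.
    exact: (cone_mono hE).
  by move=> ei e; exfalso; apply: n; split=> //; rewrite ei.
move=> /choice[as_ h]; exists (fun i => (as_ i).1), (fun i => (as_ i).2); split.
- by move=> i; have [] := h i.
- by have [_ /(_ erefl) h1 _] := h i1.
- by have [_ _ /(_ erefl) h1] := h i0.
Qed.

Section Basis.
Variables (a : 'I_q -> 'I_q -> F) (s : 'I_q -> 'I_q -> nat).
Hypothesis ok : forall i : 'I_q, class_ok iota phi T P0 hq w V i (a i) (s i).
Local Notation e := (monomial_basis phi T a s).

Lemma monomial_cone x : cone (e x).
Proof. by apply: (cone_mono hE); have [_ h _] := ok x.1. Qed.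

Lemma monomial_basis_free : kfree_fin (frob hqK) e.
Proof. by apply: (monomial_free gT q2 (hq := hq) ow w0) => i; have [] := ok i. Qed.

Lemma class_sum i (C : 'I_q -> K) :
  \sum_m C m ^+ q * e (i, m) = \sum_x (if x.1 == i then C x.2 else 0) ^+ q * e x.
Proof.
rewrite -(pair_bigA _ (fun i' m => (if i' == i then C m else 0) ^+ q * e (i', m))) /=.
rewrite [RHS](bigD1 i) //= eqxx [X in _ = _ + X]big1 ?addr0 // => i' /negPf ->.
by rewrite big1 // => m _; rewrite expr0n gtn_eqF // mul0r.
Qed.

Lemma cone_span : cone `<=` fspan q (Y V) e.
Proof.
move=> _ [f fH <-]; rewrite (evE phi T (leqnn _)); apply: (fspan_sum hqK rY) => n _.
have iq : (n %% q < q)%N by rewrite ltn_mod.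
have en : (n = n %% q + q * (n %/ q) :> nat)%N by rewrite addnC mulnC -divn_eq.
have [_ _ h] := ok (Ordinal iq).
have := h (n %/ q)%N f`_n; rewrite /= -en => /(_ (fH n)) [C CB ->].
exists (fun x => if x.1 == Ordinal iq then C x.2 else 0); last exact: (class_sum (Ordinal iq) C).
by move=> x; case: ifP => _; [apply: (chart_Y hP0 vV)|apply: sub0].
Qed.

Lemma Y_free : free_pushforward q (Y V) (torsionfree_pullback q cone (Y V)).
Proof. exact: (basis_free_pushforward rY monomial_cone monomial_basis_free cone_span). Qed.

Lemma coordinate_in B i r (C : 'I_q -> K) m : subring B -> cone `<=` B -> dominates (Y V) B ->
  free_pushforward q B (torsionfree_pullback q cone B) ->
  cone r -> r = \sum_m C m ^+ q * e (i, m) -> B (C m).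
Proof.
move=> rB RB dB fB Rr; rewrite class_sum => er.
have := coordinates_in rB rY RB cone_fraction dB fB monomial_cone monomial_basis_free cone_span Rr er (i, m).
by rewrite eqxx.
Qed.

End Basis.

(** As [Y V] is normal and contains B, only the inclusion of the chart is at stake. Its generators
    are recovered from the two coordinates that B is forced to contain, the others by
    integrality. *)
Lemma Y_integral B : subring B -> cone `<=` B -> dominates (Y V) B ->
  free_pushforward q B (torsionfree_pullback q cone B) -> Y V = loc V (integral_closure B).
Proof.
move=> rB RB dB fB; have rI := integral_subring rB.
have BI : B `<=` integral_closure B by apply: sub_integral.
have YV : Y V `<=` V by have [] := Y_dominated hE gT hP0 q ow w0 vV RV.
have IY : integral_closure B `<=` Y V.
  move=> x hx; apply: (Y_normal hE gT hP0 q2 ow w0 vV).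
  by apply: integral_mono hx; case: dB.
pose D := loc V (integral_closure B).
have rD : subring D by apply: loc_subring.
have ID : integral_closure B `<=` D by apply: sub_loc.
have RD : cone `<=` D by move=> x /RB/BI/ID.
have nD : integral_closure D `<=` D by apply: int_closed_loc => //; apply: integral_idem.
suff cD : chart V `<=` D.
  rewrite eqEsubset; split; last by rewrite -[Y V](loc_idem rV rc); apply: loc_mono.
  by rewrite -[loc V _](loc_idem rV rI); apply: loc_mono.
have [a [s [ok [r [C [m [c [Rr er eC nc]]]]] hX]]] := class_bases.
have Bc : B (phi c) by rewrite -eC; apply: (coordinate_in ok) er.
have [Q hQ nQc] := pole_ex nc.
have nQ : VF phi V <> Q by move=> e; apply: nQc; rewrite -e; apply/YV/IY/BI.
(* Q is a pole of c, and c lies in B, so no valuation ring containing B is centered over Q;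
   functions regular off Q lie in all of them and are integral over B. *)
have reg f : regular_off iota Q f -> D (phi f).
  move=> rf; apply: ID; apply: integral_of_val => // W vW BW.
  apply: (VF_regular hE vW (subset_trans RB BW) rf) => e; apply: nQc; rewrite -e; exact: BW.
have img : phi @` VF phi V `<=` D.
  move=> _ [f Vf <-]; have [c0 [c1 [r0 r1 u ->]]] := VF_fraction hE q2 vV RV hQ nQ Vf.
  by rewrite fmorph_div; apply: subM; [|apply: reg|apply: loc_unit => //; apply: reg].
have [e|n] := pselect (VF phi V = P0); last first.
  by rewrite chart_off //; apply: polyring_min => //; apply: RD; apply: coneT.
rewrite e in img.
(* D contains the local ring at P0, so a valuation ring containing D has [VF phi W] equal to P0 or
   F; either way a degree 2 section with a double pole puts the square of T/w in it. *)
have hT : D (T / phi w).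
  apply: nD; apply: integral_of_val => // W vW DW; have rW := val_sub vW.
  have imW : P0 `<=` VF phi W by move=> f Pf; apply: DW; apply: img; exists f.
  have eW : VF phi W = P0 \/ VF phi W = setT.
    have RW := subset_trans RD DW.
    have [|nT] := pselect (VF phi W = setT); [by right|left].
    by apply/esym; apply: (place_incomp hF hP0 (VF_place hE vW RW nT)).
  have [f fH [f0 of_]] := pole_section hE hP0 (isT : (1 < 2)%N).
  have Px : P0 (f * w ^+ 2)^-1.
    apply/(place_ord hF hP0); right; rewrite (ordV hF hP0) ?mulf_neq0 ?expf_neq0 //.
    by rewrite (ordM hF hP0) ?expf_neq0 // (ordX hF hP0) // of_ ow.
  have W2 : W ((T / phi w) ^+ 2).
    have -> : (T / phi w) ^+ 2 = phi (f * w ^+ 2)^-1 * (phi f * T ^+ 2).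
      rewrite fmorphV rmorphM rmorphXn; have pf0 : phi f != 0 by rewrite fmorph_eq0.
      by field; rewrite pw0 pf0.
    by apply: subM => //; [apply: imW|apply/DW/RD; apply: (cone_mono hE)].
  have [//|h] := vW.2 (T / phi w).
  have -> : T / phi w = (T / phi w) ^+ 2 * (T / phi w)^-1 by field; rewrite pw0 T0.
  exact: subM.
have [r' [C' [m' [c' [Rr' er' [c0 oc] eC']]]]] := hX e.
have DX : D Xc.
  have -> : Xc = phi c'^-1 * C' m' by rewrite eC' fmorphV mulKf // fmorph_eq0.
  apply: subM => //; last by apply/ID/BI; apply: (coordinate_in ok) er'.
  apply: img; exists c'^-1 => //; apply/(place_ord hF hP0); right.
  by rewrite (ordV hF hP0) // oc.
move: DX; rewrite /Xc; case: asboolP => h DX.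
  by rewrite chart_1 //; apply: polyring_min.
by rewrite chart_2 //; apply: polyring_min => //; apply: polyring_min.
Qed.

End AtV.

(** Universality of FB, applied to the flattening [Y], gives a local ring of FB dominated by [Y V].
    Uniqueness of the center of V identifies it with the one under consideration. *)
Lemma normalization_FB (P1 : set F) (M : set (set K)) : place iota P1 -> P1 <> P0 ->
  regular_off iota P1 w -> is_F_blowup q cone M ->
  normalization M = [set Y V | V in [set V | valuation_ring V /\ cone `<=` V]].
Proof.
move=> hP1 nP1 wreg [[mM fM] uM].
have mY := modification_Y hE gT hP0 q2 hP1 nP1 ow w0 wreg.
have fY : F_flattening q cone [set Y V | V in [set V | valuation_ring V /\ cone `<=` V]].
  split=> // _ [V [vV RV] <-]; have [a [s [ok _ _]]] := class_bases vV RV.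
  exact: (Y_free vV ok).
apply: (normalizationE mM) => V B vV RV MB dB.
have [rB RB] := modification_sub mM MB.
have [|B' MB' dB'] := uM _ fY (Y V); first by exists V.
have -> : B = B'.
  have [B1 [_ uB1]] := mM.2 V vV RV; rewrite -(uB1 B) //; apply: uB1; split=> //.
  exact: dominates_trans (Y_dominated hE gT hP0 q ow w0 vV RV) dB'.
have [rB' RB'] := modification_sub mM MB'.
by apply: Y_integral => //; apply: fM.
Qed.

End FBlowup.

(** * The blowup at the fat point *)

Section Blowup.
Variables (k : closedFieldType) (F : fieldType) (iota : {rmorphism k -> F}).
Hypothesis hE : elliptic_curve iota.
Let hF : function_field_1 iota := proj1 hE.
Variables (K : fieldType) (phi : {rmorphism F -> K}) (T : K) (gT : generates phi T).
Variables (P0 : set F) (hP0 : place iota P0) (q : nat) (q2 : (1 < q)%N).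
Variables (w : F) (ow : ord P0 w = 1) (w0 : w != 0).
Local Notation cone := (cone iota phi T P0).
Local Notation chart := (chart phi T P0 q w).
Local Notation Y := (Y phi T P0 q w).
Local Notation t := (T / phi w).
Local Notation tq := (T / phi w ^+ q).
Implicit Types (V W B : set K) (P : set F).
Let q0 : (0 < q)%N. Proof. exact: ltnW. Qed.
Let T0 : T != 0. Proof. exact: generates_neq0 gT. Qed.
Let pw0 : phi w != 0. Proof. by rewrite fmorph_eq0. Qed.
Let t0 : t != 0. Proof. by rewrite mulf_neq0 ?invr_eq0. Qed.
Let rP0 : subring P0. Proof. exact: place_sub hP0. Qed.
Let gt : generates phi t.
Proof. by rewrite mulrC -fmorphV; apply: generates_scale => //; rewrite invr_eq0. Qed.
Let etq : tq = t / phi w ^+ q.-1.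
Proof. by rewrite -[in LHS](prednK q0) exprS; field; rewrite pw0 expf_neq0. Qed.
Let P0w : nonunits P0 w.
Proof. by apply/(nonunits_ord hF hP0); right; rewrite ow. Qed.

(** The restriction of the minimal resolution to Spec of the local ring at P; at P0 the fiber
    coordinate is T/w because L has degree 1 there. *)
Definition cone_chart_at P : set K := polyring (phi @` P) (if `[< P = P0 >] then t else T).

Definition zero_point : set K := localization (cone_chart_at P0)
  [set ev phi t f | f in [set f | polyover P0 f /\ nonunits P0 f`_0]].

Definition fat B : set K := [set x | B x /\ (B = zero_point ->
  exists a b, [/\ B a, B b & x = a * t + b * phi w ^+ q.-1])].

Definition resolution : set (set K) := [set B | exists2 P, place iota P & spec_model (cone_chart_at P) B].

Local Notation C := cone_chart_at.

Lemma cone_chart_P0 : C P0 = [set ev phi t f | f in polyover P0].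
Proof. by rewrite /C asboolT // polyring_image. Qed.

Lemma cone_chart_subring P : place iota P -> subring (C P).
Proof. by move=> hP; apply: polyring_subring; apply: image_subring; apply: place_sub hP. Qed.

Let rimg P : place iota P -> subring (phi @` P).
Proof. by move=> hP; apply: image_subring; apply: place_sub hP. Qed.

Lemma cone_chart_img P : place iota P -> phi @` P `<=` C P.
Proof. by move=> hP; apply: sub_polyring; apply: rimg. Qed.

Lemma cone_chart_t : C P0 t.
Proof. by rewrite /C asboolT //; apply: polyring_gen; apply: rimg. Qed.

Lemma cone_chart_T P : place iota P -> C P T.
Proof.
move=> hP; have [->|n] := pselect (P = P0); last first.
  by rewrite /C asboolF //; apply: polyring_gen; apply: rimg.
have -> : T = phi w * t by rewrite mulrC divfK.
apply: subM; [exact: cone_chart_subring| |exact: cone_chart_t].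
by apply: cone_chart_img => //; exists w => //; case: P0w.
Qed.

Lemma cone_sub_chart_at P : place iota P -> cone `<=` C P.
Proof.
move=> hP; have [->|n] := pselect (P = P0).
  apply: (cone_sub_P0 hE hP0 ow w0); first exact: cone_chart_subring.
    exact: cone_chart_img.
  exact: cone_chart_t.
have rC := cone_chart_subring hP.
apply: cone_min => // m f /(HnP hE hP0)[_ h]; apply: subM => //.
  by apply: cone_chart_img => //; exists f => //; apply/(place_ord hF hP); apply: h.
by apply: subX => //; apply: cone_chart_T.
Qed.

Lemma cone_chart_zero_point : C P0 `<=` zero_point.
Proof.
move=> x Cx; exists x, 1; split; rewrite ?divr1 //.
  by apply: sub1; apply: cone_chart_subring.
move=> [f [_ nf] ef]; have e1 : f = 1 by apply: (ev_inj gt); rewrite ef ev1.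
by move: nf; rewrite e1 coef1; apply: nonunits1.
Qed.

Lemma zero_point_t : zero_point t /\ ~ zero_point t^-1.
Proof.
split; first exact/cone_chart_zero_point/cone_chart_t.
move=> [y [y1 [Cy Cy1 nb e]]]; move: Cy Cy1; rewrite cone_chart_P0 => -[f hf ef] [g hg eg].
rewrite -ef -eg in e nb.
have g0 : ev phi t g != 0.
  apply/eqP => z; apply: nb; exists g => //; split=> //.
  by have -> : g = 0; [apply: (ev_inj gt); rewrite z ev0|rewrite coef0; apply: nonunits0].
apply: nb; exists g => //; split=> //.
have -> : g = f * 'X.
  apply: (ev_inj gt); rewrite evM evX.
  have <- : t^-1 * ev phi t g = ev phi t f by rewrite e divfK.
  by rewrite mulrAC mulVf // mul1r.
by rewrite coefMX; apply: nonunits0.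
Qed.

Lemma zero_point_F x : zero_point (phi x) -> P0 x.
Proof.
move=> [y [y1 [Cy Cy1 nb e]]]; move: Cy Cy1; rewrite cone_chart_P0 => -[f hf ef] [g hg eg].
rewrite -ef -eg in e nb.
have ng : ~ nonunits P0 g`_0 by move=> n; apply: nb; exists g.
have [_ g00 ig] : unit_in P0 g`_0 by apply/unit_nonunits.
have g0 : ev phi t g != 0.
  by apply: ev_neq0 => //; apply/eqP => z; move: g00; rewrite z coef0 eqxx.
have ex : x *: g = f by apply: (ev_inj gt); rewrite evZ e divfK.
have -> : x = f`_0 / g`_0 by rewrite -ex coefZ mulfK.
exact: subM.
Qed.

Section AtV.
Variables (V : set K) (vV : valuation_ring V).
Let rV : subring V. Proof. exact: val_sub. Qed.

(** With t a nonunit, f(t) is a unit of V exactly when its constant coefficient is a unit at P0. *)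
Lemma loc_zero_point : C P0 `<=` V -> VF phi V = P0 -> nonunits V t -> loc V (C P0) = zero_point.
Proof.
move=> CV e nt.
have nF x : P0 x -> nonunits V (phi x) <-> nonunits P0 x.
  move=> Px; have Vx : V (phi x) by have : VF phi V x by rewrite e.
  have ei : V (phi x)^-1 <-> P0 x^-1 by rewrite -fmorphV -e.
  split=> -[_ [/eqP z|n]]; split=> //.
  - by left; apply/eqP; move: z; rewrite fmorph_eq0.
  - by right => /ei.
  - by left; rewrite (eqP z) rmorph0.
  - by right => /ei.
have key f : polyover P0 f -> nonunits V (ev phi t f) <-> nonunits P0 f`_0.
  move=> hf.
  have [r Vr er] : exists2 r, V r & ev phi t f = phi f`_0 + t * r.
    exists (ev phi t (drop_poly 1 f)).
      apply: CV; rewrite cone_chart_P0; exists (drop_poly 1 f) => //.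
      by move=> i; rewrite coef_drop_poly.
    rewrite -{1}(poly_take_drop 1 f) expr1 evD evM evX; congr (_ + _); last exact: mulrC.
    rewrite (_ : take_poly 1 f = (f`_0)%:P) ?evC //.
    by apply/polyP => i; rewrite coef_take_poly coefC ltnS leqn0; case: eqP => [->|].
  have nr : nonunits V (t * r) by rewrite mulrC; apply: nonunitsM.
  rewrite -(nF _ (hf 0%N)) er; split=> h; last exact: nonunitsD.
  by rewrite -[phi _](addrK (t * r)); apply: nonunitsD => //; apply: nonunitsN.
rewrite eqEsubset; split=> _ [a [b [Ca Cb ub ->]]]; exists a, b; split=> //.
  move=> [f [hf nf] ef]; have : ~ nonunits V b by apply/unit_nonunits => //; case: ub.
  by apply; rewrite -ef; apply/key.
apply/unit_nonunits; first exact: CV.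
move: Cb ub; rewrite cone_chart_P0 => -[f hf <-] nf n; apply: nf; exists f => //; split=> //.
exact/key.
Qed.

Lemma loc_zero_pointP P : place iota P -> C P `<=` V -> loc V (C P) = zero_point ->
  [/\ P = P0, VF phi V = P0 & nonunits V t].
Proof.
move=> hP CV e; have rC := cone_chart_subring hP.
have [BV nBV] := dominates_loc rV rC CV.
have eP : P = P0.
  apply: (place_incomp hF hP hP0) => f Pf; apply: zero_point_F; rewrite -e; apply: sub_loc => //.
  by apply: cone_chart_img => //; exists f.
have [zt nzt] := zero_point_t.
split=> //; last by apply: nBV; rewrite e; split=> //; right.
have RV : cone `<=` V by apply: subset_trans CV; apply: cone_sub_chart_at.
have sub : P0 `<=` VF phi V.
  by move=> f Pf; apply: CV; apply: cone_chart_img => //; exists f => //; rewrite eP.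
have [eT|nT] := pselect (VF phi V = setT); last first.
  by apply/esym; apply: (place_incomp hF hP0 (VF_place hE vV RV nT)).
have : nonunits V (phi w).
  apply: nBV; split; first by apply: sub_loc => //; apply: cone_chart_img => //; exists w => //; rewrite eP; case: P0w.
  right; rewrite e -fmorphV => /zero_point_F h.
  by have [_ [/eqP|//]] := P0w; rewrite (negPf w0).
move=> [_ [/eqP|]]; rewrite ?(negPf pw0) // -fmorphV => h.
by exfalso; apply: h; have : VF phi V w^-1 by rewrite eT.
Qed.

End AtV.

Section OverCone.
Variables (V : set K) (vV : valuation_ring V) (RV : cone `<=` V).
Let rV : subring V. Proof. exact: val_sub. Qed.
Let rc : subring (chart V). Proof. exact: (chart_subring phi T hP0 q w vV). Qed.
Let rY : subring (Y V). Proof. exact: (Y_subring phi T hP0 q w vV). Qed.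
Let cY : chart V `<=` Y V. Proof. exact: (chart_Y hP0 vV). Qed.
Let YV : Y V `<=` V. Proof. by have [] := Y_dominated hE gT hP0 q ow w0 vV RV. Qed.

Lemma Y_unit x : Y V x -> V x^-1 -> Y V x^-1.
Proof.
have [->|x0] := eqVneq x 0; first by rewrite invr0.
by move=> Yx Vx; apply: loc_unit => //; split=> //; apply: YV.
Qed.

Lemma img_Y : phi @` VF phi V `<=` Y V.
Proof.
have [e|n] := pselect (VF phi V = P0).
  by apply: subset_trans cY; rewrite e; have [] := chart_P0 hE gT hP0 q2 ow w0 e.
apply: subset_trans cY; rewrite chart_off //; apply: sub_polyring.
by apply: image_subring; apply: val_sub; apply: VF_val.
Qed.

Lemma T_Y : Y V T. Proof. by apply/cY/(cone_chart hE gT hP0 q2 ow w0 vV RV)/(coneT hE). Qed.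

Lemma cone_chart_Y P : place iota P -> C P `<=` V -> C P `<=` Y V.
Proof.
move=> hP CV; have sub : phi @` P `<=` Y V.
  apply: subset_trans img_Y => _ [f Pf <-]; exists f => //; apply: CV.
  by apply: cone_chart_img => //; exists f.
apply: polyring_min => //; case: asboolP => [eP|_]; last exact: T_Y.
have [e|n] := pselect (VF phi V = P0).
  by apply: cY; have [] := chart_P0 hE gT hP0 q2 ow w0 e.
have hi : VF phi V w^-1.
  have [eT|nT] := pselect (VF phi V = setT); first by rewrite eT.
  exfalso; apply: n; apply/esym; apply: (place_incomp hF hP0 (VF_place hE vV RV nT)) => f Pf.
  by apply: CV; apply: cone_chart_img => //; exists f => //; rewrite eP.
by apply: subM => //; [apply: T_Y|rewrite -fmorphV; apply: img_Y; exists w^-1].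
Qed.

Lemma off_chart P : place iota P -> C P `<=` V -> VF phi V <> P0 -> chart V `<=` loc V (C P).
Proof.
move=> hP CV n; have rC := cone_chart_subring hP; have rL := loc_subring rV rC.
have CL := sub_loc rV rC.
have sub f : P f -> V (phi f) by move=> Pf; apply: CV; apply: cone_chart_img => //; exists f.
rewrite chart_off //; apply: polyring_min => //; last by apply: CL; apply: cone_chart_T.
move=> _ [f Vf <-].
have inP g : P g -> loc V (C P) (phi g) by move=> Pg; apply: CL; apply: cone_chart_img => //; exists g.
have [//|Pf] := pselect (P f); first exact: inP.
have f0 : f != 0 by apply/eqP => z; apply: Pf; rewrite z; apply: sub0; apply: place_sub hP.
have Pi : P f^-1 by have [vP _ _] := hP; case: (vP.2 f).
rewrite -[f]invrK fmorphV; apply: loc_unit => //; first exact: inP.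
by split; [apply: sub|rewrite fmorph_eq0 invr_eq0|rewrite fmorphV invrK].
Qed.

(** Off the fat point nothing is blown up. Over P0 this means that t is a unit of V, so V contains
    w^q/T = w^(q-1)/t but not T/w^q, and the second chart localizes to the resolution. *)
Lemma loc_cone_chart P : place iota P -> C P `<=` V -> loc V (C P) <> zero_point ->
  loc V (C P) = Y V.
Proof.
move=> hP CV nz; have rC := cone_chart_subring hP.
apply: (Y_eq hP0 vV rC); first exact: cone_chart_Y.
have rL := loc_subring rV rC; have CL := sub_loc rV rC.
have [e|n] := pselect (VF phi V = P0); last exact: off_chart.
have eP : P = P0.
  by apply: (place_incomp hF hP hP0) => f Pf; rewrite -e; apply: CV; apply: cone_chart_img => //; exists f.
subst P; have ut : unit_in V t.
  apply/unit_nonunits; first by apply: CV; apply: cone_chart_t.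
  by move=> nt; apply: nz; apply: loc_zero_point => //; exact: CV.
have nq : ~ V tq.
  rewrite etq => Vs; suff nt : nonunits V t.
    have : ~ nonunits V t by apply/unit_nonunits => //; case: ut.
    exact.
  have -> : t = (t / phi w ^+ q.-1 * phi w ^+ q.-2) * phi w.
    by rewrite -mulrA -exprSr (_ : q.-2.+1 = q.-1) ?divfK ?expf_neq0 //; case: (q) q2 => [|[]].
  apply: nonunitsM => //.
    by apply: subM => //; apply: subX => //; have : VF phi V w by rewrite e; case: P0w.
  split; first by have : VF phi V w by rewrite e; case: P0w.
  right; rewrite -fmorphV => h; have [_ [/eqP|]] := P0w; first by rewrite (negPf w0).
  by apply; rewrite -e.
rewrite chart_2 //; apply: polyring_min => //.
  by apply: polyring_min => //; [|apply: CL; apply: cone_chart_t]; apply: subset_trans CL; apply: cone_chart_img.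
have -> : phi w ^+ q / T = phi (w ^+ q.-1) * t^-1.
  by rewrite rmorphXn -[in LHS](prednK q0) exprS; field; rewrite pw0 T0.
apply: subM => //; last by apply: loc_unit => //; apply: CL; apply: cone_chart_t.
by apply: CL; apply: cone_chart_img => //; exists (w ^+ q.-1) => //; apply: subX => //; case: P0w.
Qed.

(* The blowup charts at the fat point are Z0[t/w^(q-1)] and Z0[w^(q-1)/t]. *)
Lemma loc_fat B a : resolution B -> fat B a -> a != 0 ->
  adjoin B [set x / a | x in fat B] `<=` V -> loc V (adjoin B [set x / a | x in fat B]) = Y V.
Proof.
move=> [P hP sB] [Ba ha] a0; set A := adjoin _ _ => AV.
have rC := cone_chart_subring hP; have rB := spec_subring rC sB.
have rA : subring A by apply: adjoin_subring.
have rL := loc_subring rV rA; have AL := sub_loc rV rA.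
have BA : B `<=` A by apply: sub_adjoin.
have gA x : fat B x -> A (x / a) by move=> hx; apply: adjoin_gen; exists x.
have CB := spec_sub rC sB.
have CV : C P `<=` V by move=> x /CB/BA/AV.
have CA : C P `<=` A by apply: subset_trans BA.
have [W [vW CW eB]] := loc_spec rC sB; have rW := val_sub vW.
have BL : B `<=` loc V (C P).
  move=> x; rewrite {1}eB => -[y [z [Cy Cz uz ->]]]; exists y, z; split=> //.
  have [_ z0 _] := uz; split=> //; first exact: CV.
  by apply: (AV); apply: (BA); rewrite eB; apply: loc_unit => //; apply: sub_loc.
have BY : B `<=` Y V.
  apply: subset_trans BL _; rewrite -[Y V](loc_idem rV rc); apply: loc_mono; exact: cone_chart_Y.
have [eZ|nZ] := pselect (B = zero_point); last first.
  (* V contains B, so an element of the chart that is a nonunit in V is one in W. Were V centered at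
     the fat point, W would be too, and B would be its local ring. *)
  have nL : loc V (C P) <> zero_point.
    move=> e; have [eP eV nt] := loc_zero_pointP vV hP CV e; subst P; apply: nZ.
    rewrite eB; have RW : cone `<=` W by apply: subset_trans CW; apply: cone_sub_chart_at.
    have inB x : C P0 x -> unit_in W x -> V x^-1.
      by move=> Cx ux; apply: (AV); apply: (BA); rewrite eB; apply: loc_unit => //; apply: sub_loc.
    have ntW x : C P0 x -> nonunits V x -> nonunits W x.
      move=> Cx [_ nx]; apply: contrapT => h; have ux : unit_in W x by apply/unit_nonunits => //; exact: CW.
      case: nx => [z|]; last by apply; apply: inB.
      by have [_ + _] := ux; rewrite z eqxx.
    apply: loc_zero_point => //.
    + have sW : P0 `<=` VF phi W.
        by move=> f Pf; apply: CW; apply: cone_chart_img => //; exists f.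
      have [eT|nT] := pselect (VF phi W = setT); last first.
        by apply/esym; apply: (place_incomp hF hP0 (VF_place hE vW RW nT)).
      have Cw : C P0 (phi w) by apply: cone_chart_img => //; exists w => //; case: P0w.
      have nw : nonunits V (phi w).
        split; [exact: CV|right; rewrite -fmorphV => h].
        by have [_ [/eqP|]] := P0w; [rewrite (negPf w0)|apply; rewrite -eV].
      have [_ [/eqP|]] := ntW _ Cw nw; rewrite ?(negPf pw0) // -fmorphV => h.
      by exfalso; apply: h; have : VF phi W w^-1 by rewrite eT.
    + exact: ntW (cone_chart_t) nt.
  rewrite -(loc_cone_chart hP CV nL).
  have fB : fat B = B.
    by rewrite eqEsubset; split=> [x []|x Bx] //; split.
  have ia : A a^-1.
    have := gA 1; rewrite fB div1r; apply; exact: sub1.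
  apply: (loc_loc rV rC CA) => x; apply: adjoin_min.
  - exact: loc_subring.
  - exact: BL.
  move=> _ [y + <-]; rewrite fB => By; apply: subM; [exact: loc_subring|exact: BL|].
  apply: loc_unit => //; first exact: BL.
  by split=> //; apply: AV => //; apply: BA.
have [al [be [Bal Bbe ea]]] := ha eZ.
have eP : P = P0.
  by apply: (place_incomp hF hP hP0) => f Pf; apply: zero_point_F; rewrite -eZ; apply: CB; apply: cone_chart_img => //; exists f.
subst P; have Bt : B t by rewrite eZ; have [] := zero_point_t.
pose W' := phi w ^+ q.-1; have W'0 : W' != 0 by rewrite expf_neq0.
have Cw : C P0 (phi w) by apply: cone_chart_img => //; exists w => //; case: P0w.
have BW' : B W' by apply: CB; apply: subX.
have At : A (t / a).
  by apply: gA; split=> // _; exists 1, 0; split; [exact: sub1|exact: sub0|rewrite mul1r mul0r addr0].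
have AW' : A (W' / a).
  by apply: gA; split=> // _; exists 0, 1; split; [exact: sub0|exact: sub1|rewrite mul1r mul0r add0r].
(* Here x and z are the two generators of the ideal, ordered so that x/z lies in V. Then a/z = c
   (x/z) + d lies in V, so z/a is a unit there, and the chart of a may be replaced by that of z. *)
have key x z c d : z != 0 -> B c -> B d -> a = c * x + d * z -> A (x / a) -> A (z / a) -> V (x / z) ->
    loc V A (x / z) /\ (Y V (x / z) -> Y V (x / a) /\ Y V (z / a)).
  move=> z0 Bc Bd e Ax Az Vxz.
  have ei : (z / a)^-1 = c * (x / z) + d by rewrite invf_div e mulrDl mulfK // mulrA.
  have Vi : V (z / a)^-1.
    by rewrite ei; apply: subD => //; [apply: subM => //|]; apply: AV; apply: BA.
  split.
    have -> : x / z = (x / a) * (z / a)^-1 by field; rewrite a0 z0.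
    apply: subM => //; first exact: AL.
    by apply: loc_unit => //; [exact: AL|split=> //; [exact: AV|rewrite mulf_neq0 ?invr_eq0]].
  move=> Yxz; have Yz : Y V (z / a).
    rewrite -[z / a]invrK; apply: Y_unit; last by rewrite invrK; apply: AV.
    by rewrite ei; apply: subD => //; [apply: subM => //|]; apply: BY.
  split=> //; have -> : x / a = (x / z) * (z / a) by field; rewrite a0 z0.
  exact: subM.
have ea' : a = be * W' + al * t by rewrite addrC.
have er : phi w ^+ q / T = W' / t by rewrite -invf_div etq invf_div.
have etq' : tq = t / W' by rewrite etq.
have subY : Y V (t / a) -> Y V (W' / a) -> A `<=` Y V.
  move=> Yt YW; apply: adjoin_min => // _ [x [Bx hx] <-]; have [b [c [Bb Bc ->]]] := hx eZ.
  have -> : (b * t + c * phi w ^+ q.-1) / a = b * (t / a) + c * (W' / a) by rewrite mulrDl !mulrA.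
  by apply: subD => //; apply: subM => //; apply: BY.
have CL : C P0 `<=` loc V A by move=> x /CA/AL.
have rI : subring (phi @` P0) by apply: rimg.
have [e|n] := pselect (VF phi V = P0); last first.
  have hi : VF phi V w^-1.
    have [eT|nT] := pselect (VF phi V = setT); first by rewrite eT.
    exfalso; apply: n; apply/esym; apply: (place_incomp hF hP0 (VF_place hE vV RV nT)) => f Pf.
    by apply: CV; apply: cone_chart_img => //; exists f.
  have Ys : Y V (t / W').
    apply: subM => //; first exact: BY.
    by rewrite -exprVn -fmorphV; apply: subX => //; apply: img_Y; exists w^-1.
  have [_ /(_ Ys)[h1 h2]] := key t W' al be W'0 Bal Bbe ea At AW' (YV Ys).
  apply: (Y_eq hP0 vV rA); first exact: subY.
  apply: subset_trans (off_chart hP0 CV n) _; exact: loc_mono.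
have [h|h] := pselect (V tq).
  have [Ls hY] := key t W' al be W'0 Bal Bbe ea At AW' (eq_ind _ V h _ etq').
  have Ys : Y V (t / W') by rewrite -etq'; apply: cY; rewrite chart_1 //; apply: polyring_gen.
  have [h1 h2] := hY Ys; apply: (Y_eq hP0 vV rA); first exact: subY.
  rewrite chart_1 //; apply: polyring_min; [exact: loc_subring| |by rewrite etq'].
  by apply: subset_trans CL; apply: cone_chart_img.
have Vr : V (W' / t) by rewrite -er; apply: V_wT.
have [Lr hY] := key W' t be al t0 Bbe Bal ea' AW' At Vr.
have Yr : Y V (W' / t) by rewrite -er; apply: cY; rewrite chart_2 //; apply: polyring_gen; apply: polyring_subring.
have [h2 h1] := hY Yr; apply: (Y_eq hP0 vV rA); first exact: subY.
rewrite chart_2 //; apply: polyring_min; [exact: loc_subring| |by rewrite er].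
apply: polyring_min; [exact: loc_subring| |by apply: CL; apply: cone_chart_t].
by apply: subset_trans CL; apply: cone_chart_img.
Qed.
(** At the fat point the generator that is minimal for V is inverted: w^(q-1) if V contains T/w^q,
    and t otherwise. *)
Lemma fat_chart : exists B a, [/\ resolution B, fat B a, a != 0 &
  adjoin B [set x / a | x in fat B] `<=` V].
Proof.
have at1 P : place iota P -> C P `<=` V -> loc V (C P) <> zero_point ->
    exists B a, [/\ resolution B, fat B a, a != 0 & adjoin B [set x / a | x in fat B] `<=` V].
  move=> hP CV nz; have rC := cone_chart_subring hP; have LV := loc_sub rV CV.
  exists (loc V (C P)), 1; split; rewrite ?oner_neq0 //.
  - by exists P => //; apply: spec_loc.
  - by split=> //; apply: sub1; apply: loc_subring.
  - by apply: adjoin_min => // _ [x [Lx _] <-]; rewrite divr1; apply: LV.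
have off P : place iota P -> P `<=` VF phi V -> P <> P0 -> C P `<=` V.
  move=> hP sP n; rewrite /C asboolF //; apply: polyring_min => //; last by apply: RV; apply: coneT.
  by move=> _ [f /sP Vf <-].
have nz P : place iota P -> C P `<=` V -> P <> P0 -> loc V (C P) <> zero_point.
  by move=> hP CV n e; have [] := loc_zero_pointP vV hP CV e.
have [eT|nT] := pselect (VF phi V = setT).
  have [P hP nP] := other_place hE hP0; apply: (at1 P) => //; last apply: nz => //; by apply: off => //; rewrite eT.
have hV := VF_place hE vV RV nT.
have [e|n] := pselect (VF phi V = P0); last first.
  by apply: (at1 (VF phi V)) => //; last apply: nz => //; apply: off.
have Vt : V t := V_Tw hE gT hP0 ow w0 vV RV e.
have CV : C P0 `<=` V.
  rewrite /C asboolT //; apply: polyring_min => // _ [f Pf <-].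
  by have : VF phi V f by rewrite e.
have [eZ|] := pselect (loc V (C P0) = zero_point); last exact: (at1 P0).
have rC := cone_chart_subring hP0; have LV := loc_sub rV CV.
have sB : resolution zero_point by exists P0 => //; rewrite -eZ; apply: spec_loc.
have rZ : subring zero_point by rewrite -eZ; apply: loc_subring.
have ZV : zero_point `<=` V by rewrite -eZ.
have Zw : zero_point (phi w ^+ q.-1).
  rewrite -eZ; apply: sub_loc => //; apply: subX => //; apply: cone_chart_img => //.
  by exists w => //; case: P0w.
have [Zt _] := zero_point_t.
have [h|h] := pselect (V tq).
  exists zero_point, (phi w ^+ q.-1); split; rewrite ?expf_neq0 //.
    by split=> // _; exists 0, 1; split; [exact: sub0|exact: sub1|rewrite mul1r mul0r add0r].
  apply: adjoin_min => // _ [x [Zx hx] <-]; have [b [c [Zb Zc ->]]] := hx erefl.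
  rewrite mulrDl mulfK ?expf_neq0 // -mulrA -etq; apply: subD => //; last exact: ZV.
  by apply: subM => //; apply: ZV.
exists zero_point, t; split=> //.
  by split=> // _; exists 1, 0; split; [exact: sub1|exact: sub0|rewrite mul1r mul0r addr0].
apply: adjoin_min => // _ [x [Zx hx] <-]; have [b [c [Zb Zc ->]]] := hx erefl.
rewrite mulrDl mulfK // -mulrA; apply: subD => //; first exact: ZV.
apply: subM => //; first exact: ZV.
have -> : phi w ^+ q.-1 / t = phi w ^+ q / T by rewrite -[RHS]invf_div etq [RHS]invf_div.
exact: V_wT.
Qed.

End OverCone.

Lemma blowup_fat : blowup resolution fat = [set Y V | V in [set V | valuation_ring V /\ cone `<=` V]].
Proof.
rewrite eqEsubset; split=> [B' [B [a [RB Ia a0 sB]]]|_ [V [vV RV] <-]].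
  have [V [vV AV eB]] := loc_spec (adjoin_subring _ _) sB.
  have RV : cone `<=` V.
    have [P hP sP] := RB => x /(cone_sub_chart_at hP) Cx; apply: AV; apply: sub_adjoin.
    exact: (spec_sub (cone_chart_subring hP) sP).
  by exists V => //; rewrite eB (loc_fat vV RV RB Ia a0 AV).
have [B [a [RB Ia a0 AV]]] := fat_chart vV RV; exists B, a; split=> //.
rewrite -(loc_fat vV RV RB Ia a0 AV); apply: spec_loc => //; exact: adjoin_subring.
Qed.

End Blowup.

Lemma fraction_ex (R : idomainType) (z : {fraction R}) :
  exists n d, d != 0 /\ z = tofrac n / tofrac d.
Proof.
exists \n_(repr z)%qT, \d_(repr z)%qT; split; first exact: denom_ratioP.
have d0 : tofrac \d_(repr z)%qT != 0 by rewrite tofrac_eq0 denom_ratioP.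
apply: (mulIf d0); rewrite divfK //.
unlock tofrac; rewrite -{1}[z]reprK -[LHS]FracField.pi_mul.
apply/eqmodP; rewrite /= FracField.equivfE /FracField.mulf !numden_Ratio ?mulr1 ?oner_neq0 ?denom_ratioP //.
by rewrite mulrC.
Qed.

Lemma pnat_pchar (L L' : fieldType) (mu : {rmorphism L -> L'}) p e :
  p \in [pchar L] -> [pchar L'].-nat (p ^ e)%N.
Proof.
move=> hp; have hp' : p \in [pchar L'] by rewrite (fmorph_pchar mu).
by rewrite pnatX pnatE ?hp' // (pcharf_prime hp).
Qed.

Lemma blowup_ext (K : fieldType) (M : set (set K)) (I J : set K -> set K) :
  (forall B, M B -> I B = J B) -> blowup M I = blowup M J.
Proof.
move=> h; rewrite eqEsubset; split=> B' [B [a [MB Ba a0 sB]]]; exists B, a; split=> //.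
- by rewrite -h.
- by rewrite -h.
- by rewrite h.
- by rewrite h.
Qed.

Lemma span_units (K : fieldType) (B : set K) (x y c d z : K) : subring B ->
  unit_in B x -> unit_in B y ->
  (exists a b, [/\ B a, B b & z = a * (x * c) + b * (y * d)]) <->
  (exists a b, [/\ B a, B b & z = a * c + b * d]).
Proof.
move=> rB [Bx x0 Bx'] [By y0 By']; split=> -[a [b [Ba Bb ->]]].
  by exists (a * x), (b * y); split; rewrite ?mulrA //; apply: subM.
by exists (a * x^-1), (b * y^-1); split; rewrite -?mulrA ?mulKf //; apply: subM.
Qed.

(** * Coordinates on the minimal resolution *)

Section FractionField.
Variable F : fieldType.
Local Notation K := {fraction {poly F}}.

Definition const_frac : {rmorphism F -> K} := (@tofrac {poly F}) \o polyC.
Local Notation phi := const_frac.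
Local Notation X0 := (tofrac ('X : {poly F})).

Lemma ev_frac f : ev phi X0 f = tofrac f.
Proof.
rewrite (evE phi X0 (leqnn _)) -[f in RHS]coefK poly_def (rmorph_sum (@tofrac {poly F})).
by apply: eq_bigr => i _; rewrite -mul_polyC rmorphM rmorphXn.
Qed.

Lemma generates_frac : generates phi X0.
Proof.
split=> [f|z]; first by rewrite ev_frac => /eqP; rewrite tofrac_eq0 => /eqP.
by have [f [g [g0 ->]]] := fraction_ex z; exists f, g; rewrite !ev_frac.
Qed.

Definition rescale (c : F) (f : {poly F}) : {poly F} := f \Po (c *: 'X).

Lemma coef_rescale c f n : (rescale c f)`_n = f`_n * c ^+ n.
Proof.
rewrite /rescale comp_polyE coef_sum.
have e (i : 'I_(size f)) : (f`_i *: (c *: 'X) ^+ i)`_n = if i == n :> nat then f`_n * c ^+ n else 0.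
  by rewrite exprZn !coefZ coefXn eq_sym; case: eqP => [->|_]; rewrite ?mulr1 ?mulr0.
under eq_bigr do rewrite e.
case: (ltnP n (size f)) => [lt|le]; last first.
  rewrite nth_default // mul0r big1 // => i _; by case: eqP.
by rewrite (bigD1 (Ordinal lt)) //= eqxx big1 ?addr0 // => i; rewrite -val_eqE => /negPf ->.
Qed.

Lemma rescaleK c f : c != 0 -> rescale c (rescale c^-1 f) = f.
Proof.
move=> c0; apply/polyP => n; rewrite !coef_rescale -mulrA -exprMn mulVf //.
by rewrite expr1n mulr1.
Qed.

Lemma image_rescale c (S : set {poly F}) : c != 0 ->
  [set tofrac f | f in S] = [set ev phi (phi c * X0) f | f in [set f | S (rescale c f)]].
Proof.
move=> c0; rewrite eqEsubset; split=> _ [f hf <-].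
  exists (rescale c^-1 f); first by rewrite /= rescaleK.
  by rewrite -ev_comp -/(rescale _ _) rescaleK // ev_frac.
by exists (rescale c f) => //; rewrite -ev_frac /rescale ev_comp.
Qed.

End FractionField.

Lemma conormal_stalkE (k : closedFieldType) (F : fieldType) (iota : {rmorphism k -> F}) D P :
  function_field_1 iota -> place iota P -> conormal_stalk D P = stalk D P.
Proof.
move=> hF hP; rewrite eqEsubset; split=> [_ [f [hf _] <-]|f hf]; first exact: (hf 1%N).
exists (f *: 'X); last by rewrite coefZ coefX mulr1.
split; last by rewrite coefZ coefX mulr0.
move=> [|[|n]] /=; rewrite coefZ coefX ?mulr1 //.
  by rewrite mulr0; apply/(stalkE hF hP); left.
by rewrite mulr0; apply/(stalkE hF hP); left.
Qed.

Lemma divisor_of_stalk (k : closedFieldType) (F : fieldType) (iota : {rmorphism k -> F}) D C P :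
  function_field_1 iota -> place iota P -> stalk D P `<=` stalk C P -> D P <= C P.
Proof.
move=> hF hP sub; have [x x0 ox] := elem_ord hF hP (- D P).
have : stalk D P x by apply/(stalkE hF hP); right; rewrite ox.
by move=> /sub/(stalkE hF hP)/(vge_neq0 _ _ x0); rewrite ox lerN2.
Qed.

Section Ruled.
Variables (k : closedFieldType) (F : fieldType) (iota : {rmorphism k -> F}).
Hypothesis hE : elliptic_curve iota.
Let hF : function_field_1 iota := proj1 hE.
Variables (D : set F -> int) (P0 : set F) (hP0 : place iota P0).
Variables (h : F) (h0 : h != 0).
Hypothesis eD : forall P, place iota P -> D P = point_divisor P0 P - ord P h.
Variables (w : F) (ow : ord P0 w = 1) (w0 : w != 0).
Local Notation K := {fraction {poly F}}.
Local Notation phi := (const_frac F).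
Local Notation T := (phi h * tofrac 'X).
Local Notation Hn n := (Hn iota P0 n%N).

Lemma section_ring_cone :
  [set tofrac f | f in section_ring iota D] = cone iota phi T P0.
Proof.
rewrite (image_rescale _ h0) /cone; congr (_ @` _); apply/funext => f; apply/propext.
split=> hf n; have := hf n; rewrite coef_rescale => /(H0P hF) hn.
  apply/(HnE hE) => P hP; apply/(vge_shift hF hP _ _ (expf_neq0 n h0)).
  by have := hn P hP; rewrite eD // mulrnBl opprB addrC (ordX hF hP).
apply/(H0P hF) => P hP; move/(HnE hE)/(_ P hP): (hf n).
by move/(vge_shift hF hP _ _ (expf_neq0 n h0)); rewrite eD // mulrnBl opprB addrC (ordX hF hP).
Qed.

Lemma cone_algebra_rescale P c f : place iota P -> c != 0 -> ord P c = - D P ->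
  cone_algebra D P (rescale c f) <-> polyover P f.
Proof.
move=> hP c0 oc; split=> hf n; have := hf n; rewrite ?coef_rescale.
  move/(stalkE hF hP) => hn; apply/(place_ord hF hP); apply/(vge_shift hF hP _ _ (expf_neq0 n c0)).
  by rewrite add0r (ordX hF hP) // oc mulNrn.
move/(place_ord hF hP)/(vge_shift hF hP _ _ (expf_neq0 n c0)).
by rewrite add0r (ordX hF hP) // oc mulNrn => hn; apply/(stalkE hF hP).
Qed.

Let gT : generates phi T. Proof. exact: generates_scale (generates_frac F) h0. Qed.

Let ehw : T / phi w = phi (h / w) * tofrac 'X.
Proof. by rewrite fmorph_div mulrAC. Qed.

Let ohw : ord P0 (h / w) = - D P0.
Proof. by rewrite (ord_div hF hP0) // ow eD // /point_divisor eqxx opprB. Qed.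

Let hw0 : h / w != 0. Proof. by rewrite mulf_neq0 ?invr_eq0. Qed.

Lemma cone_algebra_chart P : place iota P ->
  [set tofrac f | f in cone_algebra D P] = cone_chart_at phi T P0 w P.
Proof.
move=> hP; rewrite /cone_chart_at polyring_image.
case: asboolP => [->|n].
  rewrite ehw (image_rescale _ hw0); congr (_ @` _); apply/funext => f; apply/propext.
  exact: cone_algebra_rescale.
rewrite (image_rescale _ h0); congr (_ @` _); apply/funext => f; apply/propext.
by apply: cone_algebra_rescale => //; rewrite eD // /point_divisor; move/eqP/negPf: n => ->; rewrite sub0r opprK.
Qed.

Lemma zero_section_pointE : zero_section_point D P0 = zero_point phi T P0 w.
Proof.
rewrite /zero_section_point /zero_point cone_algebra_chart //; congr localization.
rewrite ehw (image_rescale _ hw0); congr (_ @` _); apply/funext => f; apply/propext => /=.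
by rewrite coef_rescale expr0 mulr1 cone_algebra_rescale.
Qed.

Lemma min_resolutionE : min_resolution iota D = resolution iota phi T P0 w.
Proof.
by rewrite eqEsubset; split=> B [P hP sB]; exists P => //; move: sB; rewrite cone_algebra_chart.
Qed.

Lemma zero_point_unit x : x != 0 -> ord P0 x = 0 -> zero_point phi T P0 w (phi x).
Proof.
move=> x0 ox; apply: (cone_chart_zero_point gT hP0 w0); apply: (cone_chart_img _ _ _ hP0).
by exists x => //; apply/(place_ord hF hP0); right; rewrite ox.
Qed.

(** Another trivialization of L and another parameter change the two generators by functions that
    are units at P0, so g and u may be replaced by h/w and w. *)
Lemma fat_point_idealE q g u B : trivialization D P0 g -> uniformizer P0 u -> subring B ->
  fat_point_ideal D q P0 g u B = fat phi T P0 q w B.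
Proof.
move=> tg hu rB.
have [x x0 ox] := elem_ord hF hP0 (- D P0).
have [a Pa ex] : [set g * a | a in P0] x by rewrite -tg; apply/(stalkE hF hP0); right; rewrite ox.
have g0 : g != 0 by apply: contra_neq x0 => z; rewrite -ex z mul0r.
have a0 : a != 0 by apply: contra_neq x0 => z; rewrite -ex z mulr0.
have og : ord P0 g = - D P0.
  have : stalk D P0 g by rewrite tg; exists 1; rewrite ?mulr1 //; apply: sub1; apply: place_sub hP0.
  move=> /(stalkE hF hP0)/(vge_neq0 _ _ g0).
  move/(place_ord hF hP0)/(vge_neq0 _ _ a0): Pa.
  by move: ox; rewrite -ex (ordM hF hP0) //; lia.
have [u0 _ _] := (uniformizerP hP0 u).1 hu; have ou := ord_uniformizer hP0 hu.
pose v := g / (h / w); pose y := (u / w) ^+ q.-1.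
have v0 : v != 0 by rewrite mulf_neq0 ?invr_eq0.
have y0 : y != 0 by rewrite expf_neq0 // mulf_neq0 ?invr_eq0.
have ov : ord P0 v = 0 by rewrite (ord_div hF hP0) // ohw og subrr.
have oy : ord P0 y = 0.
  by rewrite (ordX hF hP0) ?mulf_neq0 ?invr_eq0 // (ord_div hF hP0) // ou ow subrr mul0rn.
have et : tofrac (g *: 'X) = phi v * (T / phi w).
  have eg : g = v * (h / w) by rewrite /v divfK.
  transitivity (phi g * tofrac 'X); first by rewrite -mul_polyC rmorphM.
  by rewrite {1}eg (rmorphM phi) ehw mulrA.
have eu : tofrac (u ^+ q.-1)%:P = phi y * phi w ^+ q.-1.
  by rewrite -rmorphXn -(rmorphM phi) /y expr_div_n divfK // expf_neq0.
have inv z : z != 0 -> ord P0 z = 0 -> z^-1 != 0 /\ ord P0 z^-1 = 0.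
  by move=> z0 oz; rewrite invr_eq0 (ordV hF hP0) // oz oppr0.
have zu z : z != 0 -> ord P0 z = 0 -> B = zero_point phi T P0 w -> unit_in B (phi z).
  move=> z0 oz ->; split; [exact: zero_point_unit|by rewrite fmorph_eq0|].
  by rewrite -fmorphV; apply: zero_point_unit; have [] := inv z z0 oz.
rewrite /fat_point_ideal /fat zero_section_pointE et eu; apply/funext => z; apply/propext.
split=> -[Bz hz]; split=> // eB; have Bv := zu v v0 ov eB; have By := zu y y0 oy eB.
  exact: (span_units _ _ _ rB Bv By).1 (hz eB).
exact: (span_units _ _ _ rB Bv By).2 (hz eB).
Qed.

End Ruled.

Theorem theorem4p13
  (k : closedFieldType) (p : nat) (char_k : p \in [pchar k])
  (* the elliptic curve E over k, with function field F, and L = O_E(D) *)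
  (F : fieldType) (iota : {rmorphism k -> F})
  (E_elliptic : elliptic_curve iota)
  (D : set F -> int) (D_divisor : divisor iota D)
  (L_ample : 0 < degree iota D)
  (* X = Spec R with R = R(E, L), not F-pure *)
  (R : comNzRingType) (j : {rmorphism R -> {poly F}})
  (j_inj : injective j) (j_range : range j = section_ring iota D)
  (X_not_F_pure : ~ F_pure p R)
  (E_square : zero_section_square iota D (-1))
  (P0 : set F) (P0_place : place iota P0)
  (P0_conormal : conormal_is_point iota D P0)
  (g : F) (g_triv : trivialization D P0 g)
  (u : F) (u_param : uniformizer P0 u)
  (e : nat) (e_ge1 : (1 <= e)%N)
  (FB : set (set {fraction {poly F}}))
  (FB_blowup : is_F_blowup (p ^ e) (range (fun r => tofrac (j r))) FB) :
  blowup (min_resolution iota D) (fat_point_ideal D (p ^ e) P0 g u)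
  = normalization FB.
Proof.
have hE := E_elliptic; have hF : function_field_1 iota := proj1 hE.
have hp := pcharf_prime char_k; have p0 : (0 < p)%N := prime_gt0 hp.
have q2 : (1 < p ^ e)%N by rewrite -(exp1n e) ltn_exp2r ?prime_gt1.
have [h h0 eh] := P0_conormal.
have stD P x : place iota P -> stalk D P x <-> vge P (ord P h - point_divisor P0 P) x.
  move=> hP; rewrite -(conormal_stalkE D hF hP) eh //; split=> [[y hy <-]|hx].
    move/(stalkE hF hP)/(vge_shift hF hP _ _ h0): hy.
    by rewrite mulrC addrC.
  exists (x / h); last by rewrite mulrC divfK.
  by apply/(stalkE hF hP)/(vge_shift hF hP _ _ h0); rewrite divfK // addrC.
(* The stalks of O(D) determine D, so the isomorphism by h says that D is P0 minus the divisor of h;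
   T = h t is the resulting rescaled coordinate. *)
have eD P : place iota P -> D P = point_divisor P0 P - ord P h.
  move=> hP; pose E Q := point_divisor P0 Q - ord Q h.
  apply/eqP; rewrite eq_le -/(E P); apply/andP.
  split; apply: (divisor_of_stalk hF hP) => x.
    by move/(stD P x hP) => hx; apply/(stalkE hF hP); rewrite /E opprB.
  by move/(stalkE hF hP) => hx; apply/(stD P x hP); rewrite -opprB.
have dD : degree iota D = 1.
  have [C [dC eC dm]] := E_square; rewrite -[1]opprK dm opprK; apply: degree_ext => P hP.
  apply/eqP; rewrite eq_le; apply/andP.
  by split; apply: (divisor_of_stalk hF hP) => x; rewrite -eC // (conormal_stalkE D hF hP).
have no_tors P f (hP : place iota P) := no_torsion hE char_k D_divisor dD j_inj j_range X_not_F_pure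
  (e := e) (f := f) hP P0_place.
have [P1 hP1 nP1] := other_place hE P0_place.
have dP := divisor_point P0_place.
(* The divisor 3 P1 - P0 has degree 2, the least for which sections with exact order are available;
   one of them is a uniformizer at P0 with poles only at P1. *)
have dC := divisorD (divisor_mulpt 3 hP1) (divisorN dP).
have [|w wH [w0 ow']] := section_exact hE dC P0_place.
  by rewrite (degreeD (divisor_mulpt 3 hP1) (divisorN dP)) (degreeN dP) degree_mulpt // degree_point.
have ow : ord P0 w = 1.
  by rewrite ow' /point_divisor eqxx; move/eqP/negPf: nP1; rewrite eq_sym => ->.
have wreg : regular_off iota P1 w.
  move=> Q hQ nQ; apply: vge_le ((H0P hF _ _).1 wH Q hQ).
  by rewrite /point_divisor; move/eqP/negPf: nQ => ->; case: (Q == P0).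
have gT := generates_scale (generates_frac F) h0.
have eR : range (fun r => tofrac (j r)) = cone iota (const_frac F) (const_frac F h * tofrac 'X) P0.
  rewrite -(section_ring_cone hE h0 eD) -j_range.
  by rewrite eqEsubset; split=> [_ [r _ <-]|_ [_ [r _ <-] <-]]; [exists (j r) => //|]; exists r.
rewrite eR in FB_blowup.
have hq := pnat_pchar iota e char_k.
have hqK := pnat_pchar (const_frac F) e (etrans (fmorph_pchar iota p) char_k).
rewrite (normalization_FB hE gT P0_place q2 hq hqK no_tors ow w0 hP1 nP1 wreg FB_blowup).
rewrite -(blowup_fat hE gT P0_place q2 ow w0).
rewrite (min_resolutionE hE P0_place h0 eD ow w0); apply: blowup_ext => B [P hP sB].
apply: (fat_point_idealE hE P0_place h0 eD ow w0 _ g_triv u_param).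
by apply: spec_subring sB; apply: cone_chart_subring hP.
Qed.
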